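(* Let $N\ge2$ and let $\pi$ be a unitary representation of $BS(1,N)$ on a nonzero Hilbert space such that the restriction of $\pi$ to the subgroup $\mathbb{Z}[1/N]$ has a cyclic vector. Then there exist a Borel probability measure $\nu$ on $\mathcal{S}_N$ that is quasi-invariant for $S$ and a measurable map $\theta:\mathcal{S}_N\to\mathbb{T}$ such that $\pi$ is unitarily equivalent to $\pi_{\nu,\theta}$.
   Context: $BS(1,N)=\langle u,t\mid utu^{-1}=t^N\rangle$; the subgroup $\mathbb{Z}[1/N]$ is $\{u^{-p}t^ku^{p}\mid k\in\mathbb{Z},\,p\ge 0\}$, with $k/N^p\in\mathbb{Z}[1/N]$ corresponding to $u^{-p}t^ku^p$. $\mathbb{T}=\{z\in\mathbb{C}:|z|=1\}$. The solenoid is the compact group $\mathcal{S}_N=\{(z_n)_{n\in\mathbb{Z}}\mid z_{n+1}^N=z_n,\ |z_n|=1 \text{ for all } n\in\mathbb{Z}\}$, and $S$ is the shift $S(z_n)_{n}=(z_{n-1})_{n}$. For a Borel measure $\nu$ on $\mathcal{S}_N$, $\nu\circ S$ is the measure $E\mapsto\nu(S(E))$; $\nu$ is quasi-invariant for $S$ if $\nu\circ S$ and $\nu$ are mutually absolutely continuous. For such a $\sigma$-finite $\nu$ and measurable $\theta:\mathcal{S}_N\to\mathbb{T}$, put $\Delta=\frac{d(\nu\circ S)}{d\nu}$; $\pi_{\nu,\theta}$ is the unitary representation of $BS(1,N)$ on $L^2(\nu)$ with $\pi_{\nu,\theta}(u)=U$, $\pi_{\nu,\theta}(t)=T$, where $U\xi=\sqrt{\Delta}\,\theta\,(\xi\circ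 S)$ and $(T\xi)((z_n)_n)=z_0\,\xi((z_n)_n)$. *)

(* Defs.v *)
From HB Require Import structures.
From mathcomp Require Import all_boot all_order all_algebra.
From mathcomp Require Import complex generic_quotient ring_quotient.
From mathcomp Require Import ring lra.
From mathcomp Require Import all_classical all_reals all_analysis.
From mathcomp Require Import measurable_realfun.
Import Order.TTheory GRing.Theory Num.Theory.
Import numFieldTopology.Exports numFieldNormedType.Exports.
Set Implicit Arguments. Unset Strict Implicit. Unset Printing Implicit Defensive.
Local Open Scope classical_set_scope.
Local Open Scope ring_scope.

HB.mixin Record hasInnerProduct (C : numClosedFieldType) V
    of GRing.Lmodule C V := {
  inner : {dot V for (@Num.conj C : C -> C)}
}.

#[short(type="preHilbertType")]
HB.structure Definition PreHilbert (C : numClosedFieldType) :=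
  {V of GRing.Lmodule C V & hasInnerProduct C V}.

HB.mixin Record isHilbert (C : numClosedFieldType) V
    of CompleteNormedModule C V & hasInnerProduct C V := {
  innerxx : forall x : V, (inner : {dot V for Num.conj}) x x = `|x| ^+ 2
}.

#[short(type="hilbertType")]
HB.structure Definition Hilbert (C : numClosedFieldType) :=
  {V of CompleteNormedModule C V & PreHilbert C V & isHilbert C V}.

HB.instance Definition _ (R : realType) := NormedModule.copy R[i] R[i]^o.

(* the Borel sigma-algebra of the complex numbers *)
HB.instance Definition _ (R : realType) :=
  Measurable.copy R[i] (g_sigma_algebraType (@open R[i])).

Section complex_measurability.
Context {R : realType}.
Local Notation Re := (@complex.Re R).
Local Notation Im := (@complex.Im R).

Lemma normc_leD (z : R[i]) : `|z| <= (`|Re z| + `|Im z|)%:C%C.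
Proof.
rewrite normc_def lecR; set a := Re z; set b := Im z.
rewrite -[leRHS]ger0_norm ?addr_ge0// -sqrtr_sqr ler_wsqrtr// sqrrD.
rewrite !real_normK ?num_real// addrAC lerDl mulrn_wge0// mulr_ge0//.
Qed.

Lemma normc_geIm (z : R[i]) : `|Im z|%:C%C <= `|z|.
Proof.
rewrite normc_def lecR -sqrtr_sqr ler_wsqrtr// lerDr sqr_ge0//.
Qed.

Lemma continuous_Re : continuous Re.
Proof.
move=> z; apply/(@cvgrPdist_lt _ _ _ _ (nbhs_filter z)) => e e0.
have ze : \forall w \near z, `|z - w| < e%:C%C.
  by exists e%:C%C => //=; rewrite ltcR.
apply: (@filterS _ _ (nbhs_filter z)) ze => w zwe; rewrite -ltcR; apply: le_lt_trans zwe.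
by rewrite -raddfB; exact: normc_ge_Re.
Qed.

Lemma continuous_Im : continuous Im.
Proof.
move=> z; apply/(@cvgrPdist_lt _ _ _ _ (nbhs_filter z)) => e e0.
have ze : \forall w \near z, `|z - w| < e%:C%C.
  by exists e%:C%C => //=; rewrite ltcR.
apply: (@filterS _ _ (nbhs_filter z)) ze => w zwe; rewrite -ltcR; apply: le_lt_trans zwe.
by rewrite -raddfB; exact: normc_geIm.
Qed.


Lemma measurable_continuous_complex (f : R[i] -> R) :
  continuous f -> measurable_fun setT f.
Proof.
move=> cf; apply: (measurability _ (RGenOpens.measurableE R)).
move=> _ [_ [a [b ->] <-]]; rewrite setTI.
apply: sub_sigma_algebra; apply: open_comp; first by move=> z _; exact: cf.
exact: interval_open.
Qed.

Lemma measurable_Re d (T : measurableType d) (f : T -> R[i]) :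
  measurable_fun setT f -> measurable_fun setT (Re \o f).
Proof.
by move=> mf; apply: measurableT_comp mf; apply: measurable_continuous_complex;
  exact: continuous_Re.
Qed.

Lemma measurable_Im d (T : measurableType d) (f : T -> R[i]) :
  measurable_fun setT f -> measurable_fun setT (Im \o f).
Proof.
by move=> mf; apply: measurableT_comp mf; apply: measurable_continuous_complex;
  exact: continuous_Im.
Qed.

Definition csquare (p : rat * rat * rat) : set R[i] :=
  [set z | `|Re z - ratr p.1.1| < ratr p.2 /\ `|Im z - ratr p.1.2| < ratr p.2].

Lemma measurable_complexP d (T : measurableType d) (f : T -> R[i]) :
  measurable_fun setT f <->
  measurable_fun setT (Re \o f) /\ measurable_fun setT (Im \o f).
Proof.
split=> [mf|[mr mi]]; first by split; [exact: measurable_Re|exact: measurable_Im].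
apply: (@measurability _ _ _ _ _ _ (@open R[i])) => //.
move=> _ [U oU <-]; rewrite setTI.
have -> : f @^-1` U = \bigcup_p
   (if `[< csquare p `<=` U >] then f @^-1` csquare p else set0).
  apply/seteqP; split=> [x /= Ufx|x [p _]]; last first.
    by case: ifPn => // /asboolP; apply.
  have [e /= e0 eU] : nbhs (f x) U by exact: open_nbhs_nbhs.
  have er : e = (Re e)%:C%C by apply/eqP; rewrite eq_complex/= eqxx/=;
    move: e0; rewrite ltcE /= => /andP[/eqP->].
  have e0' : 0 < Re e by move: e0; rewrite er ltcR.
  have e40 : 0 < Re e / 4 by rewrite divr_gt0.
  have [r] := rat_in_itvoo e40; rewrite in_itv/= => /andP[r0 re].
  have [a] : exists a : rat, ratr a \in `](Re (f x) - ratr r), (Re (f x) + ratr r)[.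
    by apply: rat_in_itvoo; rewrite ltrBlDr -addrA ltrDl addr_gt0.
  have [b] : exists b : rat, ratr b \in `](Im (f x) - ratr r), (Im (f x) + ratr r)[.
    by apply: rat_in_itvoo; rewrite ltrBlDr -addrA ltrDl addr_gt0.
  rewrite !in_itv/= -!ltr_distlC => br ar.
  exists (a, b, r) => //; case: ifPn => [_|/asboolP]; first by split.
  case=> z [/= zr zi]; apply: eU => /=; rewrite er.
  apply: le_lt_trans (normc_leD _) _; rewrite ltcR !raddfB/=.
  have : `|Re (f x) - Re z| < ratr r + ratr r.
    by rewrite (le_lt_trans (ler_distD (ratr a) _ _))// ltrD// distrC.
  have : `|Im (f x) - Im z| < ratr r + ratr r.
    by rewrite (le_lt_trans (ler_distD (ratr b) _ _))// ltrD// distrC.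
  lra.
apply: countable_bigcupT_measurable; first exact: countableP.
move=> p; case: ifPn => // _.
have -> : f @^-1` csquare p =
  (Re \o f) @^-1` (ball (ratr p.1.1 : R) (ratr p.2)) `&`
  (Im \o f) @^-1` (ball (ratr p.1.2 : R) (ratr p.2)).
  by apply/seteqP; split => x /=; rewrite /csquare/= /ball/= ![`|ratr _ - _|]distrC.
by apply: measurableI; rewrite -[X in measurable X]setTI;
  [apply: mr|apply: mi] => //; apply: open_measurable; exact: ball_open.
Qed.

End complex_measurability.

Definition sqr_modulus (R : realType) (z : R[i]) : R := complex.Re (`|z| ^+ 2).
Arguments sqr_modulus : simpl never.

Section square_integrable.
Context d (T : measurableType d) (R : realType).
Variable mu : {measure set T -> \bar R}.
Local Notation Re := (@complex.Re R).
Local Notation Im := (@complex.Im R).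
Implicit Types (f g : T -> R[i]) (a b : T -> R).

Definition square_integrable f : Prop :=
  measurable_fun setT f /\ (\int[mu]_x (sqr_modulus (f x))%:E < +oo)%E.

Definition cintegral f : R[i] :=
  Complex (\int[mu]_x Re (f x))%R (\int[mu]_x Im (f x))%R.

Definition real_sqint a : Prop :=
  measurable_fun setT a /\ mu.-integrable setT (EFin \o (fun x => a x ^+ 2)).

Lemma sqr_modulusE (z : R[i]) : sqr_modulus z = Re z ^+ 2 + Im z ^+ 2.
Proof.
rewrite /sqr_modulus normc_def -rmorphXn/= sqr_sqrtr// addr_ge0 ?sqr_ge0//.
Qed.

Lemma square_integrableP f : square_integrable f <->
  real_sqint (Re \o f) /\ real_sqint (Im \o f).
Proof.
rewrite /square_integrable measurable_complexP; split.
- move=> [[mr mi] fi].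
  have intf : mu.-integrable setT
      (EFin \o (fun x => Re (f x) ^+ 2 + Im (f x) ^+ 2)).
    apply/integrableP; split.
      apply/measurable_EFinP; apply: measurable_funD; exact: measurable_funX.
    apply: le_lt_trans fi; apply: ge0_le_integral => //=.
    + do 2 apply/measurableT_comp => //.
      by apply: measurable_funD; exact: measurable_funX.
    + apply/measurable_EFinP. under eq_fun do rewrite sqr_modulusE.
      by apply: measurable_funD; exact: measurable_funX.
    + by move=> x _; rewrite sqr_modulusE ger0_norm// addr_ge0 ?sqr_ge0.
  split; split => //; apply: le_integrable intf => //=.
  + by apply/measurable_EFinP; exact: measurable_funX.
  + by move=> x _; rewrite lee_fin !ger0_norm ?addr_ge0 ?sqr_ge0// lerDl sqr_ge0.
  + by apply/measurable_EFinP; exact: measurable_funX.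
  + by move=> x _; rewrite lee_fin !ger0_norm ?addr_ge0 ?sqr_ge0// lerDr sqr_ge0.
- move=> [[mr ir] [mi ii]]; split => //.
  have /integrableP[_] := integrableD measurableT ir ii.
  apply: le_lt_trans; apply: ge0_le_integral => //=.
  + by move=> x _; rewrite sqr_modulusE lee_fin addr_ge0 ?sqr_ge0.
  + apply/measurable_EFinP; under eq_fun do rewrite sqr_modulusE.
    by apply: measurable_funD; exact: measurable_funX.
  + do 2 apply/measurableT_comp => //.
    by apply: measurable_funD; exact: measurable_funX.
  + by move=> x _; rewrite sqr_modulusE lee_fin ler_norm.
Qed.

Lemma real_sqintM a b : real_sqint a -> real_sqint b ->
  mu.-integrable setT (EFin \o (fun x => a x * b x)).
Proof.
move=> [ma ia] [mb ib].
apply: le_integrable (integrableD measurableT ia ib) => //=.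
  by apply/measurable_EFinP; exact: measurable_funM.
move=> x _; rewrite lee_fin [leRHS]ger0_norm ?addr_ge0 ?sqr_ge0//.
have := sqr_ge0 (a x + b x); have := sqr_ge0 (a x - b x).
have := sqr_ge0 (a x); have := sqr_ge0 (b x).
rewrite ler_norml; nra.
Qed.

Lemma real_sqintD a b : real_sqint a -> real_sqint b -> real_sqint (fun x => a x + b x).
Proof.
move=> La Lb; split; first by apply: measurable_funD; [case: La|case: Lb].
rewrite (_ : _ \o _ = (fun x => ((a x ^+ 2)%:E + (b x ^+ 2)%:E)
   + ((a x * b x)%:E + (a x * b x)%:E)))%E; last first.
  by apply/funext => x /=; rewrite -!EFinD; congr EFin; ring.
apply: integrableD => //; apply: integrableD => //;
  [exact: La.2|exact: Lb.2|exact: real_sqintM|exact: real_sqintM].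
Qed.

Lemma real_sqintZ (r : R) a : real_sqint a -> real_sqint (fun x => r * a x).
Proof.
move=> [ma ia]; split; first exact: measurable_funM.
rewrite (_ : _ \o _ = (fun x => (r ^+ 2)%:E * (a x ^+ 2)%:E))%E; last first.
  by apply/funext => x /=; rewrite -EFinM exprMn.
exact: integrableZl.
Qed.

Lemma real_sqint0 : real_sqint (fun=> 0).
Proof.
split => //; rewrite (_ : _ \o _ = cst 0%E); first exact: integrable0.
by apply/funext => x /=; rewrite expr0n.
Qed.

Definition square_integrable_pred : {pred (T -> R[i])} :=
  fun f => `[< square_integrable f >].

Lemma square_integrable_submod : GRing.subsemimod_closed square_integrable_pred.
Proof.
split; [split|].
- by apply/asboolP/square_integrableP; split; exact: real_sqint0.
- move=> f g /asboolP/square_integrableP[fr fi] /asboolP/square_integrableP[gr gi].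
  apply/asboolP/square_integrableP; split.
    rewrite (_ : _ \o _ = (fun x => Re (f x) + Re (g x))); first exact: real_sqintD.
    by apply/funext => x; rewrite /= raddfD.
  rewrite (_ : _ \o _ = (fun x => Im (f x) + Im (g x))); first exact: real_sqintD.
  by apply/funext => x; rewrite /= raddfD.
- move=> k f /asboolP/square_integrableP[fr fi]; apply/asboolP/square_integrableP; split.
    rewrite (_ : _ \o _ = (fun x => Re k * Re (f x) + (- Im k) * Im (f x))).
      by apply: real_sqintD; exact: real_sqintZ.
    apply/funext => x; rewrite /= [(k *: f) x]/(k * f x).
    by case: k => kr ki; case: (f x) => ? ? /=; rewrite mulNr.
  rewrite (_ : _ \o _ = (fun x => Re k * Im (f x) + Im k * Re (f x))).
    by apply: real_sqintD; exact: real_sqintZ.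
  apply/funext => x; rewrite /= [(k *: f) x]/(k * f x).
  by case: k => kr ki; case: (f x) => ? ? /=.
Qed.

HB.instance Definition _ :=
  GRing.isSubmodClosed.Build R[i] (T -> R[i]) square_integrable_pred
    square_integrable_submod.

Definition cinner f g : R[i] := cintegral (fun x => f x * (g x)^*).

Lemma complex_conjE (z : R[i]) : z^* = Complex (Re z) (- Im z).
Proof. by case: z. Qed.

Lemma complex_addE (a b c e : R) :
  Complex a b + Complex c e = Complex (a + c) (b + e) :> R[i].
Proof. by []. Qed.

Lemma complex_mulE (a b c e : R) :
  Complex a b * Complex c e = Complex (a * c - b * e) (a * e + b * c) :> R[i].
Proof. by []. Qed.

Lemma cinnerE f g : cinner f g =
  Complex (\int[mu]_x (Re (f x) * Re (g x) + Im (f x) * Im (g x)))%R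
          (\int[mu]_x (Im (f x) * Re (g x) - Re (f x) * Im (g x)))%R.
Proof.
rewrite /cinner /cintegral; congr Complex; apply: eq_Rintegral => x _;
  rewrite complex_conjE; case: (f x) (g x) => fr fi [gr gi] /=; ring.
Qed.

Lemma integrable_cinner_Re f g : square_integrable f -> square_integrable g ->
  mu.-integrable setT
    (EFin \o (fun x => Re (f x) * Re (g x) + Im (f x) * Im (g x))).
Proof.
move=> /square_integrableP[fr fi] /square_integrableP[gr gi].
exact: (integrableD measurableT (real_sqintM fr gr) (real_sqintM fi gi)).
Qed.

Lemma integrable_cinner_Im f g : square_integrable f -> square_integrable g ->
  mu.-integrable setT
    (EFin \o (fun x => Im (f x) * Re (g x) - Re (f x) * Im (g x))).
Proof.
move=> /square_integrableP[fr fi] /square_integrableP[gr gi].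
exact: (integrableB measurableT (real_sqintM fi gr) (real_sqintM fr gi)).
Qed.

Lemma cinnerDl f g h : square_integrable f -> square_integrable g ->
  square_integrable h -> cinner (f + g) h = cinner f h + cinner g h.
Proof.
move=> sf sg sh; rewrite !cinnerE complex_addE; congr Complex.
  rewrite -RintegralD//; [|exact: integrable_cinner_Re..]; apply: eq_Rintegral => x _ /=.
  rewrite /GRing.add_fun !raddfD/=; ring.
rewrite -RintegralD//; [|exact: integrable_cinner_Im..]; apply: eq_Rintegral => x _ /=.
rewrite /GRing.add_fun !raddfD/=; ring.
Qed.

Lemma cinnerZl k f g : square_integrable f -> square_integrable g ->
  cinner (k *: f) g = k * cinner f g.
Proof.
move=> sf sg; rewrite !cinnerE; case: k => kr ki; rewrite complex_mulE.
congr Complex.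
  rewrite -!RintegralZl//; [|first [exact: integrable_cinner_Re|exact: integrable_cinner_Im]..].
  rewrite -RintegralB//; [|exact: (integrableZl measurableT _ (integrable_cinner_Re sf sg))|
    exact: (integrableZl measurableT _ (integrable_cinner_Im sf sg))].
  apply: eq_Rintegral => x _ /=; rewrite [(_ *: f) x]/(Complex kr ki * f x).
  case: (f x) => fr fi /=; ring.
rewrite -!RintegralZl//; [|first [exact: integrable_cinner_Re|exact: integrable_cinner_Im]..].
rewrite -RintegralD//; [|exact: (integrableZl measurableT _ (integrable_cinner_Im sf sg))|
  exact: (integrableZl measurableT _ (integrable_cinner_Re sf sg))].
apply: eq_Rintegral => x _ /=; rewrite [(_ *: f) x]/(Complex kr ki * f x).
case: (f x) => fr fi /=; ring.
Qed.

Lemma cinner_conj f g : square_integrable f -> square_integrable g ->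
  cinner f g = (cinner g f)^*.
Proof.
move=> sf sg; rewrite complex_conjE !cinnerE; congr Complex => /=.
  by apply: eq_Rintegral => x _; ring.
rewrite -mulN1r -RintegralZl//; last exact: integrable_cinner_Im.
by apply: eq_Rintegral => x _; ring.
Qed.

Lemma cinner_ae f f' g g' :
  square_integrable f -> square_integrable f' ->
  square_integrable g -> square_integrable g' ->
  f = f' %[ae mu] -> g = g' %[ae mu] -> cinner f g = cinner f' g'.
Proof.
move=> sf sf' sg sg' ff' gg'; rewrite !cinnerE /Rintegral.
congr (Complex (fine _) (fine _)); apply: ae_eq_integral => //.
- by have /integrableP[] := integrable_cinner_Re sf sg.
- by have /integrableP[] := integrable_cinner_Re sf' sg'.
- by apply: filterS2 ff' gg' => x /= + + _ => -> // ->.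
- by have /integrableP[] := integrable_cinner_Im sf sg.
- by have /integrableP[] := integrable_cinner_Im sf' sg'.
- by apply: filterS2 ff' gg' => x /= + + _ => -> // ->.
Qed.

Lemma cinner_gt0 f : square_integrable f -> ~ f = cst 0 %[ae mu] ->
  0 < cinner f f.
Proof.
move=> sf f0; rewrite cinnerE.
have -> : (\int[mu]_x (Im (f x) * Re (f x) - Re (f x) * Im (f x)))%R = 0.
  under eq_Rintegral do rewrite mulrC subrr.
  by rewrite Rintegral_cst// mul0r.
rewrite ltcR lt_neqAle Rintegral_ge0 ?andbT; last first.
  by move=> x _; rewrite -!expr2 addr_ge0 ?sqr_ge0.
apply/negP => /eqP/esym int0; apply: f0.
have h x : 0 <= Re (f x) * Re (f x) + Im (f x) * Im (f x).
  by rewrite -!expr2 addr_ge0 ?sqr_ge0.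
have i0 : (\int[mu]_x `|(Re (f x) * Re (f x) + Im (f x) * Im (f x))%:E|)%E = 0%E.
  under eq_integral do rewrite gee0_abs ?lee_fin//.
  rewrite -[LHS]fineK; first by congr EFin.
  by apply: integrable_fin_num => //; exact: integrable_cinner_Re.
have mh : measurable_fun setT
    (fun x => (Re (f x) * Re (f x) + Im (f x) * Im (f x))%:E).
  by have /integrableP[] := integrable_cinner_Re sf sf.
have := (ae_eq_integral_abs mu measurableT mh).1 i0.
apply: filterS => x /= /(_ I) -[fx0] _; move: fx0.
rewrite -!expr2 => /eqP; rewrite paddr_eq0 ?sqr_ge0// !sqrf_eq0.
by case: (f x) => fr fi /= /andP[/eqP -> /eqP ->].
Qed.

Record sqint := SqInt {
  sqint_fun :> T -> R[i];
  _ : sqint_fun \in square_integrable_pred }.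

HB.instance Definition _ := [isSub for sqint_fun].
HB.instance Definition _ := [Choice of sqint by <:].
HB.instance Definition _ := [SubChoice_isSubLmodule of sqint by <:].

Lemma sqintP (f : sqint) : square_integrable f.
Proof. by case: f => f /= /asboolP. Qed.

Definition null_pred : {pred sqint} := fun u => `[< (u : T -> R[i]) = cst 0 %[ae mu] >].

Lemma null_zmod : zmod_closed null_pred.
Proof.
split; first by apply/asboolP; exact: aeW.
move=> f g /asboolP f0 /asboolP g0; apply/asboolP.
apply: filterS2 f0 g0 => x /= + + _ => /(_ I) fx /(_ I) gx.
by transitivity (f x - g x) => //; rewrite fx gx /= subrr.
Qed.

HB.instance Definition _ := GRing.isZmodClosed.Build sqint null_pred null_zmod.

Definition L2 : Type := Quotient.quot null_pred.
HB.instance Definition _ := GRing.Zmodule.on L2.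
HB.instance Definition _ := EqQuotient.on L2.

Definition L2_repr (u : L2) : sqint := repr u.

(* a representative of the class u *)
Definition L2_fun (u : L2) : T -> R[i] := L2_repr u.

Local Open Scope quotient_scope.

Lemma L2_reprK (u : L2) : \pi_L2 (L2_repr u) = u. Proof. exact: reprK. Qed.

Lemma L2_piP (u v : sqint) :
  \pi_L2 u = \pi_L2 v <-> (u : T -> R[i]) = v %[ae mu].
Proof.
split=> [/eqP|uv].
  rewrite eqmodE /= => /asboolP; apply: filterS => x /= /(_ I) uv _.
  by apply/eqP; rewrite -subr_eq0; apply/eqP.
apply/eqP; rewrite eqmodE /=; apply/asboolP.
apply: filterS uv => x /= /(_ I) uv _.
by transitivity (u x - v x) => //; rewrite uv subrr.
Qed.

Lemma L2_pi_repr (u : sqint) : (L2_repr (\pi_L2 u) : T -> R[i]) = u %[ae mu].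
Proof. by apply/L2_piP; rewrite L2_reprK. Qed.

Definition L2_scale (k : R[i]) (u : L2) : L2 := \pi_L2 (k *: L2_repr u).

Lemma L2_scale_pi k (u : sqint) : L2_scale k (\pi_L2 u) = \pi_L2 (k *: u).
Proof.
apply/L2_piP; apply: filterS (L2_pi_repr u) => x /= /(_ I) ux _.
by transitivity (k * (L2_repr (\pi_L2 u)) x) => //; rewrite ux.
Qed.

Lemma L2_pi_add (u v : sqint) : \pi_L2 (u + v) = \pi_L2 u + \pi_L2 v.
Proof. exact: pi_addr. Qed.

Fact L2_scalerA k l (u : L2) : L2_scale k (L2_scale l u) = L2_scale (k * l) u.
Proof. by rewrite -[u]L2_reprK !L2_scale_pi scalerA. Qed.

Fact L2_scale1r : left_id 1 L2_scale.
Proof. by move=> u; rewrite -[u]L2_reprK L2_scale_pi scale1r. Qed.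

Fact L2_scalerDr : right_distributive L2_scale +%R.
Proof.
move=> k u v; rewrite -[u]L2_reprK -[v]L2_reprK.
by rewrite -L2_pi_add !L2_scale_pi scalerDr L2_pi_add.
Qed.

Fact L2_scalerDl (u : L2) : {morph L2_scale^~ u : k l / k + l}.
Proof.
by move=> k l; rewrite -[u]L2_reprK !L2_scale_pi scalerDl L2_pi_add.
Qed.

HB.instance Definition _ := GRing.Zmodule_isLmodule.Build R[i] L2
  L2_scalerA L2_scale1r L2_scalerDr L2_scalerDl.

Definition L2_inner (u v : L2) : R[i] := cinner (L2_repr u) (L2_repr v).

Lemma L2_inner_pi (u v : sqint) :
  L2_inner (\pi_L2 u) (\pi_L2 v) = cinner u v.
Proof.
by apply: cinner_ae; try exact: sqintP; exact: L2_pi_repr.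
Qed.

Lemma L2_inner_conj (u v : L2) : L2_inner u v = (L2_inner v u)^*.
Proof. by apply: cinner_conj; exact: sqintP. Qed.

Lemma L2_inner_linearl (w : L2) : linear_for *%R (L2_inner^~ w).
Proof.
move=> k u v /=; rewrite -[u]L2_reprK -[v]L2_reprK -[w]L2_reprK.
rewrite [k *: _]L2_scale_pi -L2_pi_add !L2_inner_pi.
rewrite cinnerDl ?cinnerZl//; exact: sqintP.
Qed.

Lemma L2_bilinear :
  bilinear_for *%R (Num.conj \; *%R) L2_inner.
Proof.
split; first exact: L2_inner_linearl.
move=> u k v w; rewrite L2_inner_conj L2_inner_linearl /=.
by rewrite rmorphD rmorphM/= -!L2_inner_conj.
Qed.

HB.instance Definition _ := @bilinear_isBilinear.Build R[i] L2 L2 R[i]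
  *%R (Num.conj \; *%R) L2_inner L2_bilinear.

Lemma L2_hermitian (u v : L2) :
  L2_inner u v = (-1) ^+ false * Num.conj (L2_inner v u).
Proof. by rewrite mul1r -L2_inner_conj. Qed.

HB.instance Definition _ := @isHermitianSesquilinear.Build R[i] L2 false
  Num.conj L2_inner L2_hermitian.

Lemma L2_inner_gt0 (u : L2) : u != 0 -> 0 < L2_inner u u.
Proof.
move=> u0; apply: cinner_gt0; first exact: sqintP.
apply: contra_not (negP u0) => u00; apply/eqP.
have -> : (0 : L2) = \pi_L2 (0 : sqint) by rewrite -(@pi_zeror _ _ _ _ _ L2).
rewrite -[u]L2_reprK; apply/L2_piP; apply: filterS u00 => x /= /(_ I) ux _.
exact: ux.
Qed.

HB.instance Definition _ := @isDotProduct.Build R[i] L2 L2_inner L2_inner_gt0.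

HB.instance Definition _ := hasInnerProduct.Build R[i] L2 L2_inner.

End square_integrable.

(* BS(1,N) is the quotient of the words in u, t and their formal inverses by the
   congruence generated by free cancellation and u t u^-1 = t^N.
   A letter (b, e) stands for u (b = true) or t (b = false), inverted when
   e = false. *)
Section baumslag_solitar.
Variable N : nat.

Definition bs_word := seq (bool * bool).

Definition bs_word_inv (w : bs_word) : bs_word :=
  rev [seq (l.1, ~~ l.2) | l <- w].

Inductive bs_eq : bs_word -> bs_word -> Prop :=
| bs_refl w : bs_eq w w
| bs_sym w w' : bs_eq w w' -> bs_eq w' w
| bs_trans w w' w'' : bs_eq w w' -> bs_eq w' w'' -> bs_eq w w''
| bs_cat v v' w w' : bs_eq v v' -> bs_eq w w' -> bs_eq (v ++ w) (v' ++ w')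
| bs_cancel b e : bs_eq [:: (b, e); (b, ~~ e)] [::]
| bs_rel : bs_eq [:: (true, true); (false, true); (true, false)]
                 (nseq N (false, true)).

Lemma bs_eq_equiv : equiv_class_of (fun v w => `[< bs_eq v w >]).
Proof.
split=> [w|v w|v u w].
- by apply/asboolP; exact: bs_refl.
- by apply/asboolP/asboolP; exact: bs_sym.
- by move=> /asboolP vu /asboolP uw; apply/asboolP; exact: bs_trans uw.
Qed.

Canonical bs_eq_equivRel := EquivRelPack bs_eq_equiv.

Local Open Scope quotient_scope.

Definition BS : Type := {eq_quot bs_eq_equivRel}.
HB.instance Definition _ := Choice.on BS.
HB.instance Definition _ := EqQuotient.on BS.

Lemma bs_piP (v w : bs_word) : \pi_BS v = \pi_BS w <-> bs_eq v w.
Proof.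
split=> [/eqP|vw]; first by rewrite eqmodE => /asboolP.
by apply/eqP; rewrite eqmodE; apply/asboolP.
Qed.

Definition bs_one : BS := \pi_BS [::].
Definition bs_mul (x y : BS) : BS := \pi_BS (repr x ++ repr y).
Definition bs_inv (x : BS) : BS := \pi_BS (bs_word_inv (repr x)).

Lemma bs_repr_pi w : bs_eq (repr (\pi_BS w)) w.
Proof. by apply/bs_piP; rewrite reprK. Qed.

Lemma bs_mul_pi v w : bs_mul (\pi_BS v) (\pi_BS w) = \pi_BS (v ++ w).
Proof. by apply/bs_piP/bs_cat; exact: bs_repr_pi. Qed.

Lemma bs_mulVw w : bs_eq (bs_word_inv w ++ w) [::].
Proof.
elim: w => [|[b e] w IH]; first exact: bs_refl.
rewrite /bs_word_inv /= rev_cons cat_rcons.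
apply: bs_trans IH; apply: bs_cat; first exact: bs_refl.
rewrite -[X in bs_eq _ X]cat0s -cat1s -[_ :: w]cat1s catA.
by apply: bs_cat (bs_refl _); have := bs_cancel b (~~ e); rewrite negbK.
Qed.

Lemma bs_word_invK : involutive bs_word_inv.
Proof.
move=> w; rewrite /bs_word_inv map_rev revK -map_comp -[RHS]map_id; apply: eq_map => -[b e].
by rewrite /= negbK.
Qed.

Lemma bs_mulwV w : bs_eq (w ++ bs_word_inv w) [::].
Proof. by rewrite -{1}[w]bs_word_invK; exact: bs_mulVw. Qed.

Fact bs_mulA : associative bs_mul.
Proof.
move=> x y z; rewrite -[x]reprK -[y]reprK -[z]reprK.
by rewrite (bs_mul_pi (repr y)) (bs_mul_pi (repr x) (repr y)) !bs_mul_pi catA.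
Qed.

Fact bs_mul1g : left_id bs_one bs_mul.
Proof. by move=> x; rewrite -[x]reprK bs_mul_pi. Qed.

Fact bs_mulg1 : right_id bs_one bs_mul.
Proof. by move=> x; rewrite -[x]reprK bs_mul_pi cats0. Qed.

Fact bs_mulVg : left_inverse bs_one bs_inv bs_mul.
Proof. by move=> x; rewrite -{2}[x]reprK bs_mul_pi; apply/bs_piP; exact: bs_mulVw. Qed.

Fact bs_mulgV : right_inverse bs_one bs_inv bs_mul.
Proof. by move=> x; rewrite -{1}[x]reprK bs_mul_pi; apply/bs_piP; exact: bs_mulwV. Qed.

HB.instance Definition _ :=
  isGroup.Build BS bs_mulA bs_mul1g bs_mulg1 bs_mulVg bs_mulgV.

Definition bs_u : BS := \pi_BS [:: (true, true)].
Definition bs_t : BS := \pi_BS [:: (false, true)].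

Lemma bs_relation : (bs_u * bs_t * bs_u^-1 = bs_t ^+ N)%g.
Proof.
have uV : (bs_u^-1 = \pi_BS [:: (true, false)])%g.
  apply: (mulgI bs_u); rewrite mulgV [RHS]bs_mul_pi; apply/bs_piP/bs_sym.
  exact: (bs_cancel true true).
have tX n : (bs_t ^+ n = \pi_BS (nseq n (false, true)))%g.
  elim: n => [//|n IH]; rewrite expgS IH; exact: bs_mul_pi.
rewrite uV tX [X in (X * _)%g]bs_mul_pi [LHS]bs_mul_pi.
by apply/bs_piP; exact: bs_rel.
Qed.

Definition bs_texp (k : int) : BS :=
  match k with Posz n => bs_t ^+ n | Negz n => bs_t ^- n.+1 end%g.

(* the subgroup Z[1/N] *)
Definition bs_Zinv : set BS :=
  [set g | exists p k, g = (bs_u ^- p * bs_texp k * bs_u ^+ p)%g].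

End baumslag_solitar.
Arguments bs_Zinv N : clear implicits.

Section representations.
Variable C : numClosedFieldType.

Definition is_unitary (V W : preHilbertType C) (f : {linear V -> W}) : Prop :=
  (forall x y, inner (f x) (f y) = inner x y) /\ (forall y, exists x, f x = y).

Record unitary_rep (G : groupType) (V : preHilbertType C) := UnitaryRep {
  rep_fun :> G -> {linear V -> V} ;
  rep_unitary : forall g, is_unitary (rep_fun g) ;
  rep1 : forall x, rep_fun 1%g x = x ;
  repM : forall g h x, rep_fun (g * h)%g x = rep_fun g (rep_fun h x) }.

Definition unitarily_equivalent (G : groupType) (V W : preHilbertType C)
    (pi : unitary_rep G V) (rho : unitary_rep G W) : Prop :=
  exists2 f : {linear V -> W}, is_unitary f &
    forall g x, f (pi g x) = rho g (f x).

Definition lspan (V : lmodType C) (A : set V) : set V :=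
  [set v | exists n (c : 'I_n -> C) (a : 'I_n -> V),
    (forall i, A (a i)) /\ v = \sum_(i < n) c i *: a i].

Definition cyclic_vector (G : groupType) (H : hilbertType C)
    (pi : unitary_rep G H) (A : set G) (xi : H) : Prop :=
  closure (lspan [set pi g xi | g in A]) = setT.

End representations.

Section solenoid.
Variables (R : realType) (N : nat).

Definition solenoid_set : set {ptws int -> R[i]} :=
  [set z | forall n : int, z (n + 1) ^+ N = z n /\ `|z n| = 1].

Definition solenoid : Type := set_type solenoid_set.

HB.instance Definition _ := Topological.on solenoid.

Definition coord (z : solenoid) (n : int) : R[i] := set_val z n.

Lemma coordP (z : solenoid) n : coord z (n + 1) ^+ N = coord z n /\ `|coord z n| = 1.
Proof. exact: (set_valP z). Qed.

Lemma solenoid_set1 : solenoid_set (fun=> 1).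
Proof. by move=> n; rewrite expr1n normr1. Qed.

HB.instance Definition _ := isPointed.Build solenoid (SigSub (mem_set solenoid_set1)).

HB.instance Definition _ :=
  Measurable.copy solenoid (g_sigma_algebraType (@open solenoid)).

Lemma translate_in (k : int) (z : solenoid) :
  solenoid_set (fun n => coord z (n + k)).
Proof. by move=> n; have [zX zn] := coordP z (n + k); rewrite addrAC. Qed.

Definition translate (k : int) (z : solenoid) : solenoid :=
  SigSub (mem_set (translate_in k z)).

Lemma coord_translate k z n : coord (translate k z) n = coord z (n + k).
Proof. by []. Qed.

Lemma coord_inj (z w : solenoid) : coord z = coord w -> z = w.
Proof. by move=> zw; apply: (@val_inj _ _ (set_type solenoid_set)). Qed.

Lemma translateD k l z : translate k (translate l z) = translate (k + l) z.
Proof.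
apply: coord_inj; apply/funext => n.
by rewrite !coord_translate addrA.
Qed.

Lemma translate0 z : translate 0 z = z.
Proof.
by apply: coord_inj; apply/funext => n; rewrite coord_translate addr0.
Qed.

Lemma continuous_coord n : continuous (coord ^~ n).
Proof.
move=> z; apply: (@continuous_comp _ _ _ (set_val : solenoid -> {ptws int -> R[i]})
  (fun f : {ptws int -> R[i]} => f n)).
  exact: initial_continuous.
exact: (@proj_continuous int (fun=> R[i]) n).
Qed.

Lemma continuous_translate k : continuous (translate k).
Proof.
apply: continuous_comp_initial => z.
have FF : Filter ((set_val \o translate k) x @[x --> z]).
  exact/fmap_filter/nbhs_filter.
apply/cvg_sup => n; apply/cvg_image.
  by apply/seteqP; split => // c _; exists (fun=> c).
move=> U /= Uz; exists ((fun f : int -> R[i] => f n) @^-1` U).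
  have := @continuous_coord (n + k) z; move/(_ U); apply.
  exact: Uz.
by rewrite image_preimage//; apply/seteqP; split => // c _; exists (fun=> c).
Qed.

Lemma measurable_translate k : measurable_fun setT (translate k).
Proof.
apply: (@measurability _ _ _ _ _ _ (@open solenoid)) => //.
move=> _ [U oU <-]; rewrite setTI; apply: sub_sigma_algebra.
by apply: open_comp => // z _; exact: continuous_translate.
Qed.

Definition shift (z : solenoid) : solenoid := translate (-1) z.

Lemma coord_shift z n : coord (shift z) n = coord z (n - 1).
Proof. by []. Qed.

Lemma shift_image (E : set solenoid) : shift @` E = translate 1 @^-1` E.
Proof.
apply/seteqP; split=> [_ [z Ez <-] /=|z /= Ez].
  by rewrite /shift translateD addrN translate0.
by exists (translate 1 z) => //; rewrite /shift translateD addNr translate0.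
Qed.

Section shifted_measure.
Local Open Scope charge_scope.
Variable nu : probability solenoid R.

(* nu o S *)
Definition shifted (E : set solenoid) : \bar R := nu (shift @` E).

Lemma shiftedE : shifted = pushforward nu (translate 1).
Proof. by apply/funext => E; rewrite /shifted shift_image. Qed.

Lemma shifted0 : shifted set0 = 0%E.
Proof. by rewrite /shifted image_set0 measure0. Qed.

Lemma shifted_ge0 E : (0 <= shifted E)%E.
Proof. by rewrite /shifted measure_ge0. Qed.

Lemma shifted_sigma_additive : semi_sigma_additive shifted.
Proof.
have mt E : measurable E -> measurable (translate 1 @^-1` E).
  by move=> mE; rewrite -[X in measurable X]setTI; exact: measurable_translate.
rewrite shiftedE => F mF tF mUF; rewrite /pushforward preimage_bigcup.
apply: measure_semi_sigma_additive.
- by move=> n; exact: mt.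
- apply/trivIsetP => /= i j _ _ ij; rewrite -preimage_setI.
  by move/trivIsetP : tF => /(_ _ _ _ _ ij) ->//; rewrite preimage_set0.
- by rewrite -preimage_bigcup; exact: mt.
Qed.

HB.instance Definition _ := isMeasure.Build _ _ _ shifted
  shifted0 shifted_ge0 shifted_sigma_additive.

Lemma shifted_finite : fin_num_fun shifted.
Proof.
move=> E mE; rewrite /shifted shift_image fin_num_measure//.
by rewrite -[X in measurable X]setTI; exact: measurable_translate.
Qed.

HB.instance Definition _ := Measure_isFinite.Build _ _ _ shifted shifted_finite.

Definition quasi_invariant : Prop := shifted `<< nu /\ nu `<< shifted.

(* d(nu o S) / d nu *)
Definition Delta (z : solenoid) : R :=
  fine (('d (charge_of_finite_measure shifted) '/d nu) z).

Definition op_U (theta f : solenoid -> R[i]) (z : solenoid) : R[i] :=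
  (Num.sqrt (Delta z))%:C%C * theta z * f (shift z).

Definition op_T (f : solenoid -> R[i]) (z : solenoid) : R[i] :=
  coord z 0 * f z.

(* rho is pi_(nu, theta): as u and t generate BS(1,N), a representation is
   determined by its values at u and t. *)
Definition is_pi_nu_theta (theta : solenoid -> R[i])
    (rho : unitary_rep (BS N) (L2 nu)) : Prop :=
  (forall xi : L2 nu,
     L2_fun (rho (bs_u N) xi) = op_U theta (L2_fun xi) %[ae nu]) /\
  (forall xi : L2 nu,
     L2_fun (rho (bs_t N) xi) = op_T (L2_fun xi) %[ae nu]).

End shifted_measure.

End solenoid.

(* Main.v *)
(* Put [a_p = u^-p t u^p], so that [a_{p+1}^N = a_p] and [u a_p u^-1 = a_p^N], and
   let [xi] be a unit cyclic vector.  The spectral measure of [xi] is constructed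
   without the spectral theorem.  For each [m], the discrete Fourier transform of the
   orbit of [xi] under the unitary [pi(a_m)], over the roots of unity of order a large
   power of [N], gives vectors whose squared norms are the masses of a finitely
   supported approximate spectral measure.  The Loeb measure of the ultraproduct of
   these finite measure spaces, pushed forward to the solenoid by taking ultralimits
   of the coordinates, is a probability [nu] with
     [int z_p^K conj(z_p)^L dnu = <pi(a_p)^K xi, pi(a_p)^L xi>].
   By a functional monotone class argument the functions [z_p^K conj(z_p)^L] are total
   in [L2(nu)], so [pi(a_p^(K-L)) xi |-> z_p^K conj(z_p)^L] extends to a unitary [W]
   from [H] onto [L2(nu)].  With [h = W (pi(u) xi)], the relation [u a_p u^-1 = a_p^N]
   gives [W pi(u) W^-1 g = (g o S) h].  This operator is isometric, whence
   [|h|^2 = d(nu o S)/dnu], and it is onto, whence [h] vanishes almost nowhere; so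
   [nu] is quasi-invariant and [theta = h / |h|]. *)
From HB Require Import structures.
From mathcomp Require Import all_boot all_order all_algebra.
From mathcomp Require Import complex finmap cyclic separable cyclotomic.
From mathcomp Require Import ring lra zify.
From mathcomp Require Import all_classical all_reals all_analysis.
From mathcomp Require Import measurable_realfun.
Require Import Defs.
Import Order.TTheory GRing.Theory Num.Theory.
Import numFieldTopology.Exports numFieldNormedType.Exports.
Set Implicit Arguments. Unset Strict Implicit. Unset Printing Implicit Defensive.
Local Open Scope classical_set_scope.
Local Open Scope ring_scope.

(** * Total families in pre-Hilbert spaces *)

(** One finite stage speaks about a single operator [pi(a_m)], whereas [nu] has to record all the
    [pi(a_p)] jointly. This is possible because [a_p] is a power of [a_m] for [p <= m]: an atom at
    the root [lambda] of stage [m] comes with a whole string of coordinates [lambda^(N^(m-p))].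
    These satisfy the solenoid relation exactly, although they only approximate spectral values.

    The stages live on different finite sets, and their limit is taken among points instead of among
    measures. Saturation makes the limiting set function countably additive, and ultralimits of the
    coordinates send the hyperfinite space to the solenoid. Neither weak compactness of measures nor
    a representation theorem for positive functionals enters.

    Elements of [Z[1/N]] and characters of the solenoid are both indexed by triples [(p, K, L)]
    standing for [(K-L)/N^p]. Matching the two families then amounts to comparing Gram matrices, and
    every operator identity on [L2(nu)] is checked on these total families only. *)

Section hilbert_norm.
Variable R : realType.
Local Notation Re := (@complex.Re R).
Local Notation Im := (@complex.Im R).

Section prehilbert.
Variable V : preHilbertType R[i].
Implicit Types x y z : V.

(** A real-valued norm depending on the inner product alone, so that the same lemmas serve [L2 nu]
    and [H], whose own norm takes values in [R[i]]. *)
Definition nrm x : R := Num.sqrt (Re (inner x x)).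

Lemma innerDl x y z : inner (x + y) z = inner x z + inner y z.
Proof. exact: linearDl. Qed.

Lemma innerDr x y z : inner z (x + y) = inner z x + inner z y.
Proof. exact: linearDr. Qed.

Lemma innerZl a x z : inner (a *: x) z = a * inner x z.
Proof. exact: linearZl_LR. Qed.

Lemma innerZr a x z : inner z (a *: x) = a^* * inner z x.
Proof. exact: linearZr_LR. Qed.

Lemma innerBl x y z : inner (x - y) z = inner x z - inner y z.
Proof. exact: linearBl. Qed.

Lemma innerBr x y z : inner z (x - y) = inner z x - inner z y.
Proof. exact: linearBr. Qed.

Lemma inner_suml I (r : seq I) (F : I -> V) y :
  inner (\sum_(i <- r) F i) y = \sum_(i <- r) inner (F i) y.
Proof. exact: linear_sumlz. Qed.

Lemma inner_sumr I (r : seq I) (F : I -> V) y :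
  inner y (\sum_(i <- r) F i) = \sum_(i <- r) inner y (F i).
Proof. exact: linear_sumr. Qed.

Lemma inner_conj x y : inner y x = (inner x y)^*.
Proof. by rewrite (hermC inner) /= expr0 mul1r. Qed.

Lemma inner_xx_ge0 x : 0 <= inner x x.
Proof. exact: dnorm_ge0. Qed.

Lemma Re_inner_ge0 x : 0 <= Re (inner x x).
Proof. by have := inner_xx_ge0 x; rewrite lecE => /andP[]. Qed.

Lemma nrm_ge0 x : 0 <= nrm x. Proof. exact: sqrtr_ge0. Qed.

Lemma sqr_nrm x : nrm x ^+ 2 = Re (inner x x).
Proof. by rewrite sqr_sqrtr// Re_inner_ge0. Qed.

Lemma inner_nrm x : inner x x = (nrm x ^+ 2)%:C%C.
Proof.
rewrite sqr_nrm; apply/eqP; rewrite eq_complex/= eqxx/=.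
by have := inner_xx_ge0 x; rewrite lecE /= => /andP[/eqP->].
Qed.

Lemma nrm_eq0 x : nrm x = 0 -> x = 0.
Proof.
by move=> x0; apply/eqP; rewrite -(dnorm_eq0 inner) inner_nrm x0 expr0n.
Qed.

Lemma nrm0 : nrm 0 = 0.
Proof. by rewrite /nrm linear0l raddf0 sqrtr0. Qed.

Lemma Re_innerC x y : Re (inner x y) = Re (inner y x).
Proof. by rewrite inner_conj complex_conjE. Qed.

Lemma sqr_nrmD x y : nrm (x + y) ^+ 2 = nrm x ^+ 2 + 2 * Re (inner x y) + nrm y ^+ 2.
Proof.
rewrite !sqr_nrm innerDl !innerDr !raddfD/= [Re (inner y x)]Re_innerC; ring.
Qed.

Lemma nrmZ a x : nrm (a *: x) = Re `|a| * nrm x.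
Proof.
have ra : 0 <= Re `|a| by rewrite normc_def sqrtr_ge0.
apply/eqP; rewrite -(eqrXn2 (_ : 0 < 2)%N) ?mulr_ge0 ?nrm_ge0//; apply/eqP.
rewrite sqr_nrm innerZl innerZr inner_nrm mulrA exprMn.
have -> : a * a^* = (Re `|a| ^+ 2)%:C%C.
  by rewrite -normCK normc_def -rmorphXn.
by rewrite -rmorphM.
Qed.

Lemma nrmN x : nrm (- x) = nrm x.
Proof. by rewrite /nrm linearNl linearNr opprK. Qed.

Lemma nrmC x y : nrm (x - y) = nrm (y - x).
Proof. by rewrite -nrmN opprB. Qed.

Lemma Re_CauchySchwarz x y : Re (inner x y) <= nrm x * nrm y.
Proof.
have [x0|x0] := eqVneq (nrm x) 0; first by rewrite (nrm_eq0 x0) linear0l nrm0 mul0r.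
have [y0|y0] := eqVneq (nrm y) 0; first by rewrite (nrm_eq0 y0) linear0r nrm0 mulr0.
have xy : 0 < nrm x * nrm y by rewrite mulr_gt0// lt_neqAle eq_sym ?x0 ?y0 nrm_ge0.
(* This square expands to [2 |x| |y| (|x| |y| - Re <x, y>)]. *)
have := sqr_ge0 (nrm ((nrm y)%:C%C *: x + (- nrm x)%:C%C *: y)).
rewrite sqr_nrmD !nrmZ !normc_def/= !expr0n !addr0 !sqrtr_sqr.
rewrite innerZl innerZr normrN !ger0_norm ?nrm_ge0//.
have -> : Re ((nrm y)%:C%C * (((- nrm x)%:C%C)^* * inner x y)) =
   - (nrm x * nrm y) * Re (inner x y).
  by rewrite complex_conjE; case: (inner x y) => a b /=; ring.
move=> h; rewrite -(ler_pM2l xy); nra.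
Qed.

Lemma ler_nrmD x y : nrm (x + y) <= nrm x + nrm y.
Proof.
rewrite -(@ler_pXn2r _ 2)// ?nnegrE ?addr_ge0 ?nrm_ge0// sqr_nrmD sqrrD.
by have := Re_CauchySchwarz x y; lra.
Qed.

Lemma ler_nrmB z x y : nrm (x - y) <= nrm (x - z) + nrm (z - y).
Proof. by rewrite (le_trans _ (ler_nrmD _ _))// addrA subrK. Qed.

Lemma ler_nrm_sub x y : `|nrm x - nrm y| <= nrm (x - y).
Proof.
rewrite ler_norml; have := ler_nrmD (x - y) y; have := ler_nrmD (y - x) x.
rewrite !subrK (nrmC y x); lra.
Qed.

Lemma Re_inner_nrm x y :
  Re (inner x y) = (nrm (x + y) ^+ 2 - nrm x ^+ 2 - nrm y ^+ 2) / 2.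
Proof. by rewrite sqr_nrmD; field. Qed.

(** Reduces statements about imaginary parts to real parts, at no cost in norm since [-i] has
    modulus 1. *)
Lemma Im_inner x y : Im (inner x y) = Re (inner ((- 'i%C) *: x) y).
Proof. by rewrite innerZl; case: (inner x y) => a b /=; ring. Qed.

Lemma normi1 : Re `|- 'i%C : R[i]| = 1.
Proof. by rewrite normc_def/= oppr0 expr0n sqrrN expr1n add0r sqrtr1. Qed.

Lemma ler_Re_inner x y : `|Re (inner x y)| <= nrm x * nrm y.
Proof.
rewrite ler_norml Re_CauchySchwarz andbT lerNl -(nrmN x).
by rewrite (le_trans _ (Re_CauchySchwarz _ _))// linearNl raddfN.
Qed.

Lemma ler_Im_inner x y : `|Im (inner x y)| <= nrm x * nrm y.
Proof. by rewrite Im_inner (le_trans (ler_Re_inner _ _))// nrmZ normi1 mul1r. Qed.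

End prehilbert.

Lemma near_half_expn (e : R) : 0 < e -> \forall n \near \oo, 2^-1 ^+ n < e.
Proof.
move=> e0; have /cvgrPdist_lt/(_ _ e0) : (fun n => 2^-1 ^+ n : R) @ \oo --> (0 : R).
  by apply: cvg_expr; rewrite ger0_norm//; lra.
by apply: filterS => n; rewrite sub0r normrN ger0_norm// exprn_ge0.
Qed.

Lemma fast_cauchy (V : preHilbertType R[i]) (u : nat -> V) :
  (forall n, nrm (u n.+1 - u n) <= 2^-1 ^+ n) ->
  forall n k, nrm (u (n + k)%N - u n) <= 2 * 2^-1 ^+ n.
Proof.
move=> uP n k.
have p0 m : 0 < 2^-1 ^+ m :> R by rewrite exprn_gt0.
(* The exact geometric sum is carried along, since the rounded bound is not inductive in [k]. *)
suff : nrm (u (n + k)%N - u n) <= 2 * 2^-1 ^+ n - 2 * 2^-1 ^+ (n + k).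
  by have := p0 (n + k)%N; lra.
elim: k => [|k ih]; first by rewrite addn0 !subrr nrm0.
rewrite addnS (le_trans (ler_nrmB (u (n + k)%N) _ _))//.
by have := uP (n + k)%N; rewrite exprS; lra.
Qed.

(* Completeness in terms of fast Cauchy sequences, as [L2] carries no topology. *)
Definition fast_complete (V : preHilbertType R[i]) : Prop :=
  forall u : nat -> V, (forall n, nrm (u n.+1 - u n) <= 2^-1 ^+ n) ->
  exists x, forall e : R, 0 < e -> exists n0, forall n, (n0 <= n)%N -> nrm (u n - x) < e.

Definition lincomb (V : lmodType R[i]) I (a : I -> V) (s : seq (R[i] * I)) : V :=
  \sum_(p <- s) p.1 *: a p.2.

Definition total (V : preHilbertType R[i]) I (a : I -> V) : Prop :=
  forall x (e : R), 0 < e -> exists s, nrm (x - lincomb a s) < e.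

Lemma lincomb_cat (V : lmodType R[i]) I (a : I -> V) s t :
  lincomb a (s ++ t) = lincomb a s + lincomb a t.
Proof. by rewrite /lincomb big_cat. Qed.

Lemma lincombZ (V : lmodType R[i]) I (a : I -> V) k s :
  lincomb a [seq (k * p.1, p.2) | p <- s] = k *: lincomb a s.
Proof.
by rewrite /lincomb big_map scaler_sumr; apply: eq_bigr => p _; rewrite scalerA.
Qed.

Lemma lincombB (V : lmodType R[i]) I (a : I -> V) s t :
  lincomb a (s ++ [seq (-1 * p.1, p.2) | p <- t]) = lincomb a s - lincomb a t.
Proof. by rewrite lincomb_cat lincombZ scaleN1r. Qed.

Lemma inner_lincomb (V : preHilbertType R[i]) I (a : I -> V) s t :
  inner (lincomb a s) (lincomb a t) =
  \sum_(p <- s) \sum_(q <- t) p.1 * (q.1^* * inner (a p.2) (a q.2)).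
Proof.
rewrite inner_suml; apply: eq_bigr => p _; rewrite inner_sumr; apply: eq_bigr => q _.
by rewrite innerZl innerZr.
Qed.

Definition isometric (V W : preHilbertType R[i]) (f : V -> W) : Prop :=
  forall x, nrm (f x) = nrm x.

(** Polarization: [Re_inner_nrm] recovers real parts from norms, and [Im_inner] reduces imaginary
    parts to real ones. *)
Lemma isometric_inner (V W : preHilbertType R[i]) (f : {linear V -> W}) :
  isometric f -> forall x y, inner (f x) (f y) = inner x y.
Proof.
move=> fi x y; have hr z : Re (inner (f z) (f y)) = Re (inner z y).
  by rewrite !Re_inner_nrm -linearD !fi.
apply/eqP; rewrite eq_complex hr eqxx/= !Im_inner -linearZ hr//.
Qed.

Lemma inner_isometric (V W : preHilbertType R[i]) (f : V -> W) :
  (forall x y, inner (f x) (f y) = inner x y) -> isometric f.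
Proof. by move=> fi x; rewrite /nrm fi. Qed.

Lemma linear_lincomb (V W : lmodType R[i]) (f : {linear V -> W}) I (a : I -> V) s :
  f (lincomb a s) = lincomb (f \o a) s.
Proof. by rewrite linear_sum; apply: eq_bigr => p _; rewrite linearZ. Qed.

(** The tool by which every operator on [L2 nu] is identified: only its values on a total family
    have to be computed. *)
Lemma isometric_total_eq (V W : preHilbertType R[i]) (f g : {linear V -> W})
    I (a : I -> V) :
  isometric f -> isometric g -> total a -> (forall i, f (a i) = g (a i)) -> f =1 g.
Proof.
move=> fi gi ta fg x; apply/eqP; rewrite -subr_eq0; apply/eqP/nrm_eq0.
apply/eqP; rewrite eq_le nrm_ge0 andbT; apply/ler_addgt0Pr => e e0; rewrite add0r.
have [s xs] := ta x (e / 2) (divr_gt0 e0 (ltr0n _ 2)).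
have fgs : f (lincomb a s) = g (lincomb a s).
  by rewrite !linear_lincomb; apply: eq_bigr => p _; rewrite /= fg.
rewrite (le_trans (ler_nrmB (f (lincomb a s)) _ _))// {2}fgs -!linearB fi gi (nrmC _ x).
lra.
Qed.

Section unitary_extension.
Variables (V W : preHilbertType R[i]) (I : Type) (a : I -> V) (b : I -> W).
Hypothesis gram : forall i j, inner (a i) (a j) = inner (b i) (b j).

(** The closure of the set of pairs of linear combinations with the same coefficients. Equal Gram
    matrices make it the graph of an isometry, so uniqueness and linearity are settled before any
    value is chosen. With [a = b] and [x = y] it expresses membership in the closed span of [a]. *)
Definition close_comb (x : V) (y : W) : Prop :=
  forall e : R, 0 < e ->
  exists s, nrm (x - lincomb a s) < e /\ nrm (y - lincomb b s) < e.

Lemma nrm_lincomb_gram s : nrm (lincomb a s) = nrm (lincomb b s).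
Proof.
rewrite /nrm !inner_lincomb; congr (Num.sqrt (Re _)).
by apply: eq_bigr => p _; apply: eq_bigr => q _; rewrite gram.
Qed.

Lemma close_comb_nrm x y : close_comb x y -> nrm x = nrm y.
Proof.
move=> xy; apply/eqP; rewrite -subr_eq0 -normr_eq0 eq_le normr_ge0 andbT.
apply/ler_addgt0Pr => e e0; rewrite add0r.
have [s [xs ys]] := xy (e / 2) (divr_gt0 e0 (ltr0n _ 2)).
have := le_lt_trans (ler_nrm_sub _ _) xs; have := le_lt_trans (ler_nrm_sub _ _) ys.
rewrite nrm_lincomb_gram !ltr_norml ler_norml; lra.
Qed.

Lemma close_combP k x y x' y' : close_comb x y -> close_comb x' y' ->
  close_comb (k *: x + x') (k *: y + y').
Proof.
move=> xy xy' e e0.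
have k0 : 0 <= Re `|k| by rewrite normc_def sqrtr_ge0.
have d0 : 0 < e / (Re `|k| + 1) by rewrite divr_gt0// ltr_wpDl.
have [s [xs ys]] := xy (e / (Re `|k| + 1) / 2) (divr_gt0 d0 (ltr0n _ 2)).
have [t [xt yt]] := xy' (e / (Re `|k| + 1) / 2) (divr_gt0 d0 (ltr0n _ 2)).
have h (U : preHilbertType R[i]) (c : I -> U) (z z' : U) :
    nrm (z - lincomb c s) < e / (Re `|k| + 1) / 2 ->
    nrm (z' - lincomb c t) < e / (Re `|k| + 1) / 2 ->
    nrm (k *: z + z' - lincomb c ([seq (k * p.1, p.2) | p <- s] ++ t)) < e.
  move=> zs zt; rewrite lincomb_cat lincombZ opprD addrACA -scalerBr.
  rewrite (le_lt_trans (ler_nrmD _ _))// nrmZ.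
  have ed : e = Re `|k| * (e / (Re `|k| + 1)) + e / (Re `|k| + 1).
    by field; rewrite gt_eqF// ltr_wpDl.
  move: d0 zs zt ed; set d := e / _; nra.
by exists ([seq (k * p.1, p.2) | p <- s] ++ t); split; exact: h.
Qed.

(** By linearity [0] is paired with the difference of [y] and [y'], and paired vectors have equal
    norms. *)
Lemma close_comb_uniq x y y' : close_comb x y -> close_comb x y' -> y = y'.
Proof.
move=> xy xy'; apply/eqP; rewrite -subr_eq0; apply/eqP/nrm_eq0.
have := close_comb_nrm (close_combP (-1) xy' xy).
by rewrite !scaleN1r addNr nrm0 addrC.
Qed.

Lemma close_comb_ex : fast_complete W -> total a -> forall x, exists y, close_comb x y.
Proof.
move=> cW ta x.
have p0 n : 0 < 2^-1 ^+ n / 2 :> R by rewrite divr_gt0// exprn_gt0.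
(* The extra factor 1/2 keeps consecutive choices within [2^-n/2 + 2^-n/4], as [fast_complete]
   requires. *)
have /choice[s xs] : forall n, exists s, nrm (x - lincomb a s) < 2^-1 ^+ n / 2.
  by move=> n; exact: ta.
have [|y yP] := cW (fun n => lincomb b (s n)).
  move=> n; rewrite -lincombB -nrm_lincomb_gram lincombB.
  rewrite (le_trans (ler_nrmB x _ _))// nrmC.
  have := xs n; have := xs n.+1; rewrite exprS; have := p0 n; lra.
exists y => e e0; have [n0 yn] := yP _ e0.
have [n1 n1e] : exists n1, 2^-1 ^+ n1 < e.
  by have [n1 _ /(_ n1 (leqnn _))] := near_half_expn e0; exists n1.
exists (s (maxn n0 n1)); split; last by rewrite nrmC yn// leq_maxl.
rewrite (lt_trans (xs _))//; apply: le_lt_trans n1e.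
have := ler_wiXn2l (_ : 0 <= 2^-1 :> R) (_ : 2^-1 <= 1 :> R) (leq_maxr n0 n1).
have := p0 (maxn n0 n1).
by move=> ? /(_ _ _) h; have := h ltac:(lra) ltac:(lra); lra.
Qed.

End unitary_extension.

Lemma close_combC (V W : preHilbertType R[i]) I (a : I -> V) (b : I -> W) x y :
  close_comb a b x y -> close_comb b a y x.
Proof. by move=> xy e /xy[s []]; exists s. Qed.

Lemma close_comb_base (V W : preHilbertType R[i]) I (a : I -> V) (b : I -> W) i :
  close_comb a b (a i) (b i).
Proof.
move=> e e0; exists [:: (1, i)].
by rewrite /lincomb !big_seq1 !scale1r !subrr !nrm0.
Qed.

Lemma unitary_extension (V W : preHilbertType R[i]) I (a : I -> V) (b : I -> W) :
  fast_complete V -> fast_complete W -> total a -> total b ->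
  (forall i j, inner (a i) (a j) = inner (b i) (b j)) ->
  exists f : {linear V -> W}, [/\ Defs.is_unitary f, isometric f & forall i, f (a i) = b i].
Proof.
move=> cV cW ta tb gram; have [f fP] := choice (close_comb_ex gram cW ta).
have lf : linear f.
  by move=> k x y; apply: (close_comb_uniq gram (fP _)); apply: close_combP.
pose flin := GRing.isLinear.Build R[i] V W *:%R f lf.
pose fl : {linear V -> W} := HB.pack f flin.
have fi : isometric fl by move=> x; rewrite (close_comb_nrm gram (fP x)).
exists fl; split => //.
- split; first exact: isometric_inner.
  have gram' i j : inner (b i) (b j) = inner (a i) (a j) by rewrite gram.
  (* The hypotheses are symmetric in [a] and [b], so a preimage is found by extending in the
     opposite direction. *)
  move=> y; have [x xy] := close_comb_ex gram' cV tb y; exists x.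
  exact: (close_comb_uniq gram (fP x) (close_combC xy)).
- by move=> i; exact: (close_comb_uniq gram (fP (a i)) (@close_comb_base _ _ _ _ _ _)).
Qed.

Lemma hilbert_nrm (H : hilbertType R[i]) (x : H) : (nrm x)%:C%C = `|x|.
Proof.
have n0 : 0 <= (nrm x)%:C%C :> R[i] by rewrite lecR nrm_ge0.
have h : (nrm x)%:C%C ^+ 2 = `|x| ^+ 2.
  by rewrite -rmorphXn; exact: etrans (esym (inner_nrm x)) (innerxx x).
by apply: (pexpIrn (n := 2)) h => //; rewrite nnegrE.
Qed.

Lemma hilbert_fast_complete (H : hilbertType R[i]) : fast_complete H.
Proof.
move=> u uP.
have ulin := fast_cauchy uP.
have cu : cvgn u.
  apply: cauchy_cvg; apply/cauchy_exP => e e0.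
  have er : e = (Re e)%:C%C.
    by apply/eqP; rewrite eq_complex/= eqxx/=; move: e0; rewrite ltcE /= => /andP[/eqP->].
  have e0' : 0 < Re e by move: e0; rewrite er ltcR.
  have : \forall n \near \oo, 2^-1 ^+ n < Re e / 2.
    exact: near_half_expn (divr_gt0 e0' (ltr0n _ 2)).
  case=> n0 _ /(_ n0 (leqnn _))/= n0e; exists (u n0), n0 => // n /= n0n.
  rewrite -ball_normE /ball_/= -hilbert_nrm er ltcR nrmC.
  by rewrite -(subnKC n0n) (le_lt_trans (ulin _ _))//; lra.
exists (limn u) => e e0.
have e0' : 0 < e%:C%C :> R[i] by rewrite ltcR.
have /cvgrPdist_lt/(_ _ e0')[n0 _ un] := cu.
by exists n0 => n /un; rewrite -hilbert_nrm ltcR nrmC.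
Qed.

End hilbert_norm.

(** * Square integrable functions *)

Section L2_theory.
Context d (T : measurableType d) (R : realType).
Local Notation Re := (@complex.Re R).
Local Notation Im := (@complex.Im R).
Local Open Scope quotient_scope.

Lemma sqr_modulus_ge0 (z : R[i]) : 0 <= sqr_modulus z.
Proof. by rewrite sqr_modulusE addr_ge0 ?sqr_ge0. Qed.

Lemma sqr_modulusM (z w : R[i]) : sqr_modulus (z * w) = sqr_modulus z * sqr_modulus w.
Proof. by rewrite !sqr_modulusE; case: z w => a b [c e] /=; ring. Qed.

Lemma sqr_modulusN (z : R[i]) : sqr_modulus (- z) = sqr_modulus z.
Proof. by rewrite !sqr_modulusE !raddfN/= !sqrrN. Qed.

Lemma sqr_modulus_eq0 (z : R[i]) : sqr_modulus z = 0 -> z = 0.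
Proof.
rewrite sqr_modulusE => /eqP; rewrite paddr_eq0 ?sqr_ge0// !sqrf_eq0.
by case: z => a b /= /andP[/eqP-> /eqP->].
Qed.

Lemma norm1_sqr_modulus (z : R[i]) : `|z| = 1 -> sqr_modulus z = 1.
Proof. by rewrite /sqr_modulus => ->; rewrite expr1n. Qed.

Lemma measurable_sqr_modulus (f : T -> R[i]) :
  measurable_fun setT f -> measurable_fun setT (@sqr_modulus R \o f).
Proof.
move=> /measurable_complexP[mr mi].
rewrite (_ : _ \o _ = (fun x => Re (f x) ^+ 2 + Im (f x) ^+ 2)).
  by apply: measurable_funD; exact: measurable_funX.
by apply/funext => x /=; rewrite sqr_modulusE.
Qed.

Lemma measurable_cmul (f g : T -> R[i]) : measurable_fun setT f ->
  measurable_fun setT g -> measurable_fun setT (fun x => f x * g x).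
Proof.
move=> /measurable_complexP[fr fi] /measurable_complexP[gr gi].
apply/measurable_complexP; split.
  rewrite (_ : _ \o _ = (fun x => Re (f x) * Re (g x) - Im (f x) * Im (g x))).
    by apply: measurable_funB; exact: measurable_funM.
  by apply/funext => x /=; case: (f x) (g x) => a b [].
rewrite (_ : _ \o _ = (fun x => Re (f x) * Im (g x) + Im (f x) * Re (g x))).
  by apply: measurable_funD; exact: measurable_funM.
by apply/funext => x /=; case: (f x) (g x) => a b [].
Qed.

Variable mu : {measure set T -> \bar R}.

Definition mkL2 (f : T -> R[i]) : L2 mu :=
  if pselect (square_integrable mu f) is left sf then \pi_(L2 mu) (SqInt (asboolT sf))
  else 0.

Lemma mkL2_fun f : square_integrable mu f -> L2_fun (mkL2 f) = f %[ae mu].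
Proof. by rewrite /mkL2; case: pselect => // sf _; exact: L2_pi_repr. Qed.

Lemma L2_funP (u : L2 mu) : square_integrable mu (L2_fun u).
Proof. exact: sqintP. Qed.

Lemma mkL2_pi (f : sqint mu) : mkL2 f = \pi_(L2 mu) f.
Proof.
rewrite /mkL2; case: pselect => [sf|/(_ (sqintP f))//].
by apply/L2_piP; exact: aeW.
Qed.

Lemma L2_funK (u : L2 mu) : mkL2 (L2_fun u) = u.
Proof. by rewrite mkL2_pi L2_reprK. Qed.

Lemma mkL2_eq f g : square_integrable mu f -> square_integrable mu g ->
  f = g %[ae mu] -> mkL2 f = mkL2 g.
Proof.
move=> sf sg fg; rewrite -[f]/(SqInt (asboolT sf) : T -> R[i]) mkL2_pi.
by rewrite -[g]/(SqInt (asboolT sg) : T -> R[i]) mkL2_pi; apply/L2_piP.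
Qed.

Lemma mkL2D f g : square_integrable mu f -> square_integrable mu g ->
  mkL2 (f + g) = mkL2 f + mkL2 g.
Proof.
move=> sf sg; pose F := SqInt (asboolT sf); pose G := SqInt (asboolT sg).
by rewrite (mkL2_pi (F + G)) (mkL2_pi F) (mkL2_pi G) L2_pi_add.
Qed.

Lemma mkL2Z k f : square_integrable mu f -> mkL2 (k *: f) = k *: mkL2 f.
Proof.
move=> sf; pose F := SqInt (asboolT sf).
by rewrite (mkL2_pi (k *: F)) (mkL2_pi F) [RHS]L2_scale_pi.
Qed.

Lemma inner_mkL2 f g : square_integrable mu f -> square_integrable mu g ->
  inner (mkL2 f) (mkL2 g) = cinner mu f g.
Proof.
move=> sf sg; pose F := SqInt (asboolT sf); pose G := SqInt (asboolT sg).
by rewrite (mkL2_pi F) (mkL2_pi G); exact: L2_inner_pi.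
Qed.

Lemma sqr_nrm_mkL2 f : square_integrable mu f ->
  ((nrm (mkL2 f) ^+ 2)%:E = \int[mu]_x (sqr_modulus (f x))%:E)%E.
Proof.
move=> sf; rewrite sqr_nrm inner_mkL2// cinnerE /= /Rintegral fineK; last first.
  apply: integrable_fin_num => //; exact: integrable_cinner_Re.
by apply: eq_integral => x _; rewrite sqr_modulusE !expr2.
Qed.

Lemma square_integrableD f g : square_integrable mu f -> square_integrable mu g ->
  square_integrable mu (f + g).
Proof.
move=> sf sg; pose F := SqInt (asboolT sf); pose G := SqInt (asboolT sg).
exact: (sqintP (F + G)).
Qed.

Lemma square_integrableZ k f : square_integrable mu f -> square_integrable mu (k *: f).
Proof. by move=> sf; pose F := SqInt (asboolT sf); exact: (sqintP (k *: F)). Qed.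

Lemma square_integrableB f g : square_integrable mu f -> square_integrable mu g ->
  square_integrable mu (f - g).
Proof. by move=> sf /(square_integrableZ (-1)); rewrite scaleN1r; exact: square_integrableD. Qed.

Lemma mkL2B f g : square_integrable mu f -> square_integrable mu g ->
  mkL2 (f - g) = mkL2 f - mkL2 g.
Proof.
move=> sf sg; rewrite -scaleN1r mkL2D//; last exact: square_integrableZ.
by rewrite mkL2Z// scaleN1r.
Qed.

Lemma L2_fun_lin k (u v : L2 mu) :
  L2_fun (k *: u + v) = (k *: L2_fun u + L2_fun v) %[ae mu].
Proof.
have su := L2_funP u; have sv := L2_funP v.
have -> : L2_fun (k *: u + v) = L2_fun (mkL2 (k *: L2_fun u + L2_fun v)).
  by rewrite mkL2D ?mkL2Z ?L2_funK//; exact: square_integrableZ.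
by apply: mkL2_fun; apply: square_integrableD => //; exact: square_integrableZ.
Qed.

Lemma sqr_nrm_L2 (u : L2 mu) :
  ((nrm u ^+ 2)%:E = \int[mu]_x (sqr_modulus (L2_fun u x))%:E)%E.
Proof. by rewrite -sqr_nrm_mkL2 ?L2_funK//; exact: L2_funP. Qed.

Section weighted_composition.
Variables (tau : T -> T) (h : T -> R[i]).
Hypotheses (mtau : measurable_fun setT tau) (mh : measurable_fun setT h).
Hypothesis wc_int : forall k : T -> R, measurable_fun setT k -> (forall x, 0 <= k x) ->
  (\int[mu]_x (k x)%:E < +oo)%E ->
  (\int[mu]_x (k (tau x) * sqr_modulus (h x))%:E = \int[mu]_x (k x)%:E)%E.

(** Used twice: with [tau] the identity and [h] a character for the action of [Z[1/N]], and with
    [tau] the shift for the action of [u]. In both cases [wc_int] is what makes the operator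
    isometric. *)
Definition wcomp (f : T -> R[i]) (x : T) : R[i] := f (tau x) * h x.

Lemma wcomp_int f : square_integrable mu f ->
  (\int[mu]_x (sqr_modulus (wcomp f x))%:E = \int[mu]_x (sqr_modulus (f x))%:E)%E.
Proof.
move=> [mf fi]; rewrite -(wc_int (k := @sqr_modulus R \o f))//=.
- by under eq_integral do rewrite sqr_modulusM.
- exact: measurable_sqr_modulus.
- by move=> x; exact: sqr_modulus_ge0.
Qed.

Lemma wcomp_sqint f : square_integrable mu f -> square_integrable mu (wcomp f).
Proof.
move=> sf; split; last by rewrite wcomp_int//; case: sf.
by apply: measurable_cmul => //; apply: measurableT_comp mtau; case: sf.
Qed.

(** Nothing is assumed about [tau] and null sets. That the operator is well defined on classes
    follows from the isometry identity applied to [f - g]. *)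
Lemma wcomp_ae f g : square_integrable mu f -> square_integrable mu g ->
  f = g %[ae mu] -> mkL2 (wcomp f) = mkL2 (wcomp g).
Proof.
move=> sf sg fg; apply/eqP; rewrite -subr_eq0; apply/eqP/nrm_eq0.
have -> : mkL2 (wcomp f) - mkL2 (wcomp g) = mkL2 (wcomp (f - g)).
  rewrite -mkL2B; [|exact: wcomp_sqint..]; congr mkL2; apply/funext => x.
  by rewrite /wcomp [RHS]mulrBl.
have sfg := square_integrableB sf sg.
have : (((nrm (mkL2 (wcomp (f - g)))) ^+ 2)%:E = ((nrm (mkL2 (f - g)))^+2)%:E)%E.
  have e1 := sqr_nrm_mkL2 (wcomp_sqint sfg).
  have e2 := sqr_nrm_mkL2 sfg.
  have e3 := wcomp_int sfg.
  exact: (etrans e1 (etrans e3 (esym e2))).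
rewrite mkL2B// (mkL2_eq sf sg fg) subrr nrm0 expr0n => -[] /eqP.
by rewrite sqrf_eq0 => /eqP.
Qed.

Definition wcompL2_fun (u : L2 mu) : L2 mu := mkL2 (wcomp (L2_fun u)).

Lemma wcompL2_linear : linear wcompL2_fun.
Proof.
move=> k u v; rewrite /wcompL2_fun.
have su := L2_funP u; have sv := L2_funP v.
have sku := square_integrableZ k su.
rewrite (wcomp_ae (L2_funP _) (square_integrableD sku sv) (@L2_fun_lin k u v)).
rewrite -mkL2Z; last exact: wcomp_sqint.
rewrite -mkL2D; last exact: wcomp_sqint; last exact/square_integrableZ/wcomp_sqint.
by congr mkL2; apply/funext => x; rewrite /wcomp [LHS]mulrDl -mulrA.
Qed.

HB.instance Definition _ := GRing.isLinear.Build R[i] (L2 mu) (L2 mu) *:%R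
  wcompL2_fun wcompL2_linear.

Definition wcompL2 : {linear L2 mu -> L2 mu} := wcompL2_fun.

Lemma wcompL2_isometric : isometric wcompL2.
Proof.
move=> u; apply/eqP; rewrite -(eqrXn2 (_ : 0 < 2)%N) ?nrm_ge0//.
have su := L2_funP u.
by rewrite -eqe (sqr_nrm_mkL2 (wcomp_sqint su)) (wcomp_int su) sqr_nrm_L2.
Qed.

Lemma wcompL2_mk f : square_integrable mu f -> wcompL2 (mkL2 f) = mkL2 (wcomp f).
Proof. by move=> sf; apply: wcomp_ae => //; [exact: L2_funP|exact: mkL2_fun]. Qed.

Lemma wcompL2E u : L2_fun (wcompL2 u) = wcomp (L2_fun u) %[ae mu].
Proof. exact/mkL2_fun/wcomp_sqint/L2_funP. Qed.

End weighted_composition.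

End L2_theory.

(** * The Riesz-Fischer theorem for finite measures *)

Lemma summable_increments_cvg (R : realType) (r c : nat -> R) :
  (forall n, 0 <= c n) -> (\sum_(0 <= n <oo) (c n)%:E < +oo)%E ->
  (forall n, `|r n.+1 - r n| <= c n) -> cvgn r.
Proof.
move=> c0 coo rc.
have ge0S : (0 <= \sum_(0 <= n <oo) (c n)%:E)%E.
  by apply: nneseries_ge0 => n _ _; rewrite lee_fin.
have cc : cvgn (series c).
  apply: nondecreasing_is_cvgn.
    move=> m n mn; rewrite /series/= (big_cat_nat (leq0n m) mn)//= lerDl.
    by apply: sumr_ge0.
  exists (fine (\sum_(0 <= n <oo) (c n)%:E)%E) => _ [n _ <-].
  rewrite -lee_fin fineK ?ge0_fin_numE// /series/= -sumEFin.
  by apply: nneseries_lim_ge => k _ _; rewrite lee_fin.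
have cr : cvgn (series (telescope r)).
  apply: normed_cvg; apply: (series_le_cvg _ c0 _ cc) => n /=; first exact: normr_ge0.
  exact: rc.
rewrite (_ : r = (fun n => r 0%N + series (telescope r) n)).
  by apply: is_cvgD => //; exact: is_cvg_cst.
by apply/funext => n; rewrite -eq_sum_telescope.
Qed.

Lemma limn_einf_le (R : realType) (u : nat -> \bar R) (c : \bar R) :
  (forall n, (u n <= c)%E) -> (limn_einf u <= c)%E.
Proof.
move=> uc; rewrite limn_einf_lim; apply: lime_le; first exact: is_cvg_einfs.
apply: nearW => n; apply: le_trans (uc n); apply: ereal_inf_lbound.
by exists n => /=.
Qed.

Lemma limn_einf_ge (R : realType) (u : nat -> \bar R) (c : \bar R) :
  (forall n, (c <= u n)%E) -> (c <= limn_einf u)%E.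
Proof.
move=> cu; rewrite limn_einf_lim; apply: lime_ge; first exact: is_cvg_einfs.
by apply: nearW => n; apply: le_ereal_inf_tmp => _ [m _ <-].
Qed.

Section riesz_fischer.
Context d (T : measurableType d) (R : realType) (mu : {finite_measure set T -> \bar R}).
Local Notation Re := (@complex.Re R).
Local Notation Im := (@complex.Im R).
Variable u : nat -> L2 mu.
Hypothesis uP : forall n, nrm (u n.+1 - u n) <= 2^-1 ^+ n.

Let f n := L2_fun (u n).

Let mf n : measurable_fun setT (f n).
Proof. by have [] := L2_funP (u n). Qed.

Let mRe n : measurable_fun setT (Re \o f n). Proof. exact: measurable_Re. Qed.
Let mIm n : measurable_fun setT (Im \o f n). Proof. exact: measurable_Im. Qed.

Let msub n m : measurable_fun setT (fun x => sqr_modulus (f n x - f m x)).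
Proof.
rewrite (_ : (fun x => _) = @sqr_modulus R \o (f n - f m)) //.
by apply: measurable_sqr_modulus; have [] := square_integrableB (L2_funP (u n)) (L2_funP (u m)).
Qed.

Let int_sub n m :
  (\int[mu]_x (sqr_modulus (f n x - f m x))%:E = (nrm (u n - u m) ^+ 2)%:E)%E.
Proof.
have sfn := L2_funP (u n); have sfm := L2_funP (u m).
rewrite -{1}[u n]L2_funK -{1}[u m]L2_funK -mkL2B//.
by rewrite (sqr_nrm_mkL2 (square_integrableB sfn sfm)).
Qed.

(** A pointwise bound for the increments whose integrals are summable: the first term because [mu]
    is finite, the second because the squared norm of an increment is at most [4^-n]. *)
Let c n x : R := 2^-1 ^+ n + 2 ^+ n * sqr_modulus (f n.+1 x - f n x).

Let c_ge0 n x : 0 <= c n x.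
Proof. by rewrite addr_ge0 ?mulr_ge0 ?exprn_ge0 ?sqr_modulus_ge0. Qed.

(* AM-GM: [|t| <= 2^-n + 2^n t^2] *)
Let abs_le_c n x (a b : R) : a ^+ 2 + b ^+ 2 = sqr_modulus (f n.+1 x - f n x) ->
  `|a| <= c n x.
Proof.
move=> ab; rewrite /c -ab.
have p0 : 0 < 2 ^+ n :> R by rewrite exprn_gt0.
have pV : 2 ^+ n * 2^-1 ^+ n = 1 :> R by rewrite -exprMn divff// expr1n.
have -> : a ^+ 2 = `|a| ^+ 2 by rewrite real_normK// num_real.
have q0 : 0 < 2^-1 ^+ n :> R by rewrite exprn_gt0.
have h : 0 <= 2 ^+ n * b ^+ 2 by rewrite mulr_ge0 ?sqr_ge0// ltW.
have := normr_ge0 a; set t := `|a| => t0.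
have : 0 <= 2 ^+ n * ((t - 2^-1 ^+ n / 2) ^+ 2 + 3 / 4 * 2^-1 ^+ n ^+ 2).
  rewrite mulr_ge0 ?ltW// ltr_wpDl ?sqr_ge0// mulr_gt0 ?exprn_gt0//; lra.
have -> : 2 ^+ n * ((t - 2^-1 ^+ n / 2) ^+ 2 + 3 / 4 * 2^-1 ^+ n ^+ 2) =
  2 ^+ n * t ^+ 2 - (2 ^+ n * 2^-1 ^+ n) * t + (2 ^+ n * 2^-1 ^+ n) * 2^-1 ^+ n.
  by field.
rewrite pV; lra.
Qed.

Let mc n : measurable_fun setT (fun x => (c n x)%:E).
Proof.
apply/measurable_EFinP; apply: measurable_funD => //.
exact: measurable_funM.
Qed.

(** The bound is [2^-n (mu(T) + 1)], written in the form summed by [epsilon_trick0]. *)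
Let int_c n : (\int[mu]_x (c n x)%:E <= (2 * (fine (mu setT) + 1) / (2 ^ n.+1)%:R)%:E)%E.
Proof.
have p0 : 0 < 2 ^+ n :> R by rewrite exprn_gt0.
have pV : 2^-1 ^+ n = (2 ^+ n)^-1 :> R by rewrite exprVn.
rewrite (eq_integral (fun x => ((2^-1 ^+ n)%:E +
  (2 ^+ n)%:E * (sqr_modulus (f n.+1 x - f n x))%:E)%E))//.
have ms : measurable_fun setT (fun x => (sqr_modulus (f n.+1 x - f n x))%:E).
  exact/measurable_EFinP.
have s0 x : (0 <= (sqr_modulus (f n.+1 x - f n x))%:E)%E.
  by rewrite lee_fin sqr_modulus_ge0.
rewrite ge0_integralD//; try by [move=> x _; rewrite lee_fin exprn_ge0 |
  move=> x _; apply: mule_ge0 => //; rewrite lee_fin ltW | exact: measurable_funeM].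
rewrite integral_cst// ge0_integralZl_EFin//.
rewrite int_sub -[X in (_ * X + _)%E](@fineK _ (mu setT)) ?fin_num_measure//.
rewrite -!EFinM -EFinD lee_fin.
have h : nrm (u n.+1 - u n) ^+ 2 <= 2^-1 ^+ n ^+ 2.
  by rewrite ler_pXn2r// ?nnegrE ?nrm_ge0 ?exprn_ge0.
have -> : 2 * (fine (mu setT) + 1) / (2 ^ n.+1)%:R =
  2^-1 ^+ n * fine (mu setT) + 2 ^+ n * 2^-1 ^+ n ^+ 2.
  by rewrite natrX exprS pV; field; rewrite gt_eqF.
by rewrite lerD2l ler_pM2l.
Qed.

Let sum_c_fin : {ae mu, forall x, (\sum_(0 <= n <oo) (c n x)%:E < +oo)%E}.
Proof.
have S0 x : (0 <= \sum_(0 <= n <oo) (c n x)%:E)%E.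
  by apply: nneseries_ge0 => n _ _; rewrite lee_fin.
have mS : measurable_fun setT (fun x => (\sum_(0 <= n <oo) (c n x)%:E)%E).
  by apply: ge0_emeasurable_sum => // n x _ _; rewrite lee_fin.
have iS : mu.-integrable setT (fun x => (\sum_(0 <= n <oo) (c n x)%:E)%E).
  apply/integrableP; split => //.
  under eq_integral do rewrite gee0_abs//.
  rewrite integral_nneseries//; last by move=> n x _; rewrite lee_fin.
  apply: (@le_lt_trans _ _ (2 * (fine (mu setT) + 1))%:E); last exact: ltry.
  apply: le_trans (epsilon_trick0 xpredT _).
    by apply: lee_nneseries => // n _ _; apply: integral_ge0 => x _; rewrite lee_fin.
  by rewrite mulr_ge0// addr_ge0// fine_ge0.
apply: filterS (integrable_ae measurableT iS) => x /(_ I).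
by rewrite ge0_fin_numE.
Qed.

(** An upper limit is defined and measurable everywhere; almost everywhere it is the limit. *)
Let F x : R[i] := Complex (fine (limn_esup (fun n => (Re (f n x))%:E)))
                          (fine (limn_esup (fun n => (Im (f n x))%:E))).

Let mF : measurable_fun setT F.
Proof.
apply/measurable_complexP; split.
  apply: (measurableT_comp (fine_measurable measurableT)) => //.
  by apply: measurable_fun_limn_esup => n; apply/measurable_EFinP; exact: mRe.
apply: (measurableT_comp (fine_measurable measurableT)) => //.
by apply: measurable_fun_limn_esup => n; apply/measurable_EFinP; exact: mIm.
Qed.

Let cvgF : {ae mu, forall x, Re (f n x) @[n --> \oo] --> Re (F x) /\
                             Im (f n x) @[n --> \oo] --> Im (F x)}.
Proof.
apply: filterS sum_c_fin => x cx.
have h (r : nat -> R) : cvgn r -> r @ \oo --> fine (limn_esup (EFin \o r)).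
  move=> /cvg_ex[l rl]; suff -> : limn_esup (EFin \o r) = l%:E by [].
  by apply: (cvg_limn_einf_sup _).2; apply: cvg_EFin; [exact: nearW|exact: rl].
split; apply: h; apply: (summable_increments_cvg (c_ge0^~ x) cx) => n.
  by apply: (abs_le_c (b := Im (f n.+1 x) - Im (f n x))); rewrite sqr_modulusE !raddfB.
by apply: (abs_le_c (b := Re (f n.+1 x) - Re (f n x))); rewrite sqr_modulusE !raddfB addrC.
Qed.

(** Fatou's lemma for [|f_(n+m) - f_n|^2] as [m] grows, with [fast_cauchy] bounding each
    integral. *)
Let int_F n : (\int[mu]_x (sqr_modulus (F x - f n x))%:E <= ((2 * 2^-1 ^+ n) ^+ 2)%:E)%E.
Proof.
pose G m x := (sqr_modulus (f (n + m)%N x - f n x))%:E.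
have mG m : measurable_fun setT (G m) by exact/measurable_EFinP.
have -> : (\int[mu]_x (sqr_modulus (F x - f n x))%:E = \int[mu]_x limn_einf (G^~ x))%E.
  apply: ge0_ae_eq_integral => //.
  - apply/measurable_EFinP; rewrite (_ : (fun x => _) = @sqr_modulus R \o (F \- f n))//.
    apply: measurable_sqr_modulus; apply/measurable_complexP; split.
      rewrite (_ : _ \o _ = (Re \o F) \- (Re \o f n)).
        by apply: measurable_funB => //; exact: measurable_Re.
      by apply/funext => x /=; rewrite raddfB.
    rewrite (_ : _ \o _ = (Im \o F) \- (Im \o f n)).
      by apply: measurable_funB => //; exact: measurable_Im.
    by apply/funext => x /=; rewrite raddfB.
  - apply: (measurableT_comp (@oppe_measurable R setT)) => //.
    by apply: measurable_fun_limn_esup => m; apply: (measurableT_comp (@oppe_measurable R setT)).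
  - by move=> x _; rewrite lee_fin sqr_modulus_ge0.
  - by move=> x _; apply: limn_einf_ge => m; rewrite lee_fin sqr_modulus_ge0.
  - apply: filterS cvgF => x [rx ix] _; apply/esym.
    have hx (r : nat -> R) l k : r @ \oo --> l ->
        (r (n + m)%N - k) ^+ 2 @[m --> \oo] --> (l - k) ^+ 2.
      rewrite -(cvg_shiftn n r) => rl; under eq_fun do rewrite addnC expr2.
      by rewrite expr2; apply: cvgM; apply: cvgB => //; exact: cvg_cst.
    apply: (cvg_limn_einf_sup _).1; apply: cvg_EFin; first exact: nearW.
    rewrite /comp /= sqr_modulusE !raddfB/=.
    rewrite (_ : (fun m => _) = (fun m => (Re (f (n + m)%N x) - Re (f n x)) ^+ 2 +
      (Im (f (n + m)%N x) - Im (f n x)) ^+ 2)); last first.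
      by apply/funext => m; rewrite sqr_modulusE !raddfB.
    by apply: cvgD; [exact: (hx (fun m => Re (f m x)))|exact: (hx (fun m => Im (f m x)))].
apply: (le_trans (fatou mu measurableT mG _)).
  by move=> m x _; rewrite lee_fin sqr_modulus_ge0.
apply: limn_einf_le => m; rewrite /G int_sub lee_fin.
by rewrite ler_pXn2r// ?nnegrE ?nrm_ge0 ?mulr_ge0 ?exprn_ge0//; exact: fast_cauchy.
Qed.

Let sF : square_integrable mu F.
Proof.
have sf := L2_funP (u 0%N).
rewrite (_ : F = (F - f 0%N) + f 0%N); last by rewrite subrK.
apply: square_integrableD => //; split; last exact: le_lt_trans (int_F 0) (ltry _).
apply/measurable_complexP; split.
  rewrite (_ : _ \o _ = (Re \o F) \- (Re \o f 0%N)).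
    by apply: measurable_funB => //; exact: measurable_Re.
  by apply/funext => x /=; rewrite raddfB.
rewrite (_ : _ \o _ = (Im \o F) \- (Im \o f 0%N)).
  by apply: measurable_funB => //; exact: measurable_Im.
by apply/funext => x /=; rewrite raddfB.
Qed.

Lemma fast_cauchy_L2_limit : exists x : L2 mu, forall n, nrm (u n - x) <= 2 * 2^-1 ^+ n.
Proof.
exists (mkL2 mu F) => n; have sf := L2_funP (u n).
rewrite nrmC -(@ler_pXn2r _ 2)// ?nnegrE ?nrm_ge0 ?mulr_ge0 ?exprn_ge0//.
rewrite -lee_fin -{1}[u n]L2_funK -mkL2B//.
by rewrite (sqr_nrm_mkL2 (square_integrableB sF sf)); exact: int_F.
Qed.

End riesz_fischer.

Lemma L2_fast_complete d (T : measurableType d) (R : realType)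
  (mu : {finite_measure set T -> \bar R}) : fast_complete (L2 mu).
Proof.
move=> u uP; have [x ux] := fast_cauchy_L2_limit uP; exists x => e e0.
have [n0 _ hn] := near_half_expn (divr_gt0 e0 (ltr0n _ 2)).
exists n0 => n /hn h; rewrite (le_lt_trans (ux n))//; move: h => /=; lra.
Qed.

(** * Functional monotone classes *)

Section step_polynomials.
Variable R : realType.
Implicit Types (x r t : R) (n : nat).

Lemma bernoulli_ineq x n : -1 <= x -> 1 + n%:R * x <= (1 + x) ^+ n.
Proof.
move=> x1; elim: n => [|n ih]; first by rewrite mul0r addr0 expr0.
rewrite exprS -natr1.
have h : 0 <= 1 + x by lra.
apply: le_trans (ler_wpM2l h ih).
have := sqr_ge0 x; have : 0 <= n%:R :> R by []; nra.
Qed.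

(** With [s] the square root of [r], the term is [(n s^n) s^n], and [n s^n] stays below
    [1/(1-s)]. *)
Lemma cvg_natr_expn r : 0 <= r -> r < 1 -> n%:R * r ^+ n @[n --> \oo] --> (0 : R).
Proof.
move=> r0 r1; pose s := Num.sqrt r.
have s0 : 0 <= s by exact: sqrtr_ge0.
have ss : s ^+ 2 = r by rewrite sqr_sqrtr.
have s1 : s < 1 by rewrite -(@ltr_pXn2r _ 2)// ?nnegrE// ss expr1n.
have geo n : (1 - s) * (n%:R * s ^+ n) <= 1 - s ^+ n.
  elim: n => [|n ih]; first by rewrite mul0r mulr0 subrr.
  rewrite exprS -natr1; have sn : 0 <= s ^+ n by rewrite exprn_ge0.
  have : 0 <= n%:R :> R by [].
  have p1 : s ^+ n <= 1 by rewrite exprn_ile1// ltW.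
  move: ih sn p1; move: (s ^+ n) (n%:R) => p q ih p0 p1 q0.
  have : s * ((1 - s) * (q * p)) <= s * (1 - p) by exact: ler_wpM2l.
  have : 0 <= (1 - s) * (1 - s * p) by rewrite mulr_ge0//; nra.
  lra.
have lim0 : (1 - s)^-1 * s ^+ n @[n --> \oo] --> (0 : R).
  rewrite -[X in _ --> X](mulr0 (1 - s)^-1); apply: cvgM; first exact: cvg_cst.
  by apply: cvg_expr; rewrite ger0_norm.
apply: (squeeze_cvgr _ (cvg_cst _) lim0); apply: nearW => n.
have sn : 0 <= s ^+ n by rewrite exprn_ge0.
rewrite mulr_ge0 ?exprn_ge0//= ler_pdivlMl ?subr_gt0//.
have -> : r ^+ n = s ^+ n * s ^+ n by rewrite -ss -exprM mulnC exprM expr2.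
rewrite !mulrA -(mulrA (1 - s)) ler_piMl// (le_trans (geo n))//; lra.
Qed.

(* The step polynomials from the Brosowski-Deutsch proof of Stone-Weierstrass,
   with an extra factor [n] in the exponent to settle the threshold [t = 1/2]. *)
Definition step_poly n t : R := (1 - t ^+ n) ^+ (2 ^ n * n).

Lemma step_poly_itv n t : 0 <= t -> t <= 1 -> 0 <= step_poly n t <= 1.
Proof.
move=> t0 t1.
have tn0 : 0 <= t ^+ n by rewrite exprn_ge0.
have tn1 : t ^+ n <= 1 by rewrite exprn_ile1.
by rewrite exprn_ge0 ?subr_ge0// exprn_ile1 ?subr_ge0// gerBl.
Qed.

(** Below 1/2, Bernoulli's inequality gives the lower bound [1 - n (2t)^n]. From 1/2 on, put
    [y = 2^-n <= t^n]: since [(1-y)^(2^n) (1+y)^(2^n) <= 1] and Bernoulli makes the second factor at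
    least 2, the first is at most 1/2, and its [n]-th power tends to 0. *)
Lemma cvg_step_poly t : 0 <= t -> t <= 1 ->
  step_poly n t @[n --> \oo] --> (if t < 2^-1 then 1 else 0 : R).
Proof.
move=> t0 t1; case: ifPn => [t2|]; last rewrite -leNgt => t2.
- have lim1 : 1 - n%:R * (2 * t) ^+ n @[n --> \oo] --> (1 : R).
    rewrite -[X in _ --> X]subr0; apply: cvgB; first exact: cvg_cst.
    by apply: cvg_natr_expn; lra.
  apply: (squeeze_cvgr _ lim1 (cvg_cst _)); apply: nearW => n.
  have /andP[_ ->] := step_poly_itv n t0 t1; rewrite andbT.
  have tn1 : t ^+ n <= 1 by rewrite exprn_ile1.
  apply: le_trans (bernoulli_ineq _ _); last by lra.
  by rewrite natrM natrX exprMn; lra.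
- have lim0 : (2^-1 : R) ^+ n @[n --> \oo] --> (0 : R).
    by apply: cvg_expr; rewrite ger0_norm//; lra.
  apply: (squeeze_cvgr _ (cvg_cst _) lim0); apply: nearW => n.
  have /andP[-> _] /= := step_poly_itv n t0 t1.
  rewrite /step_poly exprM; pose y : R := 2^-1 ^+ n.
  have y0 : 0 <= y by rewrite exprn_ge0.
  have y1 : y <= 1 by rewrite exprn_ile1//; lra.
  have yt : y <= t ^+ n by rewrite lerXn2r// ?nnegrE//; lra.
  have tn1 : t ^+ n <= 1 by rewrite exprn_ile1.
  have h : (1 - y) ^+ (2 ^ n) <= 2^-1.
    have : (1 - y) ^+ (2 ^ n) * (1 + y) ^+ (2 ^ n) <= 1.
      by rewrite -exprMn exprn_ile1//; nra.
    have : 1 + (2 ^ n)%:R * y <= (1 + y) ^+ (2 ^ n) by apply: bernoulli_ineq; lra.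
    have -> : (2 ^ n)%:R * y = 1.
      by rewrite natrX /y -exprMn divff// expr1n.
    have : 0 <= (1 - y) ^+ (2 ^ n) by rewrite exprn_ge0//; lra.
    by move: ((1 - y) ^+ (2 ^ n)) ((1 + y) ^+ (2 ^ n)) => a b; nra.
  rewrite lerXn2r// ?nnegrE ?exprn_ge0//; try lra.
  by apply: le_trans h; rewrite lerXn2r// ?nnegrE; lra.
Qed.

End step_polynomials.

Section functional_monotone_class.
Variables (R : realType) (T : Type).
Implicit Types (f g : T -> R) (M E : set (T -> R)) (A : set T).

Record monotone_class M : Prop := MonotoneClass {
  mono_lin : forall (k : R) f g, M f -> M g -> M (fun x => k * f x + g x) ;
  mono_lim : forall (f_ : nat -> T -> R) f (C : R), (forall n, M (f_ n)) ->
    (forall n x, `|f_ n x| <= C) -> (forall x, f_ n x @[n --> \oo] --> f x) -> M f }.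

Definition mono_gen E f : Prop := forall M, monotone_class M -> E `<=` M -> M f.

Lemma mono_genP E : monotone_class (mono_gen E).
Proof.
split=> [k f g Ef Eg M mM EM|f_ f C Ef fC ff M mM EM].
  by apply: mono_lin => //; [exact: Ef|exact: Eg].
by apply: (mono_lim mM _ fC ff) => n; exact: Ef.
Qed.

Lemma sub_mono_gen E : E `<=` mono_gen E.
Proof. by move=> f Ef M _; apply. Qed.

Variable E : set (T -> R).
Hypotheses (E1 : E (fun=> 1)) (Ebd : forall f, E f -> exists C : R, forall x, `|f x| <= C).
(** Products are only asked to lie in the generated class: the product of two real parts of
    characters is a combination of such parts, not itself one. *)
Hypothesis EM : forall f g, E f -> E g -> mono_gen E (fun x => f x * g x).

Local Notation G := (mono_gen E).

Lemma gen_cst k : G (fun=> k).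
Proof.
have G1 : G (fun=> 1) by exact: sub_mono_gen.
have := mono_lin (mono_genP E) (k - 1) G1 G1.
by congr (G _); apply/funext => x; rewrite mulr1 subrK.
Qed.

Lemma genD f g : G f -> G g -> G (fun x => f x + g x).
Proof.
move=> Gf Gg; have := mono_lin (mono_genP E) 1 Gf Gg.
by congr (G _); apply/funext => x; rewrite mul1r.
Qed.

Lemma genZ k f : G f -> G (fun x => k * f x).
Proof.
move=> Gf; have := mono_lin (mono_genP E) k Gf (gen_cst 0).
by congr (G _); apply/funext => x; rewrite addr0.
Qed.

Lemma gen_affine k l f : G f -> G (fun x => k * f x + l).
Proof. by move=> Gf; apply: genD; [exact: genZ|exact: gen_cst]. Qed.

Lemma gen_bounded f : G f -> exists C : R, forall x, `|f x| <= C.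
Proof.
move=> Gf; apply: (Gf [set g | exists C : R, forall x, `|g x| <= C]); last exact: Ebd.
split=> [k g h [C gC] [D hD]|f_ g C _ fC fg].
  exists (`|k| * C + D) => x; rewrite (le_trans (ler_normD _ _))// normrM.
  by rewrite lerD// ler_wpM2l.
exists C => x; have fx : `|f_ n x| @[n --> \oo] --> `|g x| by exact: cvg_norm.
rewrite -(cvg_lim _ fx)//; apply: limr_le; first exact: cvgP fx.
by apply: nearW => n; exact: fC.
Qed.

Lemma mono_mul f : (exists C : R, forall x, `|f x| <= C) ->
  monotone_class [set g | G (fun x => f x * g x)].
Proof.
move=> [C fC]; split=> [k g h /= Gg Gh|f_ g D /= Gf fD fg].
  have := mono_lin (mono_genP E) k Gg Gh.
  by congr (G _); apply/funext => x; rewrite mulrDr mulrCA.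
apply: (mono_lim (mono_genP E) (C := C * D) Gf).
  by move=> n x; rewrite normrM ler_pM.
by move=> x; apply: cvgM; [exact: cvg_cst|exact: fg].
Qed.

(** The usual two rounds: for a fixed bounded factor the admissible other factors form a monotone
    class, so first one factor and then the other is reduced to a member of [E]. *)
Lemma genM f g : G f -> G g -> G (fun x => f x * g x).
Proof.
move=> Gf Gg; apply: (Gg _ (mono_mul (gen_bounded Gf))) => e Ee /=.
rewrite (_ : (fun x => _) = (fun x => e x * f x)); last first.
  by apply/funext => x; rewrite mulrC.
by apply: (Gf _ (mono_mul (Ebd Ee))) => e' Ee' /=; exact: EM.
Qed.

Lemma genX f n : G f -> G (fun x => f x ^+ n).
Proof.
move=> Gf; elim: n => [|n ih]; first exact: gen_cst.
have := genM Gf ih.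
by congr (G _); apply/funext => x; rewrite exprS.
Qed.

Lemma gen_lt f (a : R) : G f -> G \1_[set x | f x < a].
Proof.
move=> Gf; have [C fC] := gen_bounded Gf.
have C0 : 0 < `|a| + `|C| + 1 by rewrite ltr_wpDl// addr_ge0.
(* [D] dominates [|f - a|], so [t] takes values in [[0, 1]] and the threshold [a] goes to 1/2, where
   the step polynomials jump. *)
pose D := `|a| + `|C| + 1; pose t x := (2 * D)^-1 * f x + (2^-1 - (2 * D)^-1 * a).
have tE x : t x = 2^-1 + (f x - a) / (2 * D) by rewrite /t; ring.
have Gt : G t by exact: gen_affine.
have fa x : - D <= f x - a <= D.
  rewrite -ler_norml (le_trans (ler_normB _ _))// /D.
  have := fC x; have := ler_norm C; lra.
have D0 : 0 < 2 * D by rewrite mulr_gt0.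
have tx x : (0 <= t x) && (t x <= 1).
  have /andP[h1 h2] := fa x.
  have : - 2^-1 <= (f x - a) / (2 * D) by rewrite ler_pdivlMr//; move: h1; lra.
  have : (f x - a) / (2 * D) <= 2^-1 by rewrite ler_pdivrMr//; move: h2; lra.
  by rewrite tE; lra.
apply: (mono_lim (mono_genP E) (f_ := fun n x => step_poly n (t x)) (C := 1)).
- move=> n; apply: genX; have := gen_affine (-1) 1 (genX n Gt).
  by congr (G _); apply/funext => x; rewrite mulN1r addrC.
- move=> n x; have /andP[t0 t1] := tx x; have /andP[s0 s1] := step_poly_itv n t0 t1.
  by rewrite ger0_norm.
- move=> x; have /andP[t0 t1] := tx x; have := cvg_step_poly t0 t1.
  rewrite indicE; suff -> : (x \in [set x | f x < a]) = (t x < 2^-1) by case: ifP.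
  rewrite tE gtrDl ltr_pdivrMr// mul0r subr_lt0.
  by apply/idP/idP => [/set_mem|?]; [|exact/mem_set].
Qed.

Lemma gen_sigma_algebra : sigma_algebra setT [set A | G \1_A].
Proof.
have G1C A : G \1_A -> G \1_(~` A).
  move=> GA; have := gen_affine (-1) 1 GA.
  by congr (G _); apply/funext => x; rewrite !indicE in_setC; case: (x \in A); rewrite /=; ring.
have G1I A B : G \1_A -> G \1_B -> G \1_(A `&` B).
  move=> GA GB; have := genM GA GB; congr (G _); apply/funext => x.
  by rewrite !indicE in_setI; case: (x \in A); case: (x \in B); rewrite /=; ring.
split=> [/=|A GA /=|F GF /=].
- by rewrite indic0; exact: (gen_cst 0).
- by rewrite setTD; exact: G1C.
- have GU n : G \1_(\big[setU/set0]_(i < n) F i).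
    elim: n => [|n ih]; first by rewrite big_ord0 indic0; exact: (gen_cst 0).
    rewrite big_ord_recr/= -[X in \1_X]setCK setCU; apply: (G1C (_ `&` _)); by apply: G1I; [exact: (G1C _ ih)|exact: (G1C _ (GF n))].
  apply: (mono_lim (mono_genP E) (C := 1) GU).
    by move=> n x; rewrite indicE; case: (x \in _); rewrite /= ?normr1 ?normr0.
  move=> x; rewrite [X in _ --> X]indicE; case: (boolP (x \in _)) => [/set_mem[k _ Fkx]|xF].
    apply: cvg_near_cst; exists k.+1 => // n /= kn.
    rewrite indicE mem_set// -bigcup_mkord; by exists k.
  apply: cvg_near_cst; apply: nearW => n; rewrite indicE memNset//.
  rewrite -bigcup_mkord => -[k _ Fkx]; move/negP: xF; apply.
  by apply/mem_set; exists k.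
Qed.

Lemma gen_indic A : <<s [set B | exists f a, E f /\ B = [set x | f x < a]] >> A -> G \1_A.
Proof.
move=> sA; apply: (sA [set A | G \1_A]); split; first exact: gen_sigma_algebra.
by move=> _ [f [a [Ef ->]]] /=; apply: gen_lt; exact: sub_mono_gen.
Qed.

End functional_monotone_class.

Import HBNNSimple.

Section bounded_measurable.
Context d (T : measurableType d) (R : realType) (E : set (T -> R)).
Hypotheses (E1 : E (fun=> 1)) (Ebd : forall f, E f -> exists C : R, forall x, `|f x| <= C).
Hypothesis EM : forall f g, E f -> E g -> mono_gen E (fun x => f x * g x).
Hypothesis Emeas : forall A, measurable A ->
  <<s [set B | exists f (a : R), E f /\ B = [set x | f x < a]] >> A.

Lemma functional_monotone_class (M : set (T -> R)) (f : T -> R) (C : R) :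
  monotone_class M -> E `<=` M ->
  measurable_fun setT f -> (forall x, `|f x| <= C) -> M f.
Proof.
move=> mM EsM mf fC; apply: (_ : mono_gen E f) => //.
(* Adding [C] makes the function nonnegative, hence an increasing limit of simple functions bounded
   by [2 C]. *)
have mfC : measurable_fun setT (fun x => (f x + C)%:E).
  by apply/measurable_EFinP; exact: measurable_funD.
have fC0 x : setT x -> (0 <= (f x + C)%:E)%E.
  by move=> _; rewrite lee_fin; have := fC x; rewrite ler_norml; lra.
pose g := nnsfun_approx measurableT mfC.
have gG n : mono_gen E (fun x => g n x).
  rewrite (_ : (fun x => g n x) =
      fun x => \sum_(y <- fset_set (range (g n))) y * \1_(g n @^-1` [set y]) x).
    elim: (enum_fset _) => [|y s ih].
      by rewrite (_ : (fun _ => _) = cst 0); [exact: gen_cst|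
        apply/funext => x; rewrite big_nil].
    have Gy : mono_gen E \1_(g n @^-1` [set y]) 
      by apply: (gen_indic E1 Ebd EM); apply: Emeas; exact: measurable_funPTI.
    have := mono_lin (mono_genP E) y Gy ih.
    by congr (mono_gen E _); apply/funext => x; rewrite big_cons.
  by apply/funext => x; rewrite [LHS]fimfunE fsbig_finite.
have glim x : g n x @[n --> \oo] --> f x + C.
  by have := @cvg_nnsfun_approx _ _ _ _ measurableT _ mfC fC0 x Logic.I; move/fine_cvgP => [].
have gle n x : g n x <= f x + C.
  have nd : nondecreasing_seq (g^~ x).
    by move=> m k mk; have /lefP := nd_nnsfun_approx measurableT mfC mk; apply.
  by have := nondecreasing_cvgn_le nd (cvgP _ (glim x)) n; rewrite (cvg_lim _ (glim x)).
have := gen_affine E1 1 (- C) (_ : mono_gen E (fun x => f x + C)).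
move=> h; have /h : mono_gen E (fun x => f x + C).
  apply: (mono_lim (mono_genP E) (f_ := fun n x => g n x) (C := 2 * C)) => // n x.
  by rewrite ger0_norm// (le_trans (gle n x))//; have := fC x; rewrite ler_norml; lra.
by congr (mono_gen E _); apply/funext => x; rewrite mul1r addrK.
Qed.

End bounded_measurable.

(** * The Borel sets of the solenoid *)

Section solenoid_borel.
Variables (R : realType) (N : nat).
Local Notation Re := (@complex.Re R).
Local Notation Im := (@complex.Im R).
Local Notation sol := (solenoid R N).

Lemma coord_expn (z : sol) (n : int) (r : nat) :
  coord z n = coord z (n + r%:Z) ^+ (N ^ r).
Proof.
elim: r => [|r ih]; first by rewrite addr0 expn0 expr1.
by rewrite ih -(coordP z (n + r%:Z)).1 -exprM -expnS -addrA -PoszD addn1.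
Qed.

Lemma coord_norm (z : sol) n : `|coord z n| = 1.
Proof. exact: (coordP z n).2. Qed.

(** Constraining one coordinate of nonnegative index is enough: each coordinate is a power of any
    later one, so finitely many constraints can be moved to a common level. *)
Definition coord_nbhs (z : sol) : set_system sol :=
  [set A | exists (p : nat) (V : set R[i]),
    [/\ open V, V (coord z p) & [set w | V (coord w p)] `<=` A]].

Lemma continuous_expn k : continuous (fun x : R[i] => x ^+ k).
Proof.
elim: k => [|k ih] x; first exact: cst_continuous.
rewrite /continuous_at exprS; under eq_fun do rewrite exprS.
by apply: (@cvgM _ _ _ (nbhs_filter x)); [move=> A|exact: ih].
Qed.

Lemma open_expn (V : set R[i]) k : open V -> open [set x | V (x ^+ k)].
Proof. by move=> oV; apply: open_comp => // x _; exact: continuous_expn. Qed.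

Lemma coord_nbhs_filter z : Filter (coord_nbhs z).
Proof.
split.
- by exists 0%N, setT; split => //; exact: openT.
- move=> A B [p [V [oV Vz VA]]] [q [W [oW Wz WB]]].
  have raise n m U : (n <= m)%N -> open U -> U (coord z n) ->
     exists U', [/\ open U', U' (coord z m) & forall w : sol, U' (coord w m) -> U (coord w n)].
    move=> nm oU Uz; exists [set x | U (x ^+ (N ^ (m - n)))].
    have e (w : sol) : coord w m ^+ (N ^ (m - n)) = coord w n.
      by rewrite [RHS](coord_expn _ _ (m - n)) -PoszD subnKC.
    by split => [||w]; [exact: open_expn|rewrite /= e|rewrite /= e].
  have [V' [oV' V'z V'V]] := raise _ _ _ (leq_maxl p q) oV Vz.
  have [W' [oW' W'z W'W]] := raise _ _ _ (leq_maxr p q) oW Wz.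
  exists (maxn p q), (V' `&` W'); split => //; first exact: openI.
  by move=> w [/V'V ? /W'W ?]; split; [exact: VA|exact: WB].
- by move=> A B AB [p [V [oV Vz VA]]]; exists p, V; split => //; exact: subset_trans AB.
Qed.

Lemma nbhs_coord_nbhs z U : nbhs z U -> coord_nbhs z U.
Proof.
have FF := coord_nbhs_filter z.
have cG : (set_val w : {ptws int -> R[i]}) @[w --> coord_nbhs z] --> set_val z.
  have FG : Filter ((set_val w : {ptws int -> R[i]}) @[w --> coord_nbhs z]).
    exact: fmap_filter.
  apply/cvg_sup => n; apply/cvg_image.
    by apply/seteqP; split => // c _; exists (fun=> c).
  move=> V Vz /=; exists ((fun f : int -> R[i] => f n) @^-1` V); last first.
    by rewrite image_preimage//; apply/seteqP; split => // c _; exists (fun=> c).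
  have [p [k nE]] : exists (p : nat) k, forall w : sol, coord w n = coord w p ^+ k.
    case: n Vz => [p _|p _]; first by exists p, 1%N => w; rewrite expr1.
    by exists 0%N, (N ^ p.+1)%N => w; rewrite (coord_expn _ _ p.+1) NegzE addNr.
  move: Vz; rewrite nbhsE => -[W [oW Wz] WV].
  exists p, [set x | W (x ^+ k)]; split.
  - exact: open_expn.
  - by rewrite /= -nE.
  - by move=> w /=; rewrite -nE => /WV.
by move=> [?/= [[W oW <-]]] /= Wz /filterS; apply; apply: cG; exact: open_nbhs_nbhs.
Qed.

(** Collecting the cylinders inside [U] level by level turns an arbitrary union into a countable
    one, so that measurability of a map into the solenoid can be tested on coordinates. *)
Lemma open_solenoidP (U : set sol) : open U -> exists V : nat -> set R[i],
  (forall p, open (V p)) /\ U = \bigcup_p [set z | V p (coord z p)].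
Proof.
move=> oU.
pose V (p : nat) := \bigcup_(W in [set W : set R[i] | open W /\
   [set z : sol | W (coord z p)] `<=` U]) W.
exists V; split; first by move=> p; apply: bigcup_open => W [].
apply/seteqP; split => [z Uz|z [p _ [W [oW WU] Wz]]]; last exact: WU.
have [p [W [oW Wz WU]]] := nbhs_coord_nbhs (open_nbhs_nbhs (conj oU Uz)).
by exists p => //; exists W.
Qed.

Lemma measurable_solenoidP d (T : measurableType d) (f : T -> sol) :
  (forall p : nat, measurable_fun setT (fun x => coord (f x) p)) -> measurable_fun setT f.
Proof.
move=> mf; apply: (@measurability _ _ _ _ _ _ (@open sol)) => //.
move=> _ [U oU <-]; rewrite setTI.
have [V [oV ->]] := open_solenoidP oU.
rewrite preimage_bigcup; apply: bigcupT_measurable => p.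
rewrite -[X in measurable X]setTI; apply: (mf p) => //.
by apply: sub_sigma_algebra; exact: oV.
Qed.

Lemma measurable_coord n : measurable_fun setT (fun z : sol => coord z n).
Proof.
apply: (@measurability _ _ _ _ _ _ (@open R[i])) => //.
move=> _ [U oU <-]; rewrite setTI; apply: sub_sigma_algebra.
by apply: open_comp => // z _; exact: continuous_coord.
Qed.

(** The character dual to [(K-L)/N^p]: conjugation inverts numbers of modulus 1, so two natural
    exponents replace an integer one. *)
Definition chi (p K L : nat) (z : sol) : R[i] := coord z p ^+ K * (coord z p)^* ^+ L.

Lemma chi_raise r p K L z : chi p K L z = chi (p + r) (K * N ^ r) (L * N ^ r) z.
Proof.
by rewrite /chi (coord_expn z p r) -PoszD rmorphXn -!exprM ![(_ * N ^ r)%N]mulnC.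
Qed.

Lemma chiM p K L K' L' z : chi p K L z * chi p K' L' z = chi p (K + K') (L + L') z.
Proof. by rewrite /chi !exprD mulrACA. Qed.

Lemma chi_conj p K L z : (chi p K L z)^* = chi p L K z.
Proof. rewrite /chi rmorphM !rmorphXn/=. by rewrite conjCK mulrC. Qed.

Lemma chi_norm p K L z : `|chi p K L z| = 1.
Proof. by rewrite /chi normrM !normrX norm_conjC coord_norm !expr1n mulr1. Qed.

(** The dual form of the relation [u a_p u^-1 = a_p^N]. *)
Lemma chi_shift p K L z : chi p K L (shift z) = chi p (N * K) (N * L) z.
Proof.
rewrite /chi coord_shift !exprM -!rmorphXn.
by rewrite -[in coord z (p%:Z - 1) ^+ K](subrK 1 p%:Z) subrK -(coordP z (p%:Z - 1)).1 subrK.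
Qed.

Lemma measurable_chi p K L : measurable_fun setT (chi p K L).
Proof.
have mX (f : sol -> R[i]) k : measurable_fun setT f -> measurable_fun setT (fun z => f z ^+ k).
  move=> mf; elim: k => [|k ih]; first by under eq_fun do rewrite expr0; exact: measurable_cst.
  by under eq_fun do rewrite exprS; exact: measurable_cmul.
apply: measurable_cmul; first by apply: (mX _ K); exact: (@measurable_coord p).
apply: (mX _ L); have /measurable_complexP[mr mi] := @measurable_coord p.
apply/measurable_complexP; split.
  by rewrite (_ : _ \o _ = Re \o (fun z : sol => coord z p))//; apply/funext => z /=; case: (coord z p).
rewrite (_ : _ \o _ = (fun z : sol => - Im (coord z p))).
  exact: measurable_funN.
by apply/funext => z /=; case: (coord z p).
Qed.

Definition chi_parts : set (sol -> R) :=
  [set f | exists p K L, f = Re \o chi p K L \/ f = Im \o chi p K L].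

Lemma chi_parts1 : chi_parts (fun=> 1).
Proof.
exists 0%N, 0%N, 0%N; left; apply/funext => z.
by transitivity (Re (1 * 1)); [rewrite mulr1|].
Qed.

Lemma norm1_Re_Im (z : R[i]) : `|z| = 1 -> `|Re z| <= 1 /\ `|Im z| <= 1.
Proof.
move=> z1; rewrite -!lecR (_ : 1%:C%C = `|z|); last by rewrite z1.
by split; [exact: normc_ge_Re|exact: normc_geIm].
Qed.

Lemma chi_parts_bounded f : chi_parts f -> forall z, `|f z| <= 1.
Proof.
by move=> [p [K [L [|]]]] -> z; have [] := norm1_Re_Im (chi_norm p K L z).
Qed.

(** After both characters are raised to a common level, this is the product-to-sum formula:
    [Re a Re b] is the mean of the real parts of [a b] and of [a] times the conjugate of [b], and
    similarly for the other three products. *)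
Lemma chi_partsM f g : chi_parts f -> chi_parts g ->
  mono_gen chi_parts (fun x => f x * g x).
Proof.
have G k h h' : chi_parts h -> chi_parts h' ->
    mono_gen chi_parts (fun x => 2^-1 * h x + k * h' x).
  move=> /sub_mono_gen Gh /sub_mono_gen Gh'.
  apply: (mono_lin (mono_genP _)) => //.
  have := mono_lin (mono_genP chi_parts) (k - 1) Gh' Gh'.
  by congr (mono_gen _ _); apply/funext => x; ring.
move=> [p [K [L fE]]] [q [K' [L' gE]]].
pose s := (maxn p q - p)%N; pose s' := (maxn p q - q)%N.
pose a := chi (maxn p q) (K * N ^ s) (L * N ^ s).
pose b := chi (maxn p q) (K' * N ^ s') (L' * N ^ s').
have aE z : chi p K L z = a z by rewrite (chi_raise s) subnKC ?leq_maxl.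
have bE z : chi q K' L' z = b z by rewrite (chi_raise s') subnKC ?leq_maxr.
have ab z : Re (a z * b z) = Re (a z) * Re (b z) - Im (a z) * Im (b z) /\
  Im (a z * b z) = Re (a z) * Im (b z) + Im (a z) * Re (b z).
  by case: (a z) (b z) => ? ? [].
have abC z : Re (a z * (b z)^* ) = Re (a z) * Re (b z) + Im (a z) * Im (b z) /\
  Im (a z * (b z)^* ) = Im (a z) * Re (b z) - Re (a z) * Im (b z).
  by rewrite complex_conjE; case: (a z) (b z) => ? ? [? ?] /=; split; ring.
have Eab : chi_parts (fun z => Re (a z * b z)) /\ chi_parts (fun z => Im (a z * b z)).
  by split; do 3 eexists; [left|right]; apply/funext => z /=; rewrite chiM.
have EabC : chi_parts (fun z => Re (a z * (b z)^* )) /\ chi_parts (fun z => Im (a z * (b z)^* )).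
  by split; do 3 eexists; [left|right]; apply/funext => z /=; rewrite chi_conj chiM.
case: fE => ->; case: gE => ->.
- have := G 2^-1 _ _ Eab.1 EabC.1; congr (mono_gen _ _); apply/funext => z /=.
  by rewrite aE bE (ab z).1 (abC z).1; field.
- have := G (- 2^-1) _ _ Eab.2 EabC.2; congr (mono_gen _ _); apply/funext => z /=.
  by rewrite aE bE (ab z).2 (abC z).2; field.
- have := G 2^-1 _ _ Eab.2 EabC.2; congr (mono_gen _ _); apply/funext => z /=.
  by rewrite aE bE (ab z).2 (abC z).2; field.
- have := G (- 2^-1) _ _ EabC.1 Eab.1; congr (mono_gen _ _); apply/funext => z /=.
  by rewrite aE bE (ab z).1 (abC z).1; field.
Qed.

Let gen := [set B | exists (f : sol -> R) (a : R), chi_parts f /\ B = [set x | f x < a]].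

(** The identity from the solenoid with the generated sigma-algebra to the solenoid with its Borel
    sets is measurable, because the real and imaginary parts of the coordinates [z_p] belong to
    [chi_parts]. *)
Lemma chi_parts_measurable (A : set sol) : measurable A -> <<s gen >> A.
Proof.
pose T' := g_sigma_algebraType gen.
have mf (f : sol -> R) : chi_parts f -> measurable_fun setT (f : T' -> R).
  move=> Ef; apply: (measurability _ (RGenInftyO.measurableE R)).
  move=> _ [_ [a ->] <-]; rewrite setTI; apply: sub_sigma_algebra; exists f, a; split => //.
have mid : measurable_fun setT (id : T' -> sol).
  apply: measurable_solenoidP => p; apply/measurable_complexP; split.
    by apply: mf; exists p, 1%N, 0%N; left; apply/funext => z; rewrite /chi /= expr1 mulr1.
  by apply: mf; exists p, 1%N, 0%N; right; apply/funext => z; rewrite /chi /= expr1 mulr1.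
by move=> mA; have := mid measurableT A mA; rewrite setTI.
Qed.

Lemma solenoid_monotone_class (M : set (sol -> R)) (f : sol -> R) (C : R) :
  monotone_class M -> chi_parts `<=` M ->
  measurable_fun setT f -> (forall x, `|f x| <= C) -> M f.
Proof.
move=> mM EM; apply: (functional_monotone_class chi_parts1 _ chi_partsM) => //.
  by move=> g Eg; exists 1; exact: chi_parts_bounded.
exact: chi_parts_measurable.
Qed.

End solenoid_borel.

(** * Density of the characters in [L2(nu)] *)

Section L2_density.
Variable R : realType.
Local Notation Re := (@complex.Re R).
Local Notation Im := (@complex.Im R).

Section dominated.
Context d (T : measurableType d) (mu : {measure set T -> \bar R}).

Lemma L2_dominated_approx (f_ : nat -> T -> R[i]) (f : T -> R[i]) (g : T -> R) :
  (forall n, square_integrable mu (f_ n)) -> square_integrable mu f ->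
  mu.-integrable setT (EFin \o g) ->
  (forall n x, sqr_modulus (f_ n x - f x) <= g x) ->
  (forall x, sqr_modulus (f_ n x - f x) @[n --> \oo] --> (0 : R)) ->
  forall e : R, 0 < e -> exists n, nrm (mkL2 mu (f_ n) - mkL2 mu f) < e.
Proof.
move=> sf_ sf ig fg f0 e e0.
have nE n : ((nrm (mkL2 mu (f_ n) - mkL2 mu f) ^+ 2)%:E =
    \int[mu]_x (sqr_modulus (f_ n x - f x))%:E)%E.
  by rewrite -mkL2B// (sqr_nrm_mkL2 (square_integrableB (sf_ n) sf)).
have mf n : measurable_fun setT (fun x => (sqr_modulus (f_ n x - f x))%:E).
  apply/measurable_EFinP.
  rewrite (_ : (fun x => _) = @sqr_modulus R \o (f_ n - f))//.
  by apply: measurable_sqr_modulus; have [] := square_integrableB (sf_ n) sf.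
have h0 : \forall x \ae mu, setT x ->
    (sqr_modulus (f_ n x - f x))%:E @[n --> \oo] --> (0%E : \bar R).
  by apply: aeW => x _; apply: cvg_EFin; [exact: nearW|exact: f0].
have hg : \forall x \ae mu, forall n : nat, setT x ->
    (`|(sqr_modulus (f_ n x - f x))%:E| <= (EFin \o g) x)%E.
  by apply: aeW => x n _; rewrite /= ger0_norm ?sqr_modulus_ge0// lee_fin.
have [_ _] := dominated_convergence measurableT mf (measurable_cst _) h0 ig hg.
rewrite integral0.
under eq_fun do rewrite -nE.
move=> /fine_cvgP[_] /cvgrPdist_lt/(_ (e ^+ 2) (exprn_gt0 _ e0))[n _ /(_ n (leqnn _))].
rewrite /= sub0r normrN ger0_norm ?sqr_ge0// => ne; exists n.
by rewrite -(@ltr_pXn2r _ 2)// ?nnegrE ?nrm_ge0// ltW.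
Qed.

End dominated.

Section bounded.
Context d (T : measurableType d) (mu : {finite_measure set T -> \bar R}).

Lemma bounded_square_integrable (f : T -> R[i]) (C : R) : measurable_fun setT f ->
  (forall x, sqr_modulus (f x) <= C) -> square_integrable mu f.
Proof.
move=> mf fC; split => //; have ms := measurable_sqr_modulus mf.
apply: (@le_lt_trans _ _ (\int[mu]_x (cst C%:E x))%E).
  apply: ge0_le_integral => //=.
  - by move=> x _; rewrite lee_fin sqr_modulus_ge0.
  - exact/measurable_EFinP.
  - by move=> x _; rewrite lee_fin.
rewrite integral_cst// -[X in (_ * X)%E]fineK ?fin_num_measure// -EFinM; exact: ltry.
Qed.

End bounded.

Section solenoid_density.
Variables (N : nat) (nu : {finite_measure set (solenoid R N) -> \bar R}).
Local Notation sol := (solenoid R N).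

Definition chi3 (i : nat * nat * nat) : sol -> R[i] := chi i.1.1 i.1.2 i.2.
Definition chiL2 (i : nat * nat * nat) : L2 nu := mkL2 nu (chi3 i).

Lemma chi3_sqr_modulus i z : sqr_modulus (chi3 i z) = 1.
Proof. by apply: norm1_sqr_modulus; exact: chi_norm. Qed.

Lemma chi3_sqint i : square_integrable nu (chi3 i).
Proof.
apply: (@bounded_square_integrable _ _ _ _ 1); first exact: measurable_chi.
by move=> x; rewrite chi3_sqr_modulus.
Qed.

Let approx (f : sol -> R[i]) := close_comb chiL2 chiL2 (mkL2 nu f) (mkL2 nu f).

Let approxP k f g : square_integrable nu f -> square_integrable nu g ->
  approx f -> approx g -> approx (k *: f + g).
Proof.
move=> sf sg af ag; rewrite /approx (mkL2D (square_integrableZ k sf) sg) (mkL2Z k sf).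
exact: (close_combP k af ag).
Qed.

Let approx_lim (f_ : nat -> sol -> R[i]) (f : sol -> R[i]) :
  (forall n, approx (f_ n)) ->
  (forall e : R, 0 < e -> exists n, nrm (mkL2 nu (f_ n) - mkL2 nu f) < e) -> approx f.
Proof.
move=> af_ h e e0; have e20 := divr_gt0 e0 (ltr0n _ 2).
have [n hn] := h _ e20; have [s [hs _]] := af_ n _ e20.
have : nrm (mkL2 nu f - lincomb chiL2 s) < e.
  by rewrite (le_lt_trans (ler_nrmB (mkL2 nu (f_ n)) _ _))// nrmC; lra.
by exists s.
Qed.

Let cf (f : sol -> R) (x : sol) : R[i] := (f x)%:C%C.

Let mcf f : measurable_fun setT f -> measurable_fun setT (cf f).
Proof. by move=> mf; apply/measurable_complexP; split => //; exact: measurable_cst. Qed.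

Let cf_sqr f x : sqr_modulus (cf f x) = f x ^+ 2.
Proof. by rewrite sqr_modulusE /= expr0n addr0. Qed.

Let le_sqr (a C : R) : `|a| <= C -> a ^+ 2 <= C ^+ 2.
Proof. by move=> aC; rewrite -real_normK ?num_real// ler_pXn2r// nnegrE// (le_trans _ aC). Qed.

(** Measurability and boundedness belong to the class because [approx] is meaningful only for square
    integrable functions: [mkL2] sends all others to 0. *)
Let M := [set f : sol -> R | [/\ measurable_fun setT f,
  exists C : R, forall x, `|f x| <= C & approx (cf f)]].

Let M_sqint f : M f -> square_integrable nu (cf f).
Proof.
move=> [mf [C fC] _]; apply: (@bounded_square_integrable _ _ _ _ (C ^+ 2)); first exact: mcf.
by move=> x; rewrite cf_sqr le_sqr.
Qed.

Let M_monotone : monotone_class M.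
Proof.
split=> [k f g Mf Mg|f_ f C Mf_ fC ff].
  have [[mf [C fC] af] [mg [D gD] ag]] := (Mf, Mg); split.
  - by apply: measurable_funD => //; exact: measurable_funM.
  - exists (`|k| * C + D) => x; rewrite (le_trans (ler_normD _ _))// normrM.
    by rewrite lerD// ler_wpM2l.
  - have := approxP (k%:C)%C (M_sqint Mf) (M_sqint Mg) af ag.
    congr approx; apply/funext => x; rewrite /cf rmorphD rmorphM//.
have fC' x : `|f x| <= C.
  have fx : `|f_ n x| @[n --> \oo] --> `|f x| by apply: cvg_norm; exact: ff.
  rewrite -(cvg_lim _ fx)//; apply: limr_le; first exact: cvgP fx.
  by apply: nearW => n; exact: fC.
have mf : measurable_fun setT f.
  by apply: (measurable_fun_cvg (h := f_)) => [n|x _]; [have [] := Mf_ n|exact: ff].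
split => //; first by exists C.
have sf : square_integrable nu (cf f).
  apply: (@bounded_square_integrable _ _ _ _ (C ^+ 2)); first exact: mcf.
  by move=> x; rewrite cf_sqr le_sqr.
apply: (@approx_lim (fun n => cf (f_ n))); first by move=> n; have [] := Mf_ n.
have E n x : sqr_modulus (cf (f_ n) x - cf f x) = (f_ n x - f x) ^+ 2.
  by rewrite /cf -rmorphB; exact: (cf_sqr (fun=> f_ n x - f x) x).
apply: (@L2_dominated_approx _ _ _ _ _ (cst ((C + C) ^+ 2))) => //.
- by move=> n; apply: M_sqint.
- exact: finite_measure_integrable_cst.
- by move=> n x; rewrite E le_sqr// (le_trans (ler_normB _ _))// lerD.
- move=> x; under eq_fun do rewrite E expr2.
  have h : f_ n x - f x @[n --> \oo] --> (0 : R).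
    by rewrite -(subrr (f x)); apply: cvgB; [exact: ff|exact: cvg_cst].
  have := cvgM h h; rewrite mulr0. exact.
Qed.

Let chi_parts_M : chi_parts (N := N) `<=` M.
Proof.
move=> f Ef; have fb := chi_parts_bounded Ef.
have ac p K L : approx (chi p K L) by exact: (@close_comb_base _ _ _ _ chiL2 chiL2 (p, K, L)).
have sc p K L : square_integrable nu (chi p K L) by exact: (chi3_sqint (p, K, L)).
have s0 : square_integrable nu 0.
  by apply: (@bounded_square_integrable _ _ _ _ 0); [exact: measurable_cst|
    move=> x; rewrite sqr_modulusE /= expr0n addr0].
have a0 : approx 0.
  have := approxP (-1) (sc 0 0 0)%N (sc 0 0 0)%N (ac 0 0 0)%N (ac 0 0 0)%N.
  by rewrite scaleN1r addNr.
have comb k l p K L : approx (k *: chi p K L + (l *: chi p L K + 0)).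
  have slx := square_integrableD (square_integrableZ l (sc p L K)) s0.
  exact: (approxP k (sc p K L) slx (ac p K L) (approxP l (sc p L K) s0 (ac p L K) a0)).
case: Ef => p [K [L fE]]; split; last 2 first.
- by exists 1.
- have split_chi k l z : (k *: chi p K L + (l *: chi p L K + 0)) z =
      k * chi p K L z + l * (chi p K L z)^*.
    by rewrite chi_conj addr0.
  case: fE => ->.
    have := comb (2^-1)%:C%C (2^-1)%:C%C p K L; congr approx; apply/funext => z.
    rewrite split_chi /cf/=; case: (chi p K L z) => a b.
    by rewrite complex_conjE/=; apply/eqP; rewrite eq_complex/=;
      apply/andP; split; apply/eqP; field.
  (* The coefficients are [1/(2i)] and [-1/(2i)], extracting the imaginary part. *)
  have := comb (Complex 0 (- 2^-1)) (Complex 0 2^-1) p K L; congr approx; apply/funext => z.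
  rewrite split_chi /cf/=; case: (chi p K L z) => a b.
  by rewrite complex_conjE/=; apply/eqP; rewrite eq_complex/=;
    apply/andP; split; apply/eqP; field.
case: fE => ->; [apply: measurable_Re|apply: measurable_Im]; exact: measurable_chi.
Qed.

Lemma total_chiL2 : total chiL2.
Proof.
have real_approx (f : sol -> R) (C : R) : measurable_fun setT f -> (forall x, `|f x| <= C) -> approx (cf f).
  by move=> mf fC; have [] := solenoid_monotone_class M_monotone chi_parts_M mf fC.
have bounded_approx (f : sol -> R[i]) (C : R) : measurable_fun setT f -> (forall x, sqr_modulus (f x) <= C ^+ 2) ->
    0 <= C -> approx f.
  move=> mf fC C0.
  have /measurable_complexP[mr mi] := mf.
  have hb (a b : R) : a ^+ 2 + b ^+ 2 <= C ^+ 2 -> `|a| <= C.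
    move=> ab; rewrite -(@ler_pXn2r _ 2)// ?nnegrE// real_normK ?num_real//.
    by have := sqr_ge0 b; lra.
  have rb x : `|Re (f x)| <= C by apply: (hb _ (Im (f x))); rewrite -sqr_modulusE.
  have ib x : `|Im (f x)| <= C by apply: (hb _ (Re (f x))); rewrite addrC -sqr_modulusE.
  have sr : square_integrable nu (cf (Re \o f)).
    apply: (@bounded_square_integrable _ _ _ _ (C ^+ 2)); first exact: mcf.
    by move=> x; rewrite cf_sqr; exact: le_sqr (rb x).
  have si : square_integrable nu (cf (Im \o f)).
    apply: (@bounded_square_integrable _ _ _ _ (C ^+ 2)); first exact: mcf.
    by move=> x; rewrite cf_sqr; exact: le_sqr (ib x).
  have := approxP 'i%C si sr (real_approx _ C mi ib) (real_approx _ C mr rb).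
  congr approx; apply/funext => x.
  transitivity ('i%C * cf (Im \o f) x + cf (Re \o f) x) => //.
  rewrite /cf/=; case: (f x) => a b.
  by apply/eqP; rewrite eq_complex/=; apply/andP; split; apply/eqP; ring.
move=> u e e0; pose f := L2_fun u; have [mf fi] := L2_funP u.
have ms : measurable_fun setT (@sqr_modulus R \o f) by exact: measurable_sqr_modulus.
(* An arbitrary element of [L2] is reached by truncation to the set where [|f| <= n]. *)
pose A n := [set x | sqr_modulus (f x) <= n%:R ^+ 2].
have mA n : measurable (A n).
  rewrite -[A n]setTI.
  rewrite (_ : A n = (@sqr_modulus R \o f) @^-1` `]-oo, n%:R ^+ 2]%classic); last first.
    by apply/seteqP; split => x /=; rewrite in_itv.
  exact: ms.
pose f_ n x : R[i] := f x * cf \1_(A n) x.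
have f_E n x : f_ n x = if x \in A n then f x else 0.
  by rewrite /f_ /cf indicE; case: (x \in A n); rewrite ?mulr1 ?mulr0.
have mf_ n : measurable_fun setT (f_ n).
  by apply: measurable_cmul => //; apply: mcf; exact: measurable_indic.
have f_C n x : sqr_modulus (f_ n x) <= n%:R ^+ 2.
  rewrite f_E; case: ifPn => [/set_mem//|_].
  by rewrite sqr_modulusE /= expr0n addr0 sqr_ge0.
have sf_ n : square_integrable nu (f_ n) by exact: bounded_square_integrable (mf_ n) (f_C n).
have af : approx f.
  apply: (@approx_lim f_).
    by move=> n; apply: (@bounded_approx _ n%:R).
  apply: (@L2_dominated_approx _ _ _ _ _ (@sqr_modulus R \o f)) => //.
  - apply/integrableP; split; first exact/measurable_EFinP.
    by under eq_integral do rewrite /= ger0_norm ?sqr_modulus_ge0//.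
  - move=> n x; rewrite f_E; case: ifPn => _ /=.
      by rewrite subrr sqr_modulusE /= expr0n addr0 sqr_modulus_ge0.
    by rewrite sub0r sqr_modulusN.
  - move=> x; apply: cvg_near_cst.
    (* From here on [|f(x)|^2 <= n <= n^2], so truncation leaves [f(x)] unchanged; the successor
       ensures [n >= 1]. *)
    exists (Num.bound (sqr_modulus (f x))).+1 => // n /= hn.
    rewrite f_E mem_set ?subrr /A/=; first by rewrite sqr_modulusE /= expr0n addr0.
    have n1 : 1 <= n%:R :> R by rewrite ler1n (leq_trans _ hn).
    have hb : (Num.bound (sqr_modulus (f x)))%:R <= n%:R :> R by rewrite ler_nat ltnW.
    rewrite (le_trans (ltW (archi_boundP (sqr_modulus_ge0 (f x)))))// (le_trans hb)//.
    by rewrite expr2 ler_peMr// (le_trans _ n1).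
have [s [hs _]] := af e e0.
by exists s; rewrite -[u]L2_funK.
Qed.

End solenoid_density.
End L2_density.

(** * Ultralimits and Loeb measures *)

Section ultralimit.
Variables (R : realType) (U : set_system nat).
Hypothesis UU : UltraFilter U.
Local Notation Re := (@complex.Re R).
Local Notation Im := (@complex.Im R).

Local Instance ultra_properfilter : ProperFilter U := ultra_proper.

(** Compactness gives a cluster point, and an ultrafilter converges to each of its cluster
    points. *)
Lemma ultra_bounded_cvg (r : nat -> R) (C : R) : (forall m, `|r m| <= C) -> cvg (r @ U).
Proof.
move=> rC; have [p [_ cp]] : `[- C, C]%classic `&` cluster (r @ U) !=set0.
  apply: (@segment_compact R (- C) C (r @ U) (fmap_proper_filter r ultra_properfilter)).
  by apply: (@filterE _ U) => m /=; rewrite in_itv/= -ler_norml; exact: rC.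
apply/cvg_ex; exists p => V nV.
have [//|VC] := in_ultra_setVsetC (r @^-1` V) UU.
by have [x [/= ? ?]] := cp (~` V) V VC nV.
Qed.

Lemma cvg_complexP (f : nat -> R[i]) (z : R[i]) :
  f @ U --> z <-> Re (f m) @[m --> U] --> Re z /\ Im (f m) @[m --> U] --> Im z.
Proof.
split=> [fz|[rz iz]].
  by split; apply: (cvg_comp _ _ fz); [exact: continuous_Re|exact: continuous_Im].
apply/(@cvgrPdist_lt _ _ _ _ _) => e e0.
have er : e = (Re e)%:C%C.
  by apply/eqP; rewrite eq_complex/= eqxx/=; move: e0; rewrite ltcE /= => /andP[/eqP->].
have e0' : 0 < Re e by move: e0; rewrite er ltcR.
move/cvgrPdist_lt: rz => /(_ _ (divr_gt0 e0' (ltr0n _ 2))) rz.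
move/cvgrPdist_lt: iz => /(_ _ (divr_gt0 e0' (ltr0n _ 2))) iz.
apply: filterS2 rz iz => m rm im; rewrite er (le_lt_trans (normc_leD _))// ltcR !raddfB/=.
by rewrite [ltRHS](splitr (Re e)) ltrD.
Qed.

End ultralimit.

(** The sum counts the integers in [[0, y)]. Applied to [(n+1) F], this approximates [F] uniformly
    by a combination of indicators of superlevel sets. *)
Lemma step_sum_approx (R : realType) (y : R) (n : nat) : 0 <= y -> y <= n%:R ->
  `|y - \sum_(i < n) ((i%:R < y)%R)%:R| <= 1.
Proof.
move=> y0; elim: n => [yn|n ih yn]; first by rewrite big_ord0 subr0 ger0_norm// (le_trans yn).
rewrite big_ord_recr/=; have [yn'|yn'] := leP y n%:R; first by rewrite addr0; exact: ih.
rewrite (eq_bigr (fun=> 1)); last first.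
  by move=> i _; rewrite (le_lt_trans _ yn')// ler_nat ltnW.
rewrite sumr_const card_ord /=; move: yn; rewrite -natr1 ler_norml.
move: yn'; move: (n%:R : R) => a; lra.
Qed.

(** * The Loeb measure of a sequence of finite weighted sets *)

Section loeb_measure.
Variables (R : realType) (W : pointedType) (U : set_system nat).
Hypothesis UU : UltraFilter U.
Hypothesis Ufree : \oo `<=` U.
Variables (k : nat -> nat) (w : nat -> nat -> R) (pt : nat -> nat -> W).
Hypotheses (w_ge0 : forall m j, 0 <= w m j) (w_sum : forall m, \sum_(j < k m) w m j = 1).

Local Instance loeb_properfilter : ProperFilter U := ultra_proper.

Definition mean m (F : W -> R) : R := \sum_(j < k m) w m j * F (pt m j).

Lemma mean_le m (F G : W -> R) : (forall x, F x <= G x) -> mean m F <= mean m G.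
Proof. by move=> FG; apply: ler_sum => j _; rewrite ler_wpM2l. Qed.

Lemma meanD m (F G : W -> R) : mean m (fun x => F x + G x) = mean m F + mean m G.
Proof. by rewrite /mean -big_split; apply: eq_bigr => j _; rewrite mulrDr. Qed.

Lemma meanZ m a (F : W -> R) : mean m (fun x => a * F x) = a * mean m F.
Proof. by rewrite /mean mulr_sumr; apply: eq_bigr => j _; rewrite mulrCA. Qed.

Lemma mean_cst m a : mean m (fun=> a) = a.
Proof. by rewrite /mean -mulr_suml w_sum mul1r. Qed.

Lemma mean_sum m n (F : 'I_n -> W -> R) :
  mean m (fun x => \sum_(i < n) F i x) = \sum_(i < n) mean m (F i).
Proof. by rewrite /mean exchange_big; apply: eq_bigr => j _; rewrite mulr_sumr. Qed.

Lemma mean_norm_le m (F : W -> R) (C : R) : (forall x, `|F x| <= C) -> `|mean m F| <= C.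
Proof.
move=> FC; rewrite ler_norml -{1}(mean_cst m (- C)) -{2}(mean_cst m C).
by rewrite !mean_le// => x; have := FC x; rewrite ler_norml => /andP[].
Qed.

Lemma indic_norm_le1 T (A : set T) x : `|\1_A x : R| <= 1.
Proof. by rewrite indicE; case: (x \in A); rewrite /= ?normr1 ?normr0. Qed.

Definition mlim (F : nat -> W -> R) : R := lim (mean m (F m) @[m --> U]).

Lemma mlim_cvg (F : nat -> W -> R) (C : R) : (forall m x, `|F m x| <= C) ->
  mean m (F m) @[m --> U] --> mlim F.
Proof.
by move=> FC; apply: (@ultra_bounded_cvg _ _ UU _ C) => m; exact: mean_norm_le.
Qed.

Lemma mlim_near (F G : nat -> W -> R) (C : R) : (forall m x, `|F m x| <= C) ->
  (\forall m \near U, mean m (F m) = mean m (G m)) -> mlim F = mlim G.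
Proof.
move=> FC FG; apply/esym/cvg_lim => //.
by apply: cvg_trans (mlim_cvg FC); apply: near_eq_cvg.
Qed.

(** The ultraproduct without its quotient: internal sets do not distinguish sequences that agree on
    a set of [U]. *)
Definition hyper : Type := nat -> W.
HB.instance Definition _ := Pointed.on hyper.

Definition internal (A : nat -> set W) : set hyper := [set x | U [set m | A m (x m)]].

(** The theorem of Los for inclusions: otherwise counterexamples chosen stage by stage form a point
    of [internal A] outside [internal B]. *)
Lemma internal_sub (A B : nat -> set W) :
  internal A `<=` internal B -> \forall m \near U, A m `<=` B m.
Proof.
move=> AB; have [//|nAB] := in_ultra_setVsetC [set m | A m `<=` B m] UU.
have /choice[x xP] : forall m, exists x, ~ (A m `<=` B m) -> A m x /\ ~ B m x.
  move=> m; have [/asboolP h|/asboolP/nonsubset[x [Ax Bx]]] := boolP `[< A m `<=` B m >].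
    by exists point.
  by exists x.
have Ax : internal A x by apply: filterS nAB => m /xP[].
have : U (set0 : set nat).
  by apply: filterS2 nAB (AB _ Ax) => m /xP[].
by move/filter_ex => [].
Qed.

Lemma internalC A : ~` internal A = internal (fun m => ~` A m).
Proof.
apply/seteqP; split=> x /=.
  by move=> nA; have [|//] := in_ultra_setVsetC [set m | A m (x m)] UU.
move=> nA hA; have : U (set0 : set nat) by apply: filterS2 nA hA.
by move/filter_ex => [].
Qed.

Lemma internalI A B : internal A `&` internal B = internal (fun m => A m `&` B m).
Proof.
apply/seteqP; split=> x /=; first by case; exact: filterS2.
by move=> h; split; apply: filterS h => m [].
Qed.

Lemma internalU A B : internal A `|` internal B = internal (fun m => A m `|` B m).
Proof.
rewrite -[LHS]setCK setCU !internalC internalI internalC; congr internal.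
by apply/funext => m; rewrite setCI !setCK.
Qed.

Lemma internal0 : internal (fun=> set0) = set0.
Proof. by apply/seteqP; split => x //= /filter_ex[]. Qed.

Lemma internalT : internal (fun=> setT) = setT.
Proof. by apply/seteqP; split => x //= _; exact: filterT. Qed.

(* Countable saturation: [x m] below lies in [A m] and avoids as many of the first [m]
   sets [F i m] as possible. *)
Lemma internal_cover (A : nat -> set W) (F : nat -> nat -> set W) :
  internal A `<=` \bigcup_i internal (F i) ->
  exists n, internal A `<=` \bigcup_(i < n) internal (F i).
Proof.
move=> AF; apply/not_existsP => nAF.
have all_lt (P : nat -> set nat) n : (forall i, (i < n)%N -> U (P i)) ->
    U [set m | forall i, (i < n)%N -> P i m].
  elim: n => [_|n ih h]; first exact: filterE.
  apply: filterS2 (h n (ltnSn n)) (ih (fun i ik => h i (ltnW ik))) => m Pn Pi i.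
  by rewrite ltnS leq_eqVlt => /predU1P[->//|]; exact: Pi.
pose Q n m x := A m x /\ forall i, (i < n)%N -> ~ F i m x.
have UQ n : U [set m | exists x, Q n m x].
  have /nonsubset[x [Ax nF]] := nAF n.
  have : internal (fun m => Q n m) x; last by apply: filterS => m /= ?; exists (x m).
  have : forall i, (i < n)%N -> U [set m | ~ F i m (x m)].
    move=> i ik; have : (~` internal (F i)) x by move=> Fx; apply: nF; exists i.
    by rewrite internalC.
  by move=> h; apply: filterS2 Ax (all_lt _ _ h).
have /choice[x xP] : forall m, exists x, forall n, (n <= m)%N -> (exists y, Q n m y) -> Q n m x.
  move=> m; suff h l : exists x, forall n, (n <= l)%N -> (exists y, Q n m y) -> Q n m x by exact: h.
  elim: l => [|l [x ih]].
    have [[y Qy]|nQ] := pselect (exists y, Q 0%N m y).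
      by exists y => n; rewrite leqn0 => /eqP->.
    by exists point => n; rewrite leqn0 => /eqP->.
  have [[y [Ay Fy]]|nQ] := pselect (exists y, Q l.+1 m y).
    by exists y => n nl _; split => // i ni; apply: Fy; exact: leq_trans nl.
  by exists x => n; rewrite leq_eqVlt => /predU1P[->//|]; exact: ih.
have xQ n : U [set m | Q n m (x m)].
  have Un : U [set m | (n <= m)%N] by apply: Ufree; exists n.
  by apply: filterS2 Un (UQ n) => m nm; exact: xP.
have Ax : internal A x by apply: filterS (xQ 0%N) => m [].
have [i _ Fx] := AF _ Ax.
have : U (set0 : set nat) by apply: filterS2 Fx (xQ i.+1) => m /= Fm [_ /(_ i (ltnSn i))].
by move/filter_ex => [].
Qed.

Definition internal_sets : set (set hyper) := range internal.

Lemma internal_sets0 : internal_sets set0.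
Proof. by exists (fun=> set0) => //; exact: internal0. Qed.

Lemma internal_setsU : setU_closed internal_sets.
Proof. by move=> _ _ [A _ <-] [B _ <-]; exists (fun m => A m `|` B m) => //; rewrite internalU. Qed.

Lemma internal_setsC : setC_closed internal_sets.
Proof. by move=> _ [A _ <-]; exists (fun m => ~` A m) => //; rewrite internalC. Qed.

Definition loeb_disp : measure_display. Proof. by constructor; exact: tt. Qed.

HB.instance Definition _ := @isAlgebraOfSets.Build loeb_disp hyper internal_sets
  internal_sets0 internal_setsU internal_setsC.

(** A presentation of [X] as an internal set is picked by choice; [loebE] shows that the value does
    not depend on it. *)
Definition loeb (X : set hyper) : \bar R :=
  (mlim (fun m => \1_((get [set A | internal A = X]) m)))%:E.

Lemma loebE A : loeb (internal A) = (mlim (fun m => \1_(A m)))%:E.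
Proof.
rewrite /loeb; congr EFin; set B := get _.
have BA : internal B = internal A by apply: (@getPex _ [set A' | internal A' = internal A]); exists A.
apply: (@mlim_near _ _ 1); first by move=> m x; exact: indic_norm_le1.
have /internal_sub h1 : internal A `<=` internal B by rewrite BA.
have /internal_sub h2 : internal B `<=` internal A by rewrite BA.
by apply: filterS2 h1 h2 => m /= ? ?; congr (mean m \1__); apply/seteqP.
Qed.

Lemma loeb0 : loeb set0 = 0%E.
Proof.
rewrite -internal0 loebE /mlim; congr EFin; apply: cvg_lim => //.
by under eq_fun do rewrite indic0 mean_cst; exact: cvg_cst.
Qed.

Lemma loeb_ge0 X : (0 <= loeb X)%E.
Proof.
rewrite lee_fin; apply: limr_ge.
  by apply: (@mlim_cvg _ 1) => m x; exact: indic_norm_le1.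
by apply: nearW => m; rewrite -(mean_cst m 0); apply: mean_le => x; rewrite indicE.
Qed.

Lemma loeb_addI (X Y : set hyper) : internal_sets X -> internal_sets Y ->
  X `&` Y = set0 -> loeb (X `|` Y) = (loeb X + loeb Y)%E.
Proof.
move=> [A _ <-] [B _ <-]; rewrite internalI => AB0.
rewrite internalU !loebE -EFinD; congr EFin; apply: cvg_lim => //.
have cA : mean m \1_(A m) @[m --> U] --> mlim (fun m => \1_(A m)).
  by apply: (@mlim_cvg _ 1) => m x; exact: indic_norm_le1.
have cB : mean m \1_(B m) @[m --> U] --> mlim (fun m => \1_(B m)).
  by apply: (@mlim_cvg _ 1) => m x; exact: indic_norm_le1.
apply: cvg_trans (cvgD cA cB); apply: near_eq_cvg.
have /internal_sub : internal (fun m => A m `&` B m) `<=` internal (fun=> set0).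
  by rewrite AB0.
apply: filterS => m ABm /=.
transitivity (mean m \1_(A m) + mean m \1_(B m)) => //; rewrite -meanD; congr mean; apply/funext => x.
rewrite !indicE in_setU; case: (boolP (x \in A m)) => [/set_mem Ax|_] /=.
  by rewrite memNset ?addr0// => Bx; exact: (ABm x).
by rewrite add0r.
Qed.

(** By saturation an internal set that is a countable disjoint union of internal sets is already
    covered by finitely many of them, so the others are empty and finite additivity suffices. *)
Lemma loeb_sigma_additive : semi_sigma_additive (loeb : set hyper -> \bar R).
Proof.
move=> F mF tF [A _ AF].
have /choice[G GF] : forall i, exists G, internal G = F i.
  by move=> i; have [G _ GF] := mF i; exists G.
have [n AFn] : exists n, internal A `<=` \bigcup_(i < n) internal (G i).
  by apply: internal_cover; rewrite AF; apply: subset_bigcup => i _; rewrite GF.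
have F0 i : (n <= i)%N -> F i = set0.
  move=> ni; rewrite -subset0 => x Fx.
  have [j jn Gx] : (\bigcup_(i < n) internal (G i)) x.
    by apply: AFn; rewrite AF; exists i.
  move/trivIsetP : tF => /(_ i j Logic.I Logic.I).
  rewrite gtn_eqF ?(leq_trans jn)// => /(_ isT) <-; split => //.
  by rewrite -GF.
have UF m : loeb (\bigcup_(i < m) F i) = (\sum_(0 <= i < m) loeb (F i))%E /\
    internal_sets (\bigcup_(i < m) F i).
  elim: m => [|m [ih im]].
    by rewrite big_geq// bigcup_mkord big_ord0 loeb0; split => //; exact: internal_sets0.
  rewrite big_nat_recr//= -ih bigcup_mkord big_ord_recr/= -bigcup_mkord.
  split; last by apply: internal_setsU => //; exact: mF.
  apply: loeb_addI => //; first exact: mF.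
  rewrite -subset0 => x [[i im' Fi] Fm].
  move/trivIsetP : tF => /(_ i m Logic.I Logic.I).
  by rewrite ltn_eqF// => /(_ isT) <-.
apply: cvg_near_cst; exists n => // m /= nm; rewrite -(UF m).1; congr loeb.
apply/seteqP; split=> [x [i _ Fx]|x [i _ Fx]]; first by exists i.
exists i => //; rewrite /= ltnNge; apply/negP => mi.
by move: Fx; rewrite F0// (leq_trans nm).
Qed.

HB.instance Definition _ := isMeasure.Build loeb_disp hyper R loeb
  loeb0 loeb_ge0 loeb_sigma_additive.

Definition loeb_space := g_sigma_algebraType (@measurable loeb_disp hyper).

Definition loeb_prob : set loeb_space -> \bar R := measure_extension loeb.

HB.instance Definition _ := Measure.on loeb_prob.

Lemma measurable_internal A : measurable (internal A : set loeb_space).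
Proof. by apply: sub_sigma_algebra; exists A. Qed.

Lemma loeb_probE A : loeb_prob (internal A) = (mlim (fun m => \1_(A m)))%:E.
Proof. by rewrite -loebE; apply: measurable_mu_extE; exists A. Qed.

Lemma loeb_probT : loeb_prob setT = 1%E.
Proof.
rewrite -internalT loeb_probE /mlim; congr EFin; apply: cvg_lim => //.
by under eq_fun do rewrite indicT mean_cst; exact: cvg_cst.
Qed.

HB.instance Definition _ := Measure_isProbability.Build _ _ _ loeb_prob loeb_probT.

(** The standard part of the internal function [F]. *)
Definition hlim (F : nat -> W -> R) (x : loeb_space) : R := lim (F m (x m) @[m --> U]).

Lemma hlim_cvg (F : nat -> W -> R) (C : R) (x : loeb_space) : (forall m x, `|F m x| <= C) ->
  F m (x m) @[m --> U] --> hlim F x.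
Proof. by move=> FC; apply: (@ultra_bounded_cvg _ _ UU _ C) => m. Qed.

Lemma measurable_hlim (F : nat -> W -> R) (C : R) : (forall m x, `|F m x| <= C) ->
  measurable_fun setT (hlim F).
Proof.
move=> FC; apply: (measurability _ (RGenInftyO.measurableE R)).
move=> _ [_ [a ->] <-]; rewrite setTI.
(* The margin [1/(n+1)] is needed because strict inequalities at the stages become weak ones in the
   limit. *)
have -> : hlim F @^-1` `]-oo, a[%classic =
    \bigcup_n internal (fun m => [set x | F m x < a - n.+1%:R^-1]).
  apply/seteqP; split=> [x /=|x [n _ /= h]]; rewrite in_itv/=.
    move=> xa; have xa' : 0 < a - hlim F x by rewrite subr_gt0.
    have [n _ /(_ n (leqnn _)) /= na] := near_infty_natSinv_lt (PosNum xa').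
    exists n => //; have xna : hlim F x < a - n.+1%:R^-1.
      by move: na; rewrite !ltrBrDl addrC.
    have h := @cvgr_lt _ _ _ _ _ _ (hlim_cvg (x := x) FC) _ xna.
    exact: h.
  have xn := hlim_cvg (x := x) FC.
  apply: (@le_lt_trans _ _ (a - n.+1%:R^-1)); last by rewrite ltrBlDr ltrDl invr_gt0.
  rewrite -(cvg_lim _ xn)//; apply: limr_le; first exact: cvgP xn.
  by apply: filterS h => m /ltW.
by apply: bigcupT_measurable => n; exact: measurable_internal.
Qed.

(** At each stage [F] is within [1/(n+1)] of the step function [S n], whose limit [Sh n] is simple
    on the Loeb space. The integral of [Sh n] is the limit [s n] of the means of [S n], so the two
    sides differ by at most [2/(n+1)]. *)
Lemma loeb_integral_ge0 (F : nat -> W -> R) : (forall m x, 0 <= F m x <= 1) ->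
  (\int[loeb_prob]_x (hlim F x)%:E)%E = (mlim F)%:E.
Proof.
move=> F01.
have FC m x : `|F m x| <= 1 by have /andP[? ?] := F01 m x; rewrite ger0_norm.
have mh := measurable_hlim FC.
have h0 x : 0 <= hlim F x.
  have xn := hlim_cvg (x := x) FC; rewrite -(cvg_lim _ xn)//; apply: limr_ge; first exact: cvgP xn.
  by apply: nearW => m; have /andP[] := F01 m (x m).
pose A n (i : 'I_n.+1) m := [set x | i%:R / n.+1%:R < F m x].
pose S n m x : R := n.+1%:R^-1 * \sum_(i < n.+1) \1_(A n i m) x.
pose Sh n (x : loeb_space) : R := n.+1%:R^-1 * \sum_(i < n.+1) \1_(internal (A n i)) x.
have n0 n : 0 < n.+1%:R :> R by [].
have FS n m x : `|F m x - S n m x| <= n.+1%:R^-1.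
  have /andP[F0 F1] := F01 m x.
  have := @step_sum_approx R (n.+1%:R * F m x) n.+1 _ _.
  rewrite mulr_ge0// ler_piMr// => /(_ isT isT) h.
  have -> : F m x - S n m x = n.+1%:R^-1 *
      (n.+1%:R * F m x - \sum_(i < n.+1) ((i%:R < n.+1%:R * F m x)%R)%:R).
    rewrite mulrBr mulKf ?gt_eqF//; congr (_ - _ * _); apply: eq_bigr => i _.
    rewrite indicE; congr (_%:R); congr nat_of_bool.
    rewrite -[RHS](ltr_pM2l (_ : 0 < n.+1%:R^-1)) ?invr_gt0// mulKf ?gt_eqF// mulrC.
    by apply/idP/idP => [/set_mem//|?]; exact/mem_set.
  by rewrite normrM ger0_norm ?invr_ge0// ler_piMr// invr_ge0.
have hS n x : `|hlim F x - Sh n x| <= n.+1%:R^-1.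
  have xn := hlim_cvg (x := x) FC.
  have eqS : \forall m \near U, S n m (x m) = Sh n x.
    have eq1 (i : 'I_n.+1) :
        \forall m \near U, (\1_(A n i m) (x m) : R) = \1_(internal (A n i)) x.
      have [Ax|nA] := pselect (internal (A n i) x).
        by apply: filterS (Ax) => m Am; rewrite !indicE !mem_set.
      have : (~` internal (A n i)) x by [].
      by rewrite internalC; apply: filterS => m Am; rewrite !indicE !memNset.
    have eqA : \forall m \near U, forall i : 'I_n.+1,
        (\1_(A n i m) (x m) : R) = \1_(internal (A n i)) x.
      by apply: filter_forall => i; exact: eq1.
    by apply: filterS eqA => m h; rewrite /S /Sh; congr (_ * _); apply: eq_bigr => i _; exact: h.
  have nl : `|F m (x m) - Sh n x| @[m --> U] --> `|hlim F x - Sh n x|.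
    by apply: cvg_norm; apply: cvgB => //; exact: cvg_cst.
  rewrite -(cvg_lim _ nl)//; apply: limr_le; first exact: cvgP nl.
  by apply: filterS eqS => m <-.
pose s n : R := n.+1%:R^-1 * \sum_(i < n.+1) mlim (fun m => \1_(A n i m)).
have intS n : (\int[loeb_prob]_x (Sh n x)%:E)%E = (s n)%:E.
  under eq_integral do rewrite /Sh EFinM -sumEFin.
  have mi (i : 'I_n.+1) : measurable_fun setT
      (fun x : loeb_space => (\1_(internal (A n i)) x)%:E : \bar R).
    by apply/measurable_EFinP; apply: measurable_indic; exact: measurable_internal.
  rewrite ge0_integralZl_EFin//; last 2 first.
  - by move=> x _; apply: sume_ge0 => i _; rewrite lee_fin indicE.
  - by apply: emeasurable_sum.
  rewrite ge0_integral_sum//.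
  rewrite /s EFinM -sumEFin; congr (_ * _)%E; apply: eq_bigr => i _.
  rewrite integral_indic//; last exact: measurable_internal.
  by rewrite setIT; exact: loeb_probE.
have sL n : `|mlim F - s n| <= n.+1%:R^-1.
  have cs : mean m (S n m) @[m --> U] --> s n.
    rewrite (_ : (fun m => _) = (fun m => n.+1%:R^-1 * \sum_(i < n.+1) mean m \1_(A n i m))).
      apply: cvgM; first exact: cvg_cst.
      apply: cvg_big => [|i _]; first exact: add_continuous.
      by apply: (@mlim_cvg _ 1) => m x; exact: indic_norm_le1.
    by apply/funext => m; rewrite /S meanZ mean_sum.
  have nl : `|mean m (F m) - mean m (S n m)| @[m --> U] --> `|mlim F - s n|.
    by apply: cvg_norm; apply: cvgB => //; exact: (mlim_cvg FC).
  rewrite -(cvg_lim _ nl)//; apply: limr_le; first exact: cvgP nl.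
  apply: nearW => m; rewrite -mulN1r -meanZ -meanD.
  by apply: mean_norm_le => x; rewrite mulN1r.
have int_le (f g : loeb_space -> R) c : measurable_fun setT f -> measurable_fun setT g ->
    (forall x, 0 <= f x) -> (forall x, 0 <= g x) -> 0 <= c -> (forall x, f x <= g x + c) ->
    (\int[loeb_prob]_x (f x)%:E <= \int[loeb_prob]_x (g x)%:E + c%:E)%E.
  move=> mf mg f0 g0 c0 fg.
  have <- : (\int[loeb_prob]_x ((g x)%:E + cst c%:E x) = \int[loeb_prob]_x (g x)%:E + c%:E)%E.
    rewrite ge0_integralD//; try by [move=> x _; rewrite lee_fin|apply/measurable_EFinP].
    by rewrite integral_cst// [X in (_ * X)%E]loeb_probT mule1.
  apply: ge0_le_integral => //; try by [move=> x _; rewrite lee_fin | apply/measurable_EFinP |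
    move=> x _; rewrite -EFinD lee_fin addr_ge0 |
    apply/measurable_EFinP; apply: measurable_funD | move=> x _; rewrite -EFinD lee_fin].
have mSh n : measurable_fun setT (Sh n).
  apply: measurable_funM => //; apply: measurable_sum => i.
  by apply: measurable_indic; exact: measurable_internal.
have Sh0 n x : 0 <= Sh n x.
  by rewrite mulr_ge0// ?invr_ge0//; apply: sumr_ge0 => i _; rewrite indicE.
have ni0 n : 0 <= n.+1%:R^-1 :> R by rewrite invr_ge0.
have h1 n : (\int[loeb_prob]_x (hlim F x)%:E <= (s n)%:E + (n.+1%:R^-1)%:E)%E.
  rewrite -intS; apply: int_le => // x.
  by have := hS n x; rewrite ler_norml lerBlDl => /andP[].
have h2 n : ((s n)%:E <= \int[loeb_prob]_x (hlim F x)%:E + (n.+1%:R^-1)%:E)%E.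
  rewrite -intS; apply: int_le => // x.
  by have := hS n x; rewrite ler_norml lerBrDr addrC lerBlDr => /andP[].
have fI : (\int[loeb_prob]_x (hlim F x)%:E)%E \is a fin_num.
  rewrite ge0_fin_numE; first by rewrite (le_lt_trans (h1 0%N))// -EFinD ltry.
  by apply: integral_ge0 => x _; rewrite lee_fin.
move: h1 h2; rewrite -(fineK fI); set r := fine _ => h1 h2; congr EFin.
apply/eqP; rewrite -subr_eq0 -normr_eq0 eq_le normr_ge0 andbT.
apply/ler_addgt0Pr => e e0; rewrite add0r.
have [n _ /(_ n (leqnn _)) /= ne] := near_infty_natSinv_lt (PosNum (divr_gt0 e0 (ltr0n R 2))).
move: ne (h1 n) (h2 n) (sL n); rewrite -!EFinD !lee_fin !ler_norml.
move: (n.+1%:R^-1 : R) (s n) (mlim F) r {fI h1 h2} => q sn L r; lra.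
Qed.

Lemma loeb_integral (F : nat -> W -> R) : (forall m x, `|F m x| <= 1) ->
  (\int[loeb_prob]_x hlim F x)%R = mlim F.
Proof.
move=> F1; pose G m x := 2^-1 * F m x + 2^-1.
have G01 m x : 0 <= G m x <= 1.
  by rewrite /G; have := F1 m x; rewrite ler_norml; lra.
have GC m x : `|G m x| <= 1 by have /andP[? ?] := G01 m x; rewrite ger0_norm.
have FE x : hlim F x = 2 * hlim G x - 1.
  apply: cvg_lim => //; have Gx := hlim_cvg (x := x) GC.
  have : 2 * G m (x m) - 1 @[m --> U] --> 2 * hlim G x - 1.
    by apply: cvgB; [apply: cvgM => //; exact: cvg_cst|exact: cvg_cst].
  by apply: cvg_trans; apply: near_eq_cvg; apply: nearW => m; rewrite /G; field.
have ME : mlim F = 2 * mlim G - 1.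
  apply: cvg_lim => //; have cG := mlim_cvg GC.
  have : 2 * mean m (G m) - 1 @[m --> U] --> 2 * mlim G - 1.
    by apply: cvgB; [apply: cvgM => //; exact: cvg_cst|exact: cvg_cst].
  apply: cvg_trans; apply: near_eq_cvg; apply: nearW => m.
  by rewrite /G meanD meanZ mean_cst; field.
have iG : loeb_prob.-integrable setT (EFin \o hlim G).
  apply/integrableP; split; first by apply/measurable_EFinP; exact: measurable_hlim GC.
  rewrite (_ : (fun x => _) = (fun x => (hlim G x)%:E)); last first.
    apply/funext => x /=; rewrite ger0_norm//.
    have xn := hlim_cvg (x := x) GC; rewrite -(cvg_lim _ xn)//; apply: limr_ge; first exact: cvgP xn.
    by apply: nearW => m; have /andP[] := G01 m (x m).
  by rewrite loeb_integral_ge0// ltry.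
under eq_Rintegral do rewrite FE.
rewrite RintegralB//; last 2 first.
- exact: (integrableZl measurableT _ iG).
- exact: finite_measure_integrable_cst.
rewrite RintegralZl// Rintegral_cst// [X in fine X]loeb_probT mul1r ME.
by rewrite /Rintegral loeb_integral_ge0.
Qed.

End loeb_measure.

(** * Spectral measures *)

Section herglotz.
Variable R : realType.
Local Notation Re := (@complex.Re R).
Local Notation Im := (@complex.Im R).

Lemma complex_prim_root_exists n : (0 < n)%N -> exists z : R[i], n.-primitive_root z.
Proof.
pose p : {poly R[i]} := 'X^n - 1; have [r Dp] := closed_field_poly_normal p.
move=> n_gt0; rewrite (monicP _) ?monicXnsubC // scale1r in Dp.
have rn1: all n.-unity_root r by apply/allP=> z; rewrite -root_prod_XsubC -Dp.
have sz_r: (n < (size r).+1)%N.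
  by rewrite -(size_prod_XsubC r id) -Dp size_XnsubC.
have [|z] := hasP (has_prim_root n_gt0 rn1 _ sz_r); last by exists z.
by rewrite -separable_prod_XsubC -Dp separable_Xn_sub_1 // pnatr_eq0 -lt0n.
Qed.

(** * Approximate spectral measures on roots of unity *)

Section finite_stage.
Variables (H : preHilbertType R[i]) (A : {linear H -> H}).
Hypothesis Ai : isometric A.
Variable xi : H.
Hypothesis xi1 : nrm xi = 1.
Variables (M : nat) (omega : R[i]).
Hypotheses (M0 : (0 < M)%N) (prim : M.-primitive_root omega).

Let lam (j : nat) : R[i] := omega ^+ j.

Let omega_norm : `|omega| = 1.
Proof.
apply/eqP; rewrite -(@pexpr_eq1 _ _ M)//.
by rewrite -normrX (prim_expr_order prim) normr1.
Qed.

Let lam_norm j : `|lam j| = 1.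
Proof. by rewrite normrX omega_norm expr1n. Qed.

Let conj_mul z : `|z| = 1 -> z^* * z = 1 :> R[i].
Proof. by move=> z1; rewrite mulrC -normCK z1 expr1n. Qed.

(** The Fourier coefficient of the orbit at [lam j], a substitute for the spectral projection of
    [xi] at that point. *)
Let vec j : H := (M%:R^-1 : R[i]) *: \sum_(k < M) (lam j)^* ^+ k *: iter k A xi.

Let MR0 : (M%:R : R[i]) != 0. Proof. by rewrite pnatr_eq0 -lt0n. Qed.

Let iterA_inner K x y : inner (iter K A x) (iter K A y) = inner x y.
Proof. by elim: K => // K ih; rewrite !iterS isometric_inner. Qed.

Let iterA_nrm K x : nrm (iter K A x) = nrm x.
Proof. by rewrite /nrm iterA_inner. Qed.

Let iterA_sum K n (c : 'I_n -> R[i]) (x : 'I_n -> H) :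
  iter K A (\sum_(i < n) c i *: x i) = \sum_(i < n) c i *: iter K A (x i).
Proof.
elim: K => [//|K ih]; rewrite iterS ih linear_sum.
by apply: eq_bigr => i _; rewrite linearZ.
Qed.

Let iterA_Z K k x : iter K A (k *: x) = k *: iter K A x.
Proof. by elim: K => // K ih; rewrite !iterS ih linearZ. Qed.

Let root_orth k l : (k < M)%N -> (l < M)%N ->
  \sum_(j < M) (lam j)^* ^+ k * (lam j) ^+ l = if k == l then M%:R else 0.
Proof.
move=> kM lM; pose zeta := (omega ^+ k)^* * omega ^+ l.
have -> : \sum_(j < M) (lam j)^* ^+ k * lam j ^+ l = \sum_(j < M) zeta ^+ j.
  apply: eq_bigr => j _; rewrite /zeta /lam exprMn -!rmorphXn -!exprM.
  by rewrite ![(_ * j)%N]mulnC.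
have n1 n : `|omega ^+ n| = 1 by rewrite normrX omega_norm expr1n.
case: eqP => [kl|kl].
  rewrite /zeta kl conj_mul//; under eq_bigr do rewrite expr1n.
  by rewrite sumr_const card_ord.
have z1 : zeta != 1.
  apply/eqP => z1; apply: kl; apply/eqP.
  have := eq_prim_root_expr prim k l; rewrite !modn_small// => <-; apply/eqP.
  rewrite -[RHS]mul1r -(conj_mul (n1 k)) mulrAC.
  by rewrite -[X in X * _]/zeta z1 mul1r.
have zM : zeta ^+ M = 1.
  rewrite /zeta exprMn -rmorphXn -!exprM ![(_ * M)%N]mulnC !exprM (prim_expr_order prim).
  by rewrite !expr1n rmorph1 mulr1.
have := subrX1 zeta M; rewrite zM subrr => /esym/eqP.
by rewrite mulf_eq0 subr_eq0 (negbTE z1) => /eqP.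
Qed.

(** An exact identity: summation over [j] kills the terms with [k != l], and the [M] diagonal terms
    coincide since [A] preserves inner products. All error comes from replacing [A] by [lam j] on
    [vec j]. *)
Let parseval K L : \sum_(j < M) inner (iter K A (vec j)) (iter L A (vec j)) =
  inner (iter K A xi) (iter L A xi).
Proof.
transitivity (\sum_(j < M) \sum_(k < M) \sum_(l < M) (M%:R^-1 * M%:R^-1) *
   (inner (iter K A (iter k A xi)) (iter L A (iter l A xi)) * ((lam j)^* ^+ k * lam j ^+ l))).
  apply: eq_bigr => j _; rewrite /vec !iterA_Z !iterA_sum innerZl innerZr.
  rewrite fmorphV/= conjC_nat inner_suml 2!mulr_sumr; apply: eq_bigr => k _.
  rewrite inner_sumr !mulr_sumr; apply: eq_bigr => l _.
  have -> : inner ((lam j)^* ^+ k *: iter K A (iter k A xi))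
      ((lam j)^* ^+ l *: iter L A (iter l A xi)) = (lam j)^* ^+ k *
      (lam j ^+ l * inner (iter K A (iter k A xi)) (iter L A (iter l A xi))).
    by rewrite innerZl innerZr [X in _ * (X * _)]rmorphXn/= conjCK.
  ring.
rewrite exchange_big/=; under eq_bigr do rewrite exchange_big/=.
transitivity (\sum_(k < M) M%:R^-1 * inner (iter K A xi) (iter L A xi)).
  apply: eq_bigr => k _; rewrite (bigD1 k)//= [X in _ + X]big1 ?addr0.
    rewrite -mulr_sumr -mulr_sumr root_orth// eqxx.
    rewrite -!iterD ![(_ + k)%N]addnC !iterD iterA_inner; by field.
  move=> l lk; rewrite -mulr_sumr -mulr_sumr root_orth//.
  by rewrite eq_sym (inj_eq val_inj) (negbTE lk) !mulr0.
by rewrite sumr_const card_ord -[LHS]mulr_natl mulrA divff// mul1r.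
Qed.

(** The difference telescopes, and as [lam j] is an [M]-th root of unity only
    [lam j (A^M xi - xi) / M] remains. *)
Let vec_eigen j : nrm (A (vec j) - lam j *: vec j) <= 2 / M%:R.
Proof.
have lM : (lam j)^* ^+ M = 1.
  rewrite -rmorphXn /lam -exprM mulnC exprM (prim_expr_order prim) expr1n.
  by rewrite rmorph1.
have -> : A (vec j) - lam j *: vec j = (M%:R^-1 : R[i]) *: (lam j *: (iter M A xi - xi)).
  rewrite /vec linearZ/= [lam j *: _]scalerA [lam j * _]mulrC -scalerA -scalerBr.
  congr (_ *: _); rewrite linear_sum scaler_sumr -sumrB.
  rewrite (eq_bigr (fun k : 'I_M => lam j *: ((lam j)^* ^+ k.+1 *: iter k.+1 A xi)
     - lam j *: ((lam j)^* ^+ k *: iter k A xi))); last first.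
    move=> k _; have ll : lam j * (lam j)^* = 1 by rewrite mulrC conj_mul.
    by rewrite linearZ/= [in RHS]exprS [in RHS]scalerA [in RHS]mulrA ll mul1r.
  rewrite -(big_mkord xpredT (fun k => lam j *: ((lam j)^* ^+ k.+1 *: iter k.+1 A xi)
     - lam j *: ((lam j)^* ^+ k *: iter k A xi))).
  rewrite (@telescope_sumr _ 0%N M (fun k => lam j *: ((lam j)^* ^+ k *: iter k A xi)))//.
  by rewrite lM expr0 !scale1r scalerBr.
rewrite 2!nrmZ lam_norm (_ : Re 1 = 1)// mul1r.
have -> : Re `|M%:R^-1 : R[i]| = M%:R^-1.
  by rewrite normfV normr_nat -(rmorph_nat (real_complex R)) -fmorphV.
rewrite mulrC ler_pM2r ?invr_gt0 ?ltr0n//.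
rewrite (le_trans (ler_nrmD _ _))// nrmN iterA_nrm xi1; lra.
Qed.

Let vec_eigenX K j : nrm (iter K A (vec j) - lam j ^+ K *: vec j) <= K%:R * (2 / M%:R).
Proof.
elim: K => [|K ih]; first by rewrite expr0 scale1r subrr nrm0 mul0r.
have -> : iter K.+1 A (vec j) - lam j ^+ K.+1 *: vec j =
    A (iter K A (vec j) - lam j ^+ K *: vec j) +
    lam j ^+ K *: (A (vec j) - lam j *: vec j).
  rewrite [X in _ - X *: _]exprSr -scalerA iterS linearB scalerBr.
  by rewrite [A (lam j ^+ K *: vec j)]linearZ addrA subrK.
rewrite (le_trans (ler_nrmD _ _))// Ai nrmZ normrX lam_norm expr1n/= mul1r.
by rewrite -natr1 mulrDl mul1r lerD// vec_eigen.
Qed.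

Let weight j : R := nrm (vec j) ^+ 2.

Let sum_weight : \sum_(j < M) weight j = 1.
Proof.
have := congr1 Re (parseval 0 0); rewrite /= -sqr_nrm xi1 expr1n raddf_sum/= => <-.
by apply: eq_bigr => j _; rewrite /weight sqr_nrm.
Qed.

Let sum_nrm (P : nat) : M = (P ^ 2)%N -> \sum_(j < M) nrm (vec j) <= P%:R.
Proof.
move=> MP; have P0 : 0 < P%:R :> R by rewrite ltr0n; move: M0; rewrite MP expn_gt0 orbF.
(* AM-GM: [2 |v_j| <= 1/P + P |v_j|^2] *)
apply: (@le_trans _ _ (\sum_(j < M) (P%:R^-1 / 2 + P%:R / 2 * weight j))).
  apply: ler_sum => j _; rewrite /weight; set t := nrm _.
  have : 0 <= P%:R / 2 * (t - P%:R^-1) ^+ 2 by rewrite mulr_ge0 ?sqr_ge0// divr_ge0.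
  have -> : P%:R / 2 * (t - P%:R^-1) ^+ 2 = P%:R / 2 * t ^+ 2 - t + P%:R^-1 / 2.
    by field; rewrite gt_eqF.
  lra.
rewrite big_split/= sumr_const card_ord -mulr_sumr sum_weight MP -[X in X + _]mulr_natr natrX.
have -> : P%:R^-1 / 2 * P%:R ^+ 2 + P%:R / 2 * 1 = P%:R :> R by field; rewrite gt_eqF.
by [].
Qed.

Let dist_inner (x y x' y' : H) (part : {additive R[i] -> R}) :
  (forall x y : H, `|part (inner x y)| <= nrm x * nrm y) ->
  `|part (inner x y) - part (inner x' y')| <= nrm (x - x') * nrm y + nrm x' * nrm (y - y').
Proof.
move=> hp; rewrite -raddfB.
have -> : inner x y - inner x' y' = inner (x - x') y + inner x' (y - y').
  by rewrite innerBl innerBr addrA subrK.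
by rewrite raddfD (le_trans (ler_normD _ _))// lerD.
Qed.

(** Each [j] contributes an error of order [|v_j|/M]. The squares of the [|v_j|] add up to 1, so the
    [|v_j|] add up to at most the square root [P] of [M], which leaves order [1/P]. The map [part]
    stands for both [Re] and [Im]. *)
Let stage_error (P K L : nat) (part : {additive R[i] -> R}) : M = (P ^ 2)%N ->
  (forall x y : H, `|part (inner x y)| <= nrm x * nrm y) ->
  `|part (inner (iter K A xi) (iter L A xi)) -
    part (\sum_(j < M) inner (lam j ^+ K *: vec j) (lam j ^+ L *: vec j))|
  <= (K + L)%:R * (2 / P%:R).
Proof.
move=> MP hp; have P0 : 0 < P%:R :> R by rewrite ltr0n; move: M0; rewrite MP expn_gt0 orbF.
rewrite -parseval 2!(raddf_sum part) -sumrB (le_trans (ler_norm_sum _ _ _))//.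
apply: (@le_trans _ _ (\sum_(j < M) (K + L)%:R * (2 / M%:R) * nrm (vec j))).
  apply: ler_sum => j _; rewrite (le_trans (dist_inner _ _ _ _ hp))//.
  rewrite iterA_nrm (nrmZ (lam j ^+ K)) normrX lam_norm expr1n (_ : Re 1 = 1)// mul1r natrD.
  have := vec_eigenX K j; have := vec_eigenX L j; move: (2 / M%:R) => q hL hK.
  rewrite !mulrDl lerD//.
    by apply: ler_wpM2r; [exact: nrm_ge0|exact: hK].
  by rewrite mulrC; apply: ler_wpM2r; [exact: nrm_ge0|exact: hL].
rewrite -mulr_sumr -mulrA ler_wpM2l//.
have -> : 2 / P%:R = 2 / M%:R * P%:R :> R by rewrite MP natrX; field; rewrite gt_eqF.
by rewrite ler_wpM2l ?divr_ge0// sum_nrm.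
Qed.

Lemma herglotz_stage (P : nat) : M = (P ^ 2)%N ->
  exists w : nat -> R, [/\ forall j, 0 <= w j, \sum_(j < M) w j = 1 &
    forall K L,
      `|Re (inner (iter K A xi) (iter L A xi)) -
        \sum_(j < M) w j * Re (lam j ^+ K * (lam j)^* ^+ L)| <= (K + L)%:R * (2 / P%:R) /\
      `|Im (inner (iter K A xi) (iter L A xi)) -
        \sum_(j < M) w j * Im (lam j ^+ K * (lam j)^* ^+ L)| <= (K + L)%:R * (2 / P%:R)].
Proof.
move=> MP; exists weight; split => //; first by move=> j; exact: sqr_ge0.
move=> K L.
have E j : inner (lam j ^+ K *: vec j) (lam j ^+ L *: vec j) =
    (weight j)%:C%C * (lam j ^+ K * (lam j)^* ^+ L).
  rewrite innerZl innerZr inner_nrm [(lam j ^+ L)^*]rmorphXn/= /weight.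
  by move: (_ ^+ K) (_ ^+ L) (_%:C%C) => a b c; ring.
have ReE (x : R) z : Re (x%:C%C * z) = x * Re z by case: z => a b /=; ring.
have ImE (x : R) z : Im (x%:C%C * z) = x * Im z by case: z => a b /=; ring.
split.
  have := @stage_error P K L Re MP (@ler_Re_inner _ _); rewrite raddf_sum/=.
  by under eq_bigr do rewrite E ReE.
have := @stage_error P K L Im MP (@ler_Im_inner _ _); rewrite raddf_sum/=.
by under eq_bigr do rewrite E ImE.
Qed.

End finite_stage.
End herglotz.

(** * Passage from the finite stages to a measure on the solenoid *)

Section spectral_limit.
Variables (R : realType) (N : nat) (U : set_system nat).
Hypotheses (UU : UltraFilter U) (Ufree : \oo `<=` U).
Local Notation Re := (@complex.Re R).
Local Notation Im := (@complex.Im R).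
Local Notation sol := (solenoid R N).
Variables (M : nat -> nat) (w : nat -> nat -> R) (lam : nat -> nat -> R[i]).
Hypotheses (w_ge0 : forall m j, 0 <= w m j) (w_sum : forall m, \sum_(j < M m) w m j = 1).
Hypothesis lam_norm : forall m j, `|lam m j| = 1.

Local Instance spectral_properfilter : ProperFilter U := ultra_proper.

(* The point [lam m j] at level [m] has coordinate [lam m j ^+ (N ^ (m - n))] at the
   levels [n <= m]; the values at the levels [n > m] do not matter in the limit. *)
Let zc (n : int) m j : R[i] := lam m j ^+ (N ^ absz (m%:Z - n)).

Let zc_norm n m j : `|zc n m j| = 1.
Proof. by rewrite /zc normrX lam_norm expr1n. Qed.

Let space := loeb_space nat UU.

Let Lambda := loeb_prob Ufree (fun _ j => j : nat) w_ge0 w_sum.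

Let clim (f : nat -> nat -> R[i]) (x : space) : R[i] :=
  Complex (hlim (fun m j => Re (f m j)) x) (hlim (fun m j => Im (f m j)) x).

Let clim_cvg f x : (forall m j, `|f m j| = 1) -> f m (x m) @[m --> U] --> clim f x.
Proof.
move=> f1; apply/(cvg_complexP UU); split.
  by apply: (@hlim_cvg _ _ _ _ _ 1) => m j; have [] := norm1_Re_Im (f1 m j).
by apply: (@hlim_cvg _ _ _ _ _ 1) => m j; have [] := norm1_Re_Im (f1 m j).
Qed.

Let clim_norm f x : (forall m j, `|f m j| = 1) -> `|clim f x| = 1.
Proof.
move=> f1; have /(cvg_complexP UU)[fr fi] := @clim_cvg _ x f1.
have sq (z : R[i]) : `|z| = 1 -> Re z ^+ 2 + Im z ^+ 2 = 1.
  by move=> z1; rewrite -sqr_modulusE norm1_sqr_modulus.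
suff h : Re (clim f x) ^+ 2 + Im (clim f x) ^+ 2 = 1 by rewrite normc_def h sqrtr1.
have cs : Re (f m (x m)) * Re (f m (x m)) + Im (f m (x m)) * Im (f m (x m)) @[m --> U] -->
    Re (clim f x) * Re (clim f x) + Im (clim f x) * Im (clim f x).
  by apply: cvgD; apply: cvgM.
rewrite !expr2 -(cvg_lim _ cs)//; apply: cvg_lim => //.
by under eq_fun do rewrite -!expr2 sq//; exact: cvg_cst.
Qed.

Let cvgX (f : nat -> R[i]) (z : R[i]) k : f @ U --> z -> f m ^+ k @[m --> U] --> z ^+ k.
Proof.
move=> fz; exact: (@cvg_comp _ _ _ f (fun x : R[i] => x ^+ k) _ _ _ fz (@continuous_expn R k z)).
Qed.

Let cvg_complex_unique (f : nat -> R[i]) (a b : R[i]) : f @ U --> a -> f @ U --> b -> a = b.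
Proof.
move=> /(cvg_complexP UU)[ar ai] /(cvg_complexP UU)[br bi]; apply/eqP.
rewrite eq_complex; apply/andP; split; apply/eqP.
  by rewrite -(cvg_lim _ ar)//; apply: cvg_lim.
by rewrite -(cvg_lim _ ai)//; apply: cvg_lim.
Qed.

(** The relation between the coordinates [n] and [n + 1] holds exactly at all stages [m >= |n + 1|],
    hence along [U], which contains the cofinite sets. *)
Let limit_in (x : space) : solenoid_set N (fun n => clim (zc n) x).
Proof.
move=> n; split; last by apply: clim_norm => m j; exact: zc_norm.
have c1 := @cvgX _ _ N (@clim_cvg _ x (zc_norm (n + 1))).
have c0 := @clim_cvg _ x (zc_norm n).
apply: (cvg_complex_unique c1).
apply: cvg_trans c0; apply: near_eq_cvg; apply: Ufree.
exists (absz (n + 1)) => // m /= nm; rewrite /zc -exprM -expnSr; congr (_ ^+ (_ ^ _)).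
by lia.
Qed.

Let limit_point (x : space) : sol := SigSub (mem_set (limit_in x)).

Let coord_limit x n : coord (limit_point x) n = clim (zc n) x.
Proof. by []. Qed.

Let measurable_limit_point : measurable_fun setT limit_point.
Proof.
apply: measurable_solenoidP => p; apply/measurable_complexP; split.
  by apply: (@measurable_hlim _ _ _ _ _ 1) => m j; have [] := norm1_Re_Im (zc_norm p m j).
by apply: (@measurable_hlim _ _ _ _ _ 1) => m j; have [] := norm1_Re_Im (zc_norm p m j).
Qed.

Let limit_mfun : {mfun space >-> sol} :=
  HB.pack limit_point (isMeasurableFun.Build _ _ _ _ limit_point measurable_limit_point).

Let nu : probability sol R := distribution Lambda limit_mfun.

Let chi_n p K L m j : R[i] := zc p m j ^+ K * (zc p m j)^* ^+ L.

Let chi_n_norm p K L m j : `|chi_n p K L m j| = 1.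
Proof. by rewrite /chi_n /zc normrM !normrX norm_conjC normrX lam_norm !expr1n mulr1. Qed.

Let chi_limit p K L x : chi p K L (limit_point x) = clim (chi_n p K L) x.
Proof.
have c := @clim_cvg _ x (chi_n_norm p K L).
apply: cvg_complex_unique c.
rewrite /chi coord_limit; have z0 := @clim_cvg _ x (zc_norm p).
apply: cvgM; first exact: cvgX.
apply: cvgX; move/(cvg_complexP UU): z0 => [zr zi].
apply/(cvg_complexP UU); split.
  by rewrite complex_conjE; under eq_fun do rewrite complex_conjE.
by rewrite complex_conjE; under eq_fun do rewrite complex_conjE /=; exact: cvgN.
Qed.

Let int_part (part : R[i] -> R) (p K L : nat) :
  (forall x, part (clim (chi_n p K L) x) = hlim (fun m j => part (chi_n p K L m j)) x) ->
  measurable_fun setT (part \o chi p K L : sol -> R) ->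
  (forall z, `|z| = 1 -> `|part z| <= 1) ->
  (\int[nu]_z part (chi p K L z))%R =
  lim ((\sum_(j < M m) w m j * part (chi_n p K L m j)) @[m --> U]).
Proof.
move=> ph mp p1.
have := @loeb_integral _ _ _ _ Ufree _ _ (fun _ j => j : nat) w_ge0 w_sum
  (fun m j => part (chi_n p K L m j)) (fun m j => p1 _ (chi_n_norm p K L m j)).
move=> lE; transitivity (mlim U M w (fun _ j => j : nat) (fun m j => part (chi_n p K L m j))) => //.
rewrite -lE /Rintegral; congr fine.
transitivity (\int[Lambda]_x ((EFin \o (part \o chi p K L)) \o limit_point) x)%E.
  apply: integral_distribution; first exact/measurable_EFinP.
  apply: (@le_integrable _ _ _ _ _ measurableT _ (EFin \o cst 1)); last first.
  - exact: finite_measure_integrable_cst.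
  - by move=> x _; rewrite /= normr1 lee_fin p1// chi_norm.
  by apply/measurable_EFinP; exact: measurableT_comp mp measurable_limit_point.
by apply: eq_integral => x _ /=; rewrite chi_limit ph.
Qed.

Lemma spectral_limit (c : nat -> nat -> nat -> R[i]) :
  (forall p K L, (\sum_(j < M m) w m j *
     Re ((lam m j ^+ (N ^ (m - p))) ^+ K * (lam m j ^+ (N ^ (m - p)))^* ^+ L))
     @[m --> \oo] --> Re (c p K L)) ->
  (forall p K L, (\sum_(j < M m) w m j *
     Im ((lam m j ^+ (N ^ (m - p))) ^+ K * (lam m j ^+ (N ^ (m - p)))^* ^+ L))
     @[m --> \oo] --> Im (c p K L)) ->
  exists nu : probability sol R, forall p K L, cintegral nu (chi p K L) = c p K L.
Proof.
move=> cr ci; exists nu => p K L.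
have zcE m j : (p <= m)%N -> zc p m j = lam m j ^+ (N ^ (m - p)).
  by move=> pm; rewrite /zc; congr (_ ^+ (_ ^ _)); lia.
rewrite /cintegral; case E : (c p K L) (cr p K L) (ci p K L) => [a b] /= {}cr {}ci.
have mchi := @measurable_chi R N p K L.
congr Complex; rewrite int_part//.
- apply: cvg_lim => //; apply: cvg_trans (cvg_trans (cvg_app _ Ufree) cr).
  apply: near_eq_cvg; apply: Ufree; exists p => // m /= pm.
  by apply: eq_bigr => j _; rewrite /chi_n zcE.
- exact: measurable_Re.
- by move=> z /norm1_Re_Im[].
- apply: cvg_lim => //; apply: cvg_trans (cvg_trans (cvg_app _ Ufree) ci).
  apply: near_eq_cvg; apply: Ufree; exists p => // m /= pm.
  by apply: eq_bigr => j _; rewrite /chi_n zcE.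
- exact: measurable_Im.
- by move=> z /norm1_Re_Im[].
Qed.

End spectral_limit.

(** * The joint spectral measure of a compatible sequence of isometries *)

Section spectral_measure.
Variables (R : realType) (N : nat) (H : preHilbertType R[i]) (A : nat -> {linear H -> H}).
Local Notation Re := (@complex.Re R).
Local Notation Im := (@complex.Im R).
Hypotheses (N_ge2 : (2 <= N)%N) (Ai : forall p, isometric (A p)).
Hypothesis Ar : forall p x, iter N (A p.+1) x = A p x.

Lemma iter_level p r K x : iter K (A p) x = iter (K * N ^ r) (A (p + r)) x.
Proof.
elim: r => [|r ih]; first by rewrite expn0 muln1 addn0.
have refine_level q n : iter n (A q) x = iter (n * N) (A q.+1) x.
  by elim: n => // n ih'; rewrite mulSn iterD -ih' Ar.
by rewrite ih refine_level addnS expnSr mulnA.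
Qed.

Lemma spectral_measure_exists (xi : H) : nrm xi = 1 ->
  exists nu : probability (solenoid R N) R, forall p K L,
    cintegral nu (chi p K L) = inner (iter K (A p) xi) (iter L (A p) xi).
Proof.
(* Expressing level [p] through level [m] multiplies the exponents by [N^(m-p)], and with them the
   error [(K+L) 2/P]. With [P = N^(2m)] it is still at most [2 (K+L) / N^m]. *)
move=> xi1; pose P m := (N ^ (2 * m))%N; pose M m := (P m ^ 2)%N.
have P0 m : (0 < P m)%N by rewrite expn_gt0 (ltn_trans _ N_ge2).
have M0 m : (0 < M m)%N by rewrite expn_gt0 P0.
have /choice[om prim] := fun m => complex_prim_root_exists R (M0 m).
have /choice[w wP] := fun m => herglotz_stage (Ai m) xi1 (M0 m) (prim m) (erefl (M m)).
have [U [UU Ufree]] := ultraFilterLemma (_ : ProperFilter \oo).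
have err p K L : (K * N ^ (m - p) + L * N ^ (m - p))%:R * (2 / (P m)%:R) @[m --> \oo] -->
    (0 : R).
  have lim0 : (K + L)%:R * 2 * 2^-1 ^+ m @[m --> \oo] --> (0 : R).
    rewrite -[X in _ --> X](mulr0 ((K + L)%:R * 2)); apply: cvgM; first exact: cvg_cst.
    by apply: cvg_expr; rewrite ger0_norm//; lra.
  apply: (squeeze_cvgr _ (cvg_cst _) lim0); apply: nearW => m.
  rewrite mulr_ge0 ?divr_ge0//= -mulnDl natrM -!mulrA ler_wpM2l//.
  have N0 : (0 < N)%N by exact: ltn_trans N_ge2.
  have Nm : 0 < N%:R ^+ m :> R by rewrite exprn_gt0// ltr0n.
  have h1 : N%:R ^+ (m - p) * (N%:R ^+ m)^-1 <= 1 :> R.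
    by rewrite ler_pdivrMr// mul1r ler_eXn2l ?leq_subr// ltr1n.
  have h2 : (N%:R ^+ m)^-1 <= 2^-1 ^+ m :> R.
    rewrite exprVn lef_pV2 ?posrE ?exprn_gt0 ?ltr0n//.
    by apply: lerXn2r; rewrite ?nnegrE ?ler_nat.
  have -> : (N ^ (m - p))%:R * (2 / (P m)%:R) =
      2 * ((N%:R ^+ (m - p) / N%:R ^+ m) * (N%:R ^+ m)^-1) :> R.
    by rewrite /P mul2n -addnn expnD natrM !natrX; field; rewrite gt_eqF.
  by rewrite ler_wpM2l// (le_trans _ h2)// ler_piMl// invr_ge0 ltW.
have cvg_part (a : R) (b r : nat -> R) : (\forall m \near \oo, `|a - b m| <= r m) ->
    r @ \oo --> (0 : R) -> b @ \oo --> a.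
  move=> abr r0; apply/cvgrPdist_le => e e0.
  move/cvgrPdist_le : r0 => /(_ e e0); apply: filterS2 abr => m abr.
  rewrite sub0r normrN; apply: le_trans; exact: le_trans (ler_norm _).
apply: (@spectral_limit R N U UU Ufree M w (fun m j => om m ^+ j)).
- by move=> m j; have [] := wP m.
- by move=> m; have [] := wP m.
- move=> m j; apply/eqP; rewrite normrX -(@pexpr_eq1 _ _ (M m))// ?exprn_ge0//.
  by rewrite -exprM mulnC exprM -normrX (prim_expr_order (prim m)) normr1 expr1n.
- move=> p K L; apply: cvg_part (err p K L); exists p => // m /= pm.
  have [_ _ /(_ (K * N ^ (m - p)) (L * N ^ (m - p)))%N [+ _]] := wP m.
  rewrite (iter_level p (m - p) K) (iter_level p (m - p) L) subnKC//.
  apply: le_trans; rewrite le_eqVlt; apply/orP; left; apply/eqP; congr `|_ - _|.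
  apply: eq_bigr => j _; congr (_ * _).
  rewrite (mulnC K) (mulnC L) !exprM; congr (Re (_ * _ ^+ _)); exact: rmorphXn.
- move=> p K L; apply: cvg_part (err p K L); exists p => // m /= pm.
  have [_ _ /(_ (K * N ^ (m - p)) (L * N ^ (m - p)))%N [_ +]] := wP m.
  rewrite (iter_level p (m - p) K) (iter_level p (m - p) L) subnKC//.
  apply: le_trans; rewrite le_eqVlt; apply/orP; left; apply/eqP; congr `|_ - _|.
  apply: eq_bigr => j _; congr (_ * _).
  rewrite (mulnC K) (mulnC L) !exprM; congr (Im (_ * _ ^+ _)); exact: rmorphXn.
Qed.

End spectral_measure.

(** * The shifted measure *)

Section integral_limits.
Context d (T : measurableType d) (R : realType) (mu : {measure set T -> \bar R}).
Variables (f_ : nat -> T -> R) (f : T -> R).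
Hypotheses (mf_ : forall n, measurable_fun setT (f_ n)).
Hypothesis ff : forall x, f_ n x @[n --> \oo] --> f x.

Let mf : measurable_fun setT f.
Proof. by apply: (measurable_fun_cvg (h := f_)) => // x _; exact: ff. Qed.

Lemma dominated_convergence_real (g : T -> R) : mu.-integrable setT (EFin \o g) ->
  (forall n x, `|f_ n x| <= g x) ->
  (\int[mu]_x (f_ n x)%:E @[n --> \oo] --> \int[mu]_x (f x)%:E)%E.
Proof.
move=> ig fg.
have mf_' n : measurable_fun setT (fun x => (f_ n x)%:E) by exact/measurable_EFinP.
have mf' : measurable_fun setT (fun x => (f x)%:E) by exact/measurable_EFinP.
have cf : \forall x \ae mu, setT x -> (f_ n x)%:E @[n --> \oo] --> (f x)%:E.
  by apply: aeW => x _; apply: cvg_EFin; [exact: nearW|exact: ff].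
have bf : \forall x \ae mu, forall n : nat, setT x -> (`|(f_ n x)%:E| <= (EFin \o g) x)%E.
  by apply: aeW => x n _; rewrite lee_fin.
by have [] := dominated_convergence measurableT mf_' mf' cf ig bf.
Qed.

Lemma monotone_convergence_real : (forall n x, 0 <= f_ n x) ->
  (forall x, nondecreasing_seq (f_^~ x)) ->
  (\int[mu]_x (f_ n x)%:E @[n --> \oo] --> \int[mu]_x (f x)%:E)%E.
Proof.
move=> f0 nd.
have mf_' n : measurable_fun setT (fun x => (f_ n x)%:E) by exact/measurable_EFinP.
have f0' n x : setT x -> (0 <= (f_ n x)%:E)%E by rewrite lee_fin.
have nd' x : setT x -> {homo (fun n => (f_ n x)%:E) : n m / (n <= m)%N >-> (n <= m)%E}.
  by move=> _ n m nm; rewrite lee_fin; exact: nd.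
have := @cvg_monotone_convergence _ _ _ mu _ measurableT _ mf_' f0' nd'.
rewrite (_ : (\int[mu]_x _)%E = (\int[mu]_x (f x)%:E)%E)//.
apply: eq_integral => x _; apply: cvg_lim => //.
by apply: cvg_EFin; [exact: nearW|exact: ff].
Qed.

End integral_limits.

Lemma measurable_cadd d (T : measurableType d) (R : realType) (f g : T -> R[i]) :
  measurable_fun setT f -> measurable_fun setT g -> measurable_fun setT (fun x => f x + g x).
Proof.
move=> /measurable_complexP[fr fi] /measurable_complexP[gr gi].
apply/measurable_complexP; split.
  rewrite (_ : _ \o _ = (fun x => complex.Re (f x) + complex.Re (g x))).
    exact: measurable_funD.
  by apply/funext => x /=; rewrite raddfD.
rewrite (_ : _ \o _ = (fun x => complex.Im (f x) + complex.Im (g x))).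
  exact: measurable_funD.
by apply/funext => x /=; rewrite raddfD.
Qed.

Section shift_density.
Variables (R : realType) (N : nat).
Local Notation Re := (@complex.Re R).
Local Notation Im := (@complex.Im R).
Local Notation sol := (solenoid R N).
Variables (nu : probability sol R) (h : sol -> R[i]).
Hypothesis sh : square_integrable nu h.
Hypothesis h_chi : forall p K L,
  cinner nu (fun z => chi p K L (shift z) * h z) h = cintegral nu (chi p K L).

Let dens z : R := sqr_modulus (h z).

Let dens_ge0 z : 0 <= dens z. Proof. exact: sqr_modulus_ge0. Qed.

Let mh : measurable_fun setT h. Proof. by case: sh. Qed.

Let mdens : measurable_fun setT dens.
Proof. exact: measurable_sqr_modulus. Qed.

Let mshift : measurable_fun setT (@shift R N).
Proof. exact: measurable_translate. Qed.

Let idens : nu.-integrable setT (EFin \o dens).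
Proof.
apply/integrableP; split; first exact/measurable_EFinP.
under eq_integral do rewrite /= ger0_norm//.
by case: sh.
Qed.

Let idensM (f : sol -> R) (C : R) : measurable_fun setT f -> (forall z, `|f z| <= C) ->
  nu.-integrable setT (fun z => (f (shift z) * dens z)%:E).
Proof.
move=> mf fC; have iC : nu.-integrable setT (fun z => (C%:E * (EFin \o dens) z)%E).
  exact: integrableZl.
apply: (@le_integrable _ _ _ _ _ measurableT _ _ _ _ iC).
  apply/measurable_EFinP; apply: measurable_funM => //.
  exact: measurableT_comp mf mshift.
move=> z _; rewrite /= lee_fin !normrM ler_wpM2r//.
exact: le_trans (fC _) (ler_norm _).
Qed.

Let ibounded (f : sol -> R) (C : R) : measurable_fun setT f -> (forall z, `|f z| <= C) ->
  nu.-integrable setT (EFin \o f).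
Proof.
move=> mf fC; apply: (@le_integrable _ _ _ _ _ measurableT _ (EFin \o cst C)).
- exact/measurable_EFinP.
- by move=> z _; rewrite /= lee_fin (le_trans (fC z))// ler_norm.
- exact: finite_measure_integrable_cst.
Qed.

Let M : set (sol -> R) := [set f : sol -> R | [/\ measurable_fun setT f,
  exists C : R, forall z, `|f z| <= C &
  (\int[nu]_z (f (shift z) * dens z)%:E = \int[nu]_z (f z)%:E)%E]].

Let M_monotone : monotone_class M.
Proof.
split=> [k f g [mf [C fC] ef] [mg [D gD] eg]|f_ f C Mf_ fC ff].
  have mkf : measurable_fun setT (fun z => k * f z) by exact: measurable_funM.
  have kfC z : `|k * f z| <= `|k| * C by rewrite normrM ler_wpM2l.
  split; first exact: measurable_funD.
    by exists (`|k| * C + D) => x; rewrite (le_trans (ler_normD _ _))// lerD.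
  have lin (u v : sol -> R) : nu.-integrable setT (EFin \o u) ->
      nu.-integrable setT (EFin \o v) ->
      (\int[nu]_z (k * u z + v z)%:E = k%:E * \int[nu]_z (u z)%:E + \int[nu]_z (v z)%:E)%E.
    move=> iu iv; have iku : nu.-integrable setT (fun z => k%:E * (u z)%:E)%E.
      exact: integrableZl.
    by rewrite -integralZl// -(integralD measurableT iku iv).
  rewrite (lin f g (ibounded mf fC) (ibounded mg gD)) -ef -eg.
  rewrite -(lin _ _ (idensM mf fC) (idensM mg gD)).
  by apply: eq_integral => z _; rewrite mulrDl mulrA.
have fC' x : `|f x| <= C.
  have fx : `|f_ n x| @[n --> \oo] --> `|f x| by apply: cvg_norm; exact: ff.
  rewrite -(cvg_lim _ fx)//; apply: limr_le; first exact: cvgP fx.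
  by apply: nearW => n; exact: fC.
have mf_ n : measurable_fun setT (f_ n) by have [] := Mf_ n.
have mf : measurable_fun setT f.
  by apply: (measurable_fun_cvg (h := f_)) => // x _; exact: ff.
split => //; first by exists C.
have iC : nu.-integrable setT (EFin \o (fun z => C * dens z)).
  rewrite (_ : _ \o _ = (fun z => (C%:E * (EFin \o dens) z)%E)); first exact: integrableZl.
  by apply/funext => z /=; rewrite EFinM.
have c1 : (\int[nu]_z (f_ n (shift z) * dens z)%:E @[n --> \oo] -->
    \int[nu]_z (f (shift z) * dens z)%:E)%E.
  apply: (dominated_convergence_real _ _ iC).
  - move=> n; apply: measurable_funM => //; exact: measurableT_comp (mf_ n) mshift.
  - by move=> z; apply: cvgM; [exact: ff|exact: cvg_cst].
  - by move=> n z; rewrite normrM (ger0_norm (dens_ge0 z)) ler_wpM2r.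
have c2 : (\int[nu]_z (f_ n z)%:E @[n --> \oo] --> \int[nu]_z (f z)%:E)%E.
  apply: (@dominated_convergence_real _ _ _ _ _ _ mf_ ff (cst C)) => //.
  exact: finite_measure_integrable_cst.
have e n : (\int[nu]_z (f_ n (shift z) * dens z)%:E = \int[nu]_z (f_ n z)%:E)%E.
  by have [] := Mf_ n.
by move: c1; under eq_fun do rewrite e; move=> c1; rewrite -(cvg_lim _ c1)// -(cvg_lim _ c2).
Qed.

(** The identity is linear in [f] and survives bounded limits, so the monotone class argument
    reduces it to characters, where it is [h_chi]. *)
Lemma shift_integral_bounded (f : sol -> R) (C : R) :
  measurable_fun setT f -> (forall z, `|f z| <= C) ->
  (\int[nu]_z (f (shift z) * sqr_modulus (h z))%:E = \int[nu]_z (f z)%:E)%E.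
Proof.
move=> mf fC; suff EM : chi_parts (N := N) `<=` M.
  by have [] := solenoid_monotone_class M_monotone EM mf fC.
move=> g Eg; have gb := chi_parts_bounded Eg.
have mg : measurable_fun setT g.
  case: Eg => p [K [L [->|->]]].
    by apply: measurable_Re; exact: measurable_chi.
  by apply: measurable_Im; exact: measurable_chi.
split => //; first by exists 1.
have fin1 : (\int[nu]_z (g (shift z) * dens z)%:E)%E \is a fin_num.
  by apply: integrable_fin_num => //; exact: idensM mg gb.
have fin2 : (\int[nu]_z (g z)%:E)%E \is a fin_num.
  by apply: integrable_fin_num => //; exact: ibounded mg gb.
rewrite -(fineK fin1) -(fineK fin2); congr EFin.
case: Eg => p [K [L gE]].
have := h_chi p K L; rewrite cinnerE /cintegral => -[er ei].
case: gE => gE; rewrite gE.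
- rewrite -[RHS]er; congr fine; apply: eq_integral => z _; congr EFin => /=.
  rewrite /dens sqr_modulusE; case: (chi p K L (shift z)) (h z) => a b [c e] /=; ring.
- rewrite -[RHS]ei; congr fine; apply: eq_integral => z _; congr EFin => /=.
  rewrite /dens sqr_modulusE; case: (chi p K L (shift z)) (h z) => a b [c e] /=; ring.
Qed.

(** Truncate [k] at [n] and use monotone convergence on both sides. *)
Lemma shift_integral_ge0 (k : sol -> R) :
  measurable_fun setT k -> (forall z, 0 <= k z) ->
  (\int[nu]_z (k (shift z) * sqr_modulus (h z))%:E = \int[nu]_z (k z)%:E)%E.
Proof.
move=> mk k0; pose k_ n z : R := Num.min (k z) n%:R.
have mk_ n : measurable_fun setT (k_ n) by exact: measurable_minr.
have k_0 n z : 0 <= k_ n z by rewrite le_min k0 ler0n.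
have k_n n z : `|k_ n z| <= n%:R by rewrite ger0_norm// ge_min lexx orbT.
have k_nd z : nondecreasing_seq (k_^~ z).
  by move=> m n mn; rewrite le_min !ge_min lexx/= ler_nat mn orbT.
have k_cvg z : k_ n z @[n --> \oo] --> k z.
  apply: cvg_near_cst; exists (Num.bound (k z)) => // n /= hn; apply/min_idPl.
  by rewrite (le_trans (ltW (archi_boundP (k0 z))))// ler_nat.
have c1 : (\int[nu]_z (k_ n (shift z) * dens z)%:E @[n --> \oo] -->
    \int[nu]_z (k (shift z) * dens z)%:E)%E.
  apply: monotone_convergence_real.
  - move=> n; apply: measurable_funM => //; exact: measurableT_comp (mk_ n) mshift.
  - by move=> z; apply: cvgM; [exact: k_cvg|exact: cvg_cst].
  - by move=> n z; rewrite mulr_ge0.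
  - by move=> z m n mn; rewrite ler_wpM2r//; exact: k_nd.
have c2 : (\int[nu]_z (k_ n z)%:E @[n --> \oo] --> \int[nu]_z (k z)%:E)%E.
  exact: monotone_convergence_real.
have e n := shift_integral_bounded (mk_ n) (k_n n).
by move: c1; under eq_fun do rewrite e; move=> c1; rewrite -(cvg_lim _ c1)// -(cvg_lim _ c2).
Qed.

(** The integral identity for the indicator of the image of [F] under the shift, whose composition
    with the shift is the indicator of [F]. *)
Lemma shiftedE_density (F : set sol) : measurable F ->
  (shifted nu F = \int[nu]_z (\1_F z * sqr_modulus (h z))%:E)%E.
Proof.
move=> mF; rewrite /shifted shift_image.
have mt : measurable (translate 1 @^-1` F).
  by rewrite -[X in measurable X]setTI; exact: measurable_translate.
have i1 : (\int[nu]_z (\1_(translate 1 @^-1` F) z)%:E)%E = nu (translate 1 @^-1` F).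
  by rewrite integral_indic// setIT.
rewrite -i1 -shift_integral_ge0; last 2 first.
- exact: measurable_indic.
- by move=> z; rewrite indicE.
apply: eq_integral => z _; congr (_ * _)%:E; rewrite !indicE; congr (_%:R).
congr nat_of_bool; apply/idP/idP => /set_mem zF; apply/mem_set.
  by move: zF; rewrite /= /shift translateD subrr translate0.
by rewrite /= /shift translateD subrr translate0.
Qed.

Lemma shifted_dominated : shifted nu `<< nu.
Proof.
apply/null_content_dominatesP => F mF F0; rewrite shiftedE_density//.
rewrite -(integral0 nu setT); apply: ge0_ae_eq_integral => //.
- by apply/measurable_EFinP; apply: measurable_funM.
- by move=> z _; rewrite lee_fin mulr_ge0 ?sqr_modulus_ge0 ?indicE.
have nF : nu.-negligible F by apply/negligibleP.
apply: (negligibleS _ nF) => z /= nz; apply: contrapT => Fz; apply: nz => _.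
by rewrite indicE memNset// mul0r.
Qed.

Lemma Delta_density : {ae nu, forall z, Delta nu z = sqr_modulus (h z)}.
Proof.
pose rn := Radon_Nikodym (charge_of_finite_measure (shifted nu)) nu.
have dom : charge_of_finite_measure (shifted nu) `<< nu by exact: shifted_dominated.
have irn : nu.-integrable setT rn by exact: Radon_Nikodym_integrable.
have : ae_eq nu setT rn (EFin \o dens).
  apply: integral_ae_eq => //; first exact/measurable_EFinP.
  move=> F _ mF; rewrite -Radon_Nikodym_integral//.
  rewrite [LHS](shiftedE_density mF) [RHS]integral_mkcond.
  apply: eq_integral => z _; rewrite patchE indicE.
  by case: (z \in F); rewrite ?mul1r ?mul0r.
by apply: filterS => z /(_ Logic.I) rz; rewrite /Delta -/rn rz.
Qed.

Hypothesis h_neq0 : {ae nu, forall z, h z != 0}.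

Lemma dominated_shifted : nu `<< shifted nu.
Proof.
apply/null_content_dominatesP => F mF sF0.
have F0 : (\int[nu]_z (\1_F z * sqr_modulus (h z))%:E = 0)%E.
  by rewrite -shiftedE_density.
have mFd : measurable_fun setT (fun z => (\1_F z * dens z)%:E).
  by apply/measurable_EFinP; apply: measurable_funM.
apply/negligibleP => //.
have : (\int[nu]_z `|(\1_F z * dens z)%:E| = 0)%E.
  rewrite -[RHS]F0; apply: eq_integral => z _.
  by rewrite gee0_abs// lee_fin mulr_ge0 ?sqr_modulus_ge0 ?indicE.
move=> /(ae_eq_integral_abs nu measurableT mFd).1 Fd0.
have : {ae nu, forall z, ~ F z}.
  apply: filterS2 Fd0 h_neq0 => z /(_ Logic.I) [Fdz] hz Fz; move: Fdz.
  by rewrite indicE mem_set// mul1r => /sqr_modulus_eq0/eqP; apply/negP.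
by apply: negligibleS => z /= Fz /(_ Fz).
Qed.

Lemma measurable_zeros : measurable [set z | h z = 0].
Proof.
rewrite (_ : [set z | h z = 0] = dens @^-1` [set 0]).
  by rewrite -[X in measurable X]setTI; exact: mdens.
apply/seteqP; split => z /=; last exact: sqr_modulus_eq0.
by rewrite /dens => ->; rewrite sqr_modulusE /= expr0n addr0.
Qed.

(** This is [h / |h|], set to 1 on the zeros of [h] so that the modulus is 1 everywhere and not only
    almost everywhere. The factor [1/|h|] is written as a real power, whose measurability is
    immediate. *)
Definition phase z : R[i] :=
  (\1_[set z | h z = 0] z)%:C%C + (sqr_modulus (h z) `^ (- 2^-1))%:C%C * h z.

Lemma measurable_phase : measurable_fun setT phase.
Proof.
have mr (f : sol -> R) : measurable_fun setT f -> measurable_fun setT (fun z => (f z)%:C%C).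
  by move=> mf; apply/measurable_complexP; split => //; exact: measurable_cst.
apply: measurable_cadd; first by apply: mr; exact: (measurable_indic measurable_zeros).
apply: measurable_cmul => //; apply: mr.
exact: measurableT_comp (measurable_powR _) mdens.
Qed.

Let phase_neq0 z : h z != 0 -> phase z = ((Num.sqrt (dens z))^-1)%:C%C * h z.
Proof.
move=> hz; rewrite /phase indicE memNset ?add0r; last by move/eqP: hz.
by rewrite powRN powR12_sqrt ?sqr_modulus_ge0.
Qed.

Let sqrt_dens_gt0 z : h z != 0 -> 0 < Num.sqrt (dens z).
Proof.
move=> hz; rewrite sqrtr_gt0 lt_neqAle dens_ge0 andbT eq_sym.
by apply: contra hz => /eqP/sqr_modulus_eq0/eqP.
Qed.

Lemma phase_norm z : `|phase z| = 1.
Proof.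
have [hz|hz] := eqVneq (h z) 0.
  by rewrite /phase indicE mem_set// hz mulr0 addr0 normr1.
rewrite phase_neq0// normrM.
have -> : `|h z| = (Num.sqrt (dens z))%:C%C by rewrite normc_def /dens sqr_modulusE.
rewrite ger0_norm ?lecR ?invr_ge0 ?sqrtr_ge0// -rmorphM mulVf//.
by rewrite gt_eqF// sqrt_dens_gt0.
Qed.

Lemma phase_density z : (Num.sqrt (sqr_modulus (h z)))%:C%C * phase z = h z.
Proof.
have [hz|hz] := eqVneq (h z) 0.
  by rewrite hz sqr_modulusE /= expr0n addr0 sqrtr0 mul0r.
rewrite phase_neq0// mulrA -rmorphM mulfV ?mul1r//.
by rewrite gt_eqF// sqrt_dens_gt0.
Qed.

End shift_density.

(** * Representations of the Baumslag-Solitar group *)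

Section bs_generators.
Variable N : nat.
Local Open Scope group_scope.
Local Notation u := (bs_u N).
Local Notation t := (bs_t N).

(* The element corresponding to 1/N^p. *)
Definition bs_root p : BS N := t ^ (u ^+ p).

Lemma bs_rootX p n : bs_root p ^+ n = t ^+ n ^ (u ^+ p).
Proof. by rewrite conjXg. Qed.

Lemma bs_root0 : bs_root 0 = t.
Proof. by rewrite /bs_root expg0 conjg1. Qed.

Lemma bs_rootS p : bs_root p.+1 ^+ N = bs_root p.
Proof.
have e : t ^+ N ^ u = t by rewrite -bs_relation conjgE -!mulgA mulVg mulg1 mulgA mulVg mul1g.
by rewrite bs_rootX expgS conjgM e.
Qed.

Lemma bs_root_raise r p n : bs_root p ^+ n = bs_root (p + r) ^+ (n * N ^ r).
Proof.
elim: r => [|r IH]; first by rewrite addn0 expn0 muln1.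
by rewrite IH addnS -(bs_rootS (p + r)) -expgnA expnS mulnCA.
Qed.

Lemma bs_u_root p n : u * bs_root p ^+ n = bs_root p ^+ (N * n) * u.
Proof.
have uX : commute u (u ^+ p) by apply: commuteX.
have e : bs_root p ^ u^-1 = bs_root p ^+ N.
  rewrite bs_rootX -bs_relation /bs_root -conjgM.
  have -> : u ^+ p * u^-1 = u^-1 * u ^+ p by apply: commuteV; apply: commute_sym.
  by rewrite conjgM; congr (_ ^ _); rewrite conjgE invgK mulgA.
rewrite expgnA -e -(conjXg (bs_root p)) (conjgE (bs_root p ^+ n)) invgK.
by rewrite mulgA mulgVK.
Qed.

(** The element [(K-L)/N^p] of [Z[1/N]], indexed like the characters [chi3]. *)
Definition bs_frac (i : nat * nat * nat) : BS N :=
  bs_root i.1.1 ^+ i.1.2 * bs_root i.1.1 ^- i.2.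

Lemma bs_frac_raise r p K L :
  bs_frac (p, K, L) = bs_frac (p + r, K * N ^ r, L * N ^ r)%N.
Proof. by rewrite /bs_frac /= !(bs_root_raise r p). Qed.

Lemma bs_fracM p K L K' L' :
  bs_frac (p, K, L) * bs_frac (p, K', L') = bs_frac (p, K + K', L + L')%N.
Proof.
have c : commute (bs_root p ^- L) (bs_root p ^+ K').
  by apply/commute_sym/commuteV; apply: commuteX2.
rewrite /bs_frac /= expgnDr [(L + L')%N]addnC expgnDr invgM -!mulgA; congr (_ * _).
by rewrite !mulgA c.
Qed.

Lemma bs_u_frac p K L : u * bs_frac (p, K, L) = bs_frac (p, N * K, N * L)%N * u.
Proof.
rewrite /bs_frac /= mulgA bs_u_root -!mulgA; congr (_ * _).
apply: (mulgI (bs_root p ^+ (N * L))); rewrite !mulgA -bs_u_root.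
by rewrite mulgK mulgV mul1g.
Qed.

Lemma bs_Zinv_frac g : bs_Zinv N g -> exists i, g = bs_frac i.
Proof.
case=> p [[n|n] ->]; [exists (p, n, 0%N)|exists (p, 0%N, n.+1)].
  by rewrite /bs_frac /= invg1 mulg1 bs_rootX conjgE mulgA.
by rewrite /bs_frac /= mul1g bs_rootX -conjVg conjgE mulgA.
Qed.

End bs_generators.

(** * Matching the orbit of the cyclic vector with the characters *)

Section representation_model.
Variables (R : realType) (N : nat) (H : hilbertType R[i]) (pi : unitary_rep (BS N) H).

Lemma rep_inner g x y : inner (pi g x) (pi g y) = inner x y.
Proof. by have [h _] := rep_unitary pi g; exact: h. Qed.

Lemma rep_isometric g : isometric (pi g).
Proof. by apply: inner_isometric => x y; exact: rep_inner. Qed.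

Lemma rep_iter g n x : iter n (pi g) x = pi (g ^+ n)%g x.
Proof.
elim: n => [|n IH]; first by rewrite expg0 rep1.
by rewrite iterS IH -repM expgS.
Qed.

(** Applying the unitary of [a_p^(L+L')] to both arguments clears the negative exponents, leaving
    inner products of the kind prescribed by the spectral measure. *)
Lemma rep_frac_inner p K L K' L' x :
  inner (pi (bs_frac N (p, K, L)) x) (pi (bs_frac N (p, K', L')) x) =
  inner (pi (bs_root N p ^+ (K + L'))%g x) (pi (bs_root N p ^+ (L + K'))%g x).
Proof.
have fracE n : (bs_root N p ^+ n)%g = bs_frac N (p, n, 0%N).
  by rewrite /bs_frac /= invg1 mulg1.
have cancel n M : bs_frac N (p, n + M, M)%N = bs_frac N (p, n, 0%N).
  by rewrite /bs_frac /= expgnDr mulgK invg1 mulg1.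
rewrite -(rep_inner (bs_root N p ^+ (L + L'))%g) -!repM fracE !bs_fracM !fracE.
rewrite !add0n; congr (inner (pi _ x) (pi _ x)).
  by rewrite addnAC -addnA addnC -(cancel (K + L')%N L); congr (bs_frac N (p, _, _)); lia.
by rewrite -(cancel (L + K')%N L'); congr (bs_frac N (p, _, _)); lia.
Qed.

(** The scalar [c] allows the cyclic vector to be normalized. *)
Lemma cyclic_total xi (c : R[i]) : c != 0 -> cyclic_vector pi (bs_Zinv N) xi ->
  total (fun i => pi (bs_frac N i) (c *: xi)).
Proof.
move=> c0 cyc x e e0.
have : closure (lspan [set pi g xi | g in bs_Zinv N]) x by rewrite cyc.
have ec0 : 0 < e%:C%C :> R[i] by rewrite ltcR.
move/(_ _ (nbhsx_ballx x _ ec0)) => [v [[n [k [a [aP ->]]]]]].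
rewrite -ball_normE /= => xv.
have /choice[j jP] : forall i, exists l, a i = pi (bs_frac N l) xi.
  move=> i; have [g gZ <-] := aP i.
  by have [l ->] := bs_Zinv_frac gZ; exists l.
exists [seq (k i / c, j i) | i <- index_enum 'I_n].
rewrite -ltcR hilbert_nrm; apply: le_lt_trans xv.
rewrite /lincomb big_map le_eqVlt; apply/orP; left; apply/eqP; congr (`|_ - _|).
by apply: eq_bigr => i _; rewrite jP linearZ/= scalerA divfK.
Qed.

Variables (nu : probability (solenoid R N) R) (xi : H).
Hypothesis nu_chi : forall p K L, cintegral nu (chi p K L) =
  inner (pi (bs_root N p ^+ K)%g xi) (pi (bs_root N p ^+ L)%g xi).

Lemma chi3_raise r p K L : chi3 (R := R) (N := N) (p, K, L) =
  chi3 (p + r, K * N ^ r, L * N ^ r)%N.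
Proof. by apply/funext => z; exact: chi_raise. Qed.

Lemma spectral_gram i j : inner (pi (bs_frac N i) xi) (pi (bs_frac N j) xi) =
  inner (chiL2 nu i) (chiL2 nu j).
Proof.
case: i j => [[p K] L] [[p' K'] L'].
rewrite (bs_frac_raise N p' p) (bs_frac_raise N p p') [(p' + p)%N]addnC rep_frac_inner -nu_chi.
rewrite /chiL2 (inner_mkL2 (chi3_sqint nu _) (chi3_sqint nu _)).
rewrite (chi3_raise p' p) (chi3_raise p p') [(p' + p)%N]addnC; congr cintegral.
by apply/funext => z; rewrite /chi3 /= chi_conj chiM.
Qed.

End representation_model.

(** * The action of the generators on [L2(nu)] *)

Section shift_model.
Variables (R : realType) (N : nat) (H : hilbertType R[i]) (pi : unitary_rep (BS N) H).
Variables (nu : probability (solenoid R N) R) (xi : H).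
Hypothesis nu_chi : forall p K L, cintegral nu (chi p K L) =
  inner (pi (bs_root N p ^+ K)%g xi) (pi (bs_root N p ^+ L)%g xi).
Hypothesis total_frac : total (fun i => pi (bs_frac N i) xi).
Variable f : {linear H -> L2 nu}.
Hypothesis f_isometric : isometric f.
Hypothesis f_surj : forall y, exists x, f x = y.
Hypothesis f_frac : forall i, f (pi (bs_frac N i) xi) = chiL2 nu i.

Let measurable_chi3 i : measurable_fun setT (chi3 (R := R) (N := N) i).
Proof. exact: measurable_chi. Qed.

Let chi3_integral i (k : solenoid R N -> R) :
  measurable_fun setT k -> (forall x, 0 <= k x) -> (\int[nu]_x (k x)%:E < +oo)%E ->
  (\int[nu]_x (k (id x) * sqr_modulus (chi3 (R := R) (N := N) i x))%:E)%E =
  (\int[nu]_x (k x)%:E)%E.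
Proof.
by move=> _ _ _; apply: eq_integral => x _; rewrite chi3_sqr_modulus mulr1.
Qed.

Let mul_chi i : {linear L2 nu -> L2 nu} :=
  wcompL2 (@measurable_id _ _ setT) (@measurable_chi3 i) (@chi3_integral i).

Let mul_chi_mk i g : square_integrable nu g ->
  mul_chi i (mkL2 nu g) = mkL2 nu (fun z => g z * chi3 i z).
Proof. exact: wcompL2_mk. Qed.

Let mul_chi_isometric i : isometric (mul_chi i).
Proof. exact: wcompL2_isometric. Qed.

Let mul_chi_frac i j : f (pi (bs_frac N i) (pi (bs_frac N j) xi)) = mul_chi i (chiL2 nu j).
Proof.
case: i j => [[p K] L] [[p' K'] L'].
have -> : f (pi (bs_frac N (p, K, L)) (pi (bs_frac N (p', K', L')) xi)) =
   chiL2 nu (p + p', K * N ^ p' + K' * N ^ p, L * N ^ p' + L' * N ^ p)%N.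
  rewrite -f_frac -bs_fracM (bs_frac_raise N p' p) (bs_frac_raise N p p').
  by rewrite [(p' + p)%N]addnC -repM.
rewrite /chiL2 (mul_chi_mk _ (chi3_sqint nu _)); congr mkL2; apply/funext => z.
rewrite (chi3_raise R N p' p) (chi3_raise R N p p') [(p' + p)%N]addnC.
by rewrite mulrC /chi3 /= chiM.
Qed.

Lemma mul_chiE i eta : f (pi (bs_frac N i) eta) = mul_chi i (f eta).
Proof.
have e1 : isometric (f \o pi (bs_frac N i)).
  by move=> x; rewrite (f_isometric _) (rep_isometric pi _ x).
have e2 : isometric (mul_chi i \o f).
  by move=> x; exact: (etrans (mul_chi_isometric i (f x)) (f_isometric x)).
have := isometric_total_eq (f := f \o pi (bs_frac N i)) (g := mul_chi i \o f) e1 e2 total_frac.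
by apply=> j /=; rewrite f_frac mul_chi_frac.
Qed.

Let h : solenoid R N -> R[i] := L2_fun (f (pi (bs_u N) xi)).

Let sh : square_integrable nu h. Proof. exact: L2_funP. Qed.

Let mh : measurable_fun setT h. Proof. by case: sh. Qed.

(** Moving [u] to the right multiplies the exponents by [N]; on the side of [L2(nu)] this turns the
    character into its composition with the shift, multiplied by the image [h] of [pi(u) xi]. *)
Let u_frac p K L : f (pi (bs_u N) (pi (bs_frac N (p, K, L)) xi)) =
  mkL2 nu (fun z => chi p K L (shift z) * h z).
Proof.
rewrite -repM bs_u_frac repM mul_chiE -[f _]L2_funK -/h (mul_chi_mk _ sh).
by congr mkL2; apply/funext => z; rewrite mulrC chi_shift.
Qed.

Let sqint_chi_h p K L : square_integrable nu (fun z => chi p K L (shift z) * h z).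
Proof.
have := wcomp_sqint (@measurable_id _ _ setT) (@measurable_chi3 (p, N * K, N * L)%N)
  (@chi3_integral (p, N * K, N * L)%N) sh.
congr square_integrable; apply/funext => z.
by rewrite /wcomp mulrC chi_shift.
Qed.

(** Read through [f], this says that [pi(u)] preserves the inner product of
    [pi(bs_frac (p, K, L)) xi] with [xi]. *)
Let h_chi p K L :
  cinner nu (fun z => chi p K L (shift z) * h z) h = cintegral nu (chi p K L).
Proof.
rewrite -(inner_mkL2 (sqint_chi_h p K L) sh) -u_frac L2_funK.
rewrite (isometric_inner f_isometric) rep_inner nu_chi.
have {2}-> : xi = pi (bs_frac N (p, 0, 0)%N) xi.
  by rewrite /bs_frac /= invg1 mulg1 rep1.
by rewrite rep_frac_inner addn0 addn0.
Qed.

Let measurable_shift : measurable_fun setT (@shift R N).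
Proof. exact: measurable_translate. Qed.

Let h_integral (k : solenoid R N -> R) :
  measurable_fun setT k -> (forall x, 0 <= k x) -> (\int[nu]_x (k x)%:E < +oo)%E ->
  (\int[nu]_x (k (shift x) * sqr_modulus (h x))%:E)%E = (\int[nu]_x (k x)%:E)%E.
Proof. by move=> mk k0 _; exact: (shift_integral_ge0 sh h_chi). Qed.

Let J : {linear L2 nu -> L2 nu} := wcompL2 measurable_shift mh h_integral.

Let J_isometric : isometric J.
Proof. exact: wcompL2_isometric. Qed.

Lemma shift_modelE eta : f (pi (bs_u N) eta) = J (f eta).
Proof.
have e1 : isometric (f \o pi (bs_u N)).
  by move=> x; rewrite (f_isometric _) (rep_isometric pi _ x).
have e2 : isometric (J \o f).
  by move=> x; exact: (etrans (J_isometric (f x)) (f_isometric x)).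
have := isometric_total_eq (f := f \o pi (bs_u N)) (g := J \o f) e1 e2 total_frac.
apply; move=> -[[p K] L]; rewrite /= f_frac u_frac.
exact: (esym (wcompL2_mk measurable_shift mh h_integral (chi3_sqint nu (p, K, L)))).
Qed.

(** Functions in the range of [J] vanish almost everywhere on the zero set of [h]. Since [pi(u)] is
    onto, that range contains the indicator of this very set, which must therefore be null. *)
Let h_neq0 : {ae nu, forall z, h z != 0}.
Proof.
have mE : measurable [set z | h z = 0] by exact: (measurable_zeros sh).
pose g z : R[i] := (\1_[set z | h z = 0] z)%:C%C.
have mg : measurable_fun setT g.
  apply/measurable_complexP; split; last exact: measurable_cst.
  exact: measurable_indic.
have sg : square_integrable nu g.
  apply: (@bounded_square_integrable _ _ _ _ g 1 mg) => z.
  by rewrite /g indicE sqr_modulusE /=; case: (_ \in _) => /=; lra.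
have [x fx] := f_surj (mkL2 nu g); have [_ /(_ x)[eta etax]] := rep_unitary pi (bs_u N).
have := wcompL2E measurable_shift mh h_integral (f eta).
have -> : wcompL2 measurable_shift mh h_integral (f eta) = mkL2 nu g.
  by rewrite -fx -etax shift_modelE.
move=> W; apply: filterS2 W (mkL2_fun sg) => z /(_ I) Wz /(_ I) gz.
apply/negP => /eqP hz; move: Wz; rewrite [LHS]gz /wcomp hz mulr0 /g indicE mem_set//.
by move/eqP; rewrite oner_eq0.
Qed.

Lemma model_exists : exists theta : solenoid R N -> R[i],
  [/\ quasi_invariant nu, measurable_fun setT theta, forall z, `|theta z| = 1,
   forall eta, L2_fun (f (pi (bs_u N) eta)) = op_U nu theta (L2_fun (f eta)) %[ae nu] &
   forall eta, L2_fun (f (pi (bs_t N) eta)) = op_T (L2_fun (f eta)) %[ae nu]].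
Proof.
exists (phase h); split.
- split; [exact: (shifted_dominated sh h_chi)|exact: (dominated_shifted sh h_chi h_neq0)].
- exact: (measurable_phase sh).
- by move=> z; exact: phase_norm.
- move=> eta; rewrite shift_modelE.
  have D := Delta_density sh h_chi.
  have W := wcompL2E measurable_shift mh h_integral (f eta).
  apply: filterS2 D W => z Dz /(_ I) Wz _.
  by rewrite [LHS]Wz /op_U Dz phase_density /wcomp mulrC.
- move=> eta.
  have -> : bs_t N = bs_frac N (0, 1, 0)%N.
    by rewrite /bs_frac /= invg1 mulg1 expg1 bs_root0.
  rewrite mul_chiE.
  have W := wcompL2E (@measurable_id _ _ setT) (@measurable_chi3 (0, 1, 0)%N)
    (@chi3_integral (0, 1, 0)%N) (f eta).
  apply: filterS W => z /(_ I) Wz _.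
  by rewrite [LHS]Wz /op_T /wcomp /chi3 /chi /= expr1 expr0 mulr1 mulrC.
Qed.

End shift_model.

Theorem proposition3p4 (R : realType) (N : nat) (N_ge2 : (2 <= N)%N)
    (H : hilbertType R[i]) (H_neq0 : exists x : H, x != 0)
    (pi : unitary_rep (BS N) H)
    (pi_cyclic : exists xi : H, cyclic_vector pi (bs_Zinv N) xi) :
  exists (nu : probability (solenoid R N) R) (theta : solenoid R N -> R[i])
         (rho : unitary_rep (BS N) (L2 nu)),
    [/\ quasi_invariant nu,
        measurable_fun setT theta,
        forall z, `|theta z| = 1,
        is_pi_nu_theta theta rho &
        unitarily_equivalent pi rho].
Proof.
have [xi0 cyc] := pi_cyclic.
have xi0_neq0 : xi0 != 0.
  apply/eqP => xi00; have [x x0] := H_neq0.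
  (* If [xi0] were 0, every combination would vanish, so approximating [x] to within [|x|] would
     give [|x| < |x|]. *)
  have [||s] := @cyclic_total _ _ _ pi xi0 1 _ cyc x (nrm x).
  - exact: oner_neq0.
  - by rewrite lt_neqAle nrm_ge0 andbT eq_sym; apply: contra_neq x0 => /nrm_eq0.
  rewrite /lincomb big1 ?subr0 ?ltxx// => p _.
  by rewrite xi00 scaler0 linear0 scaler0.
pose c : R[i] := (nrm xi0)^-1%:C%C.
have nrm_gt0 : 0 < nrm xi0.
  by rewrite lt_neqAle nrm_ge0 andbT eq_sym; apply: contra_neq xi0_neq0 => /nrm_eq0.
have c0 : c != 0.
  by rewrite /c fmorph_eq0 invr_eq0 gt_eqF.
pose xi := c *: xi0.
have xi1 : nrm xi = 1.
  rewrite /xi nrmZ /c ger0_norm ?lecR ?invr_ge0 ?nrm_ge0//=.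
  by rewrite mulVf// gt_eqF.
have tot : total (fun i => pi (bs_frac N i) xi) := cyclic_total c0 cyc.
have [nu nu_chi0] := spectral_measure_exists (A := fun p => pi (bs_root N p)) N_ge2
  (fun p => @rep_isometric _ _ _ pi _)
  (fun p x => etrans (rep_iter pi _ _ x) (congr1 (fun g => pi g x) (bs_rootS N p))) xi1.
have nu_chi p K L : cintegral nu (chi p K L) =
  inner (pi (bs_root N p ^+ K)%g xi) (pi (bs_root N p ^+ L)%g xi).
  by rewrite nu_chi0 !rep_iter.
have gram := spectral_gram nu_chi.
have [f [[_ f_surj] f_iso f_frac]] := unitary_extension (@hilbert_fast_complete R H)
  (@L2_fast_complete _ _ R nu) tot (@total_chiL2 R N nu) gram.
(* The inverse of [f] is obtained as a linear map by extending in the opposite direction; both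
   composites fix a total family. *)
have [g [[_ g_surj] g_iso g_frac]] := unitary_extension
  (@L2_fast_complete _ _ R nu) (@hilbert_fast_complete R H) (@total_chiL2 R N nu) tot
  (fun i j => esym (gram i j)).
have fgK : f \o g =1 idfun.
  apply: (isometric_total_eq (f := f \o g) (g := idfun) _ _ (@total_chiL2 R N nu)) => //.
    by move=> y; rewrite /= f_iso g_iso.
  by move=> i; rewrite /= g_frac f_frac.
have gfK : g \o f =1 idfun.
  apply: (isometric_total_eq (f := g \o f) (g := idfun) _ _ tot) => //.
    by move=> x; rewrite /= g_iso f_iso.
  by move=> i; rewrite /= f_frac g_frac.
have [theta [qi mt nt fu ft]] := model_exists nu_chi tot f_iso f_surj f_frac.
have rhoU k : Defs.is_unitary (f \o pi k \o g).
  split=> [x y|y]; first by rewrite /= (isometric_inner f_iso) rep_inner (isometric_inner g_iso).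
  by exists (f (pi k^-1%g (g y))); rewrite /= [g _]gfK -repM mulgV rep1 [f _]fgK.
have rho1 y : (f \o pi 1%g \o g) y = y by rewrite /= rep1 [LHS]fgK.
have rhoM k l y : (f \o pi (k * l)%g \o g) y = (f \o pi k \o g) ((f \o pi l \o g) y).
  by rewrite /= [g (f _)]gfK repM.
exists nu, theta, (UnitaryRep rhoU rho1 rhoM); split => //.
- split=> y /=.
    by have := fu (g y); rewrite [f (g y)]fgK.
  by have := ft (g y); rewrite [f (g y)]fgK.
- exists f; first by split; [exact: isometric_inner|].
  by move=> k x; rewrite /= [g _]gfK.
Qed.
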